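(* Let $d\geq 1$. (a) Let $p\in[1,2)$. There is a finite constant $C_{d,p}$ depending only on $d$ and $p$ such that for every $f\in L^p(\mathbb{R}^d)$, $$\Big\|\sup_{R_1,\ldots,R_d\in(0,\infty)}\big|\mathcal{F}\big(f\mathbf{1}_{[-R_1,R_1]\times\cdots\times[-R_d,R_d]}\big) \big| \Big\|_{L^{p'}(\mathbb{R}^d)} \leq C_{d,p}\, \|f\|_{L^p(\mathbb{R}^d)},$$ and the $d$-parameter convergence $$\lim_{R_1\to\infty,\ldots,R_d\to\infty} \int_{[-R_1,R_1]\times\cdots\times[-R_d,R_d]} f(x) e^{-2\pi i x\cdot\xi} \,\mathrm{d}x = \widehat{f}(\xi)$$ holds for a.e. $\xi\in\mathbb{R}^d$. (b) If $d\geq 2$, then there exist a function $f\in L^2(\mathbb{R}^d)$ and a set $Q\subseteq\mathbb{R}^d$ of positive measure such that $$\limsup_{R_1\to\infty,\ldots,R_d\to\infty} \bigg|\int_{[-R_1,R_1]\times\cdots\times[-R_d,R_d]} f(x) e^{-2\pi i x\cdot\xi} \,\mathrm{d}x\bigg|=\infty \quad \text{for every } \xi\in Q.$$ In particular, even the weak $L^2$ estimate fails for $d\geq 2$: there is no finite constant $C_d$ such that $$\Big\|\sup_{R_1,\ldots,R_d\in(0,\infty)}\big|\mathcal{F}\big(f\mathbf{1}_{[-R_1,R_1]\times\cdots\times[-R_d,R_d]}\big) \big| \Big\|_{L^{2,\infty}(\mathbb{R}^d)} \leq C_d\, \|f\|_{L^2(\mathbb{R}^d)}$$ holds for every $f\in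 L^2(\mathbb{R}^d)$.
   Context: The Fourier transform is $(\mathcal{F}f)(\xi)=\widehat{f}(\xi)=\int_{\mathbb{R}^d} f(x)e^{-2\pi i x\cdot\xi}\,\mathrm{d}x$ for integrable $f$, extended as usual to $L^p(\mathbb{R}^d)$, $1\leq p\leq 2$. $\mathbf{1}_A$ is the indicator function of $A$; $p'$ is the conjugate exponent, $1/p+1/p'=1$ (with $p'=\infty$ when $p=1$). The multi-parameter limits and limsup are taken as $R_1,\ldots,R_d$ tend to infinity independently (i.e. as $\min_j R_j\to\infty$). $L^{2,\infty}$ is the weak $L^2$ space, with quasinorm $\|g\|_{L^{2,\infty}(\mathbb{R}^d)}=\sup_{\alpha>0}\alpha\,|\{\xi\in\mathbb{R}^d:|g(\xi)|>\alpha\}|^{1/2}$. *)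

(* Defs.v *)
From HB Require Import structures.
From mathcomp Require Import all_boot all_order all_algebra.
From mathcomp Require Import complex.
From mathcomp Require Import all_classical all_reals all_analysis.

Set Implicit Arguments.
Unset Strict Implicit.
Unset Printing Implicit Defensive.

Import Order.TTheory GRing.Theory Num.Theory.
Import numFieldNormedType.Exports.

Local Open Scope classical_set_scope.
Local Open Scope ring_scope.

Section lebesgue_Rn.
Context {R : realType}.

Definition tuple_cons n (x : R * n.-tuple R) : n.+1.-tuple R :=
  [tuple of x.1 :: x.2].

Lemma measurable_tuple_cons n : measurable_fun setT (@tuple_cons n).
Proof. exact: measurable_cons. Qed.

(* Lebesgue measure on R^n (on the Borel sigma-algebra), as the n-fold product
   of the one-dimensional Lebesgue measure. *)
Fixpoint lebesgue_Rn n : set (n.-tuple R) -> \bar R :=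
  match n with
  | 0 => @dirac _ (0.-tuple R) [tuple] R
  | n.+1 => pushforward (@lebesgue_measure R \x @lebesgue_Rn n)%E (@tuple_cons n)
  end.

Lemma lebesgue_Rn_sigma_finite_measure n :
  exists m : {sigma_finite_measure set (n.-tuple R) -> \bar R},
    m = @lebesgue_Rn n :> (set (n.-tuple R) -> \bar R).
Proof.
elim: n => [|n [m mE]].
  by exists (@dirac _ (0.-tuple R) [tuple] R : {sigma_finite_measure set _ -> \bar R}).
pose lm : {measure set _ -> \bar R} :=
  product_measure1 (@lebesgue_measure R) m.
pose M := pushforward lm (@tuple_cons n).
have M0 : M set0 = 0%E by rewrite /M /pushforward preimage_set0 measure0.
have Mge0 A : (0 <= M A)%E by rewrite /M /pushforward; exact: (measure_ge0 lm).
have mcons (A : set (n.+1.-tuple R)) :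
    measurable A -> measurable (@tuple_cons n @^-1` A).
  move=> mA; rewrite -[X in measurable X]setTI.
  exact: measurable_tuple_cons.
have Msigma : semi_sigma_additive M.
  move=> F mF tF mUF; rewrite /M /pushforward preimage_bigcup.
  apply: measure_semi_sigma_additive.
  - by move=> k; exact: mcons.
  - apply/trivIsetP => /= i j _ _ ij; rewrite -preimage_setI.
    by move/trivIsetP : tF => /(_ _ _ _ _ ij) ->//; rewrite preimage_set0.
  - by rewrite -preimage_bigcup; exact: mcons.
have Msf : sigma_finite setT M.
  have [F FT Ffin] : sigma_finite setT lm.
    have /sigma_finiteP[F [TF ndF Foo]] := sigma_finiteT (@lebesgue_measure R).
    have /sigma_finiteP[G [TG ndG Goo]] := sigma_finiteT m.
    exists (fun k => F k `*` G k).
      rewrite -setXTT TF TG predeqE => -[x y]; split.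
        move=> [/= [i _ Fix] [k _ Gky]]; exists (maxn i k) => //; split.
        - by move: x Fix; exact/subsetPset/ndF/leq_maxl.
        - by move: y Gky; exact/subsetPset/ndG/leq_maxr.
      by move=> [k _ []/= ? ?]; split; exists k.
    move=> k; have [? ?] := Foo k; have [? ?] := Goo k.
    split; first exact: measurableX.
    by rewrite /lm/= product_measure1E// lte_mul_pinfty// ge0_fin_numE.
  pose u (t : n.+1.-tuple R) : R * n.-tuple R := (thead t, [tuple of behead t]).
  have uK : cancel (@tuple_cons n) u.
    by case=> x t; rewrite /u theadE; congr pair; exact/val_inj.
  have mu : measurable_fun setT u.
    by apply/measurable_fun_pair; [exact: measurable_tnth|exact: measurable_behead].
  exists (fun k => u @^-1` F k); first by rewrite -preimage_bigcup -FT.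
  move=> k; split; first by rewrite -[X in measurable X]setTI; apply: mu => //; apply (Ffin k).1.
  rewrite /M /pushforward -comp_preimage (_ : u \o _ = id) ?preimage_id ?(Ffin k).2//.
  exact/funext.
have ME : M = @lebesgue_Rn n.+1 by rewrite /= -mE.
clearbody M; have MM := isMeasure.Build _ _ _ M M0 Mge0 Msigma.
pose M1 : {measure set _ -> \bar R} := HB.pack M MM.
have MS := Measure_isSigmaFinite.Build _ _ _ M1 Msf.
pose M2 : {sigma_finite_measure set _ -> \bar R} := HB.pack M MM MS.
by exists M2.
Qed.

Section instances.
Variable n : nat.

Let lebesgue_Rn0 : @lebesgue_Rn n set0 = 0%E.
Proof.
by have [m <-] := lebesgue_Rn_sigma_finite_measure n; rewrite measure0.
Qed.

Let lebesgue_Rn_ge0 A : (0 <= @lebesgue_Rn n A)%E.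
Proof.
have [m <-] := lebesgue_Rn_sigma_finite_measure n; exact: (measure_ge0 m).
Qed.

Let lebesgue_Rn_sigma_additive : semi_sigma_additive (@lebesgue_Rn n).
Proof.
have [m <-] := lebesgue_Rn_sigma_finite_measure n.
exact: measure_semi_sigma_additive.
Qed.

HB.instance Definition _ := isMeasure.Build _ _ _ (@lebesgue_Rn n)
  lebesgue_Rn0 lebesgue_Rn_ge0 lebesgue_Rn_sigma_additive.

Let lebesgue_Rn_sigma_finite : sigma_finite setT (@lebesgue_Rn n).
Proof.
have [m <-] := lebesgue_Rn_sigma_finite_measure n; exact: (sigma_finiteT m).
Qed.

HB.instance Definition _ := Measure_isSigmaFinite.Build _ _ _ (@lebesgue_Rn n)
  lebesgue_Rn_sigma_finite.

End instances.
End lebesgue_Rn.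

Section fourier.
Context {R : realType} {d : nat}.
Local Notation mu := (@lebesgue_Rn R d).
Implicit Types (p : \bar R) (f g h : d.-tuple R -> R[i]) (x xi : d.-tuple R).
Implicit Types (r : 'rV[R]_d).

Definition dot x xi : R := \sum_(j < d) tnth x j * tnth xi j.

(* e^{-2 pi i x.xi} *)
Definition fourier_kernel x xi : R[i] :=
  (cos (2 * pi * dot x xi) -i* sin (2 * pi * dot x xi))%C.

Definition cmeasurable f :=
  measurable_fun setT (fun x => complex.Re (f x)) /\
  measurable_fun setT (fun x => complex.Im (f x)).

Definition cintegral (D : set (d.-tuple R)) f : R[i] :=
  (Rintegral mu D (fun x => complex.Re (f x)) +i*
   Rintegral mu D (fun x => complex.Im (f x)))%C.

Definition cLnorm p f : \bar R := Lnorm mu p (fun x => (Normc.normc (f x))%:E).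

Definition cLp p f := cmeasurable f /\ (cLnorm p f < +oo)%E.

Definition box r : set (d.-tuple R) :=
  [set x | forall j, - r ord0 j <= tnth x j <= r ord0 j].

Definition fourier_integral f xi : R[i] :=
  cintegral setT (fun x => f x * fourier_kernel x xi).

Definition box_fourier_integral f r xi : R[i] :=
  cintegral (box r) (fun x => f x * fourier_kernel x xi).

(* g is the value at f of the continuous extension to L^p -> L^{p'} of the
   Fourier transform defined on the dense subspace L^1 \cap L^p. *)
Definition fourier_extension p f g :=
  cmeasurable g /\
  forall e : R, 0 < e -> exists2 del : R, 0 < del &
    forall h, cLp 1 h -> cLp p h -> (cLnorm p (h \- f)%R < del%:E)%E ->
      (cLnorm (hoelder_conjugate p) (fourier_integral h \- g)%R < e%:E)%E.

(* The extension is determined up to a null set only; a representative is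
   chosen, except for integrable f where the integral formula is used. *)
Definition fourier p f : d.-tuple R -> R[i] :=
  if `[< cLp 1 f >] then fourier_integral f
  else xget (fun=> 0) [set g | fourier_extension p f g].

(* f 1_{box r} *)
Definition cut r f x : R[i] := f x * (\1_(box r) x)%:C%C.

Definition maximal_fourier f xi : \bar R :=
  ereal_sup [set (Normc.normc (fourier_integral (cut r f) xi))%:E |
             r in [set r : 'rV[R]_d | forall j, 0 < r ord0 j]].

(* the filter of R_1, ..., R_d -> +oo independently *)
Definition all_pinfty : set_system 'rV[R]_d :=
  [set A | exists M : R, forall r : 'rV[R]_d, (forall j, M < r ord0 j) -> A r].

Global Instance all_pinfty_filter : ProperFilter all_pinfty.
Proof.
apply: Build_ProperFilter => [[M MP]|].
  by apply: (MP (const_mx (M + 1))) => j; rewrite mxE ltrDl.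
split; first by exists 0.
- move=> P Q [M MP] [N NQ]; exists (Num.max M N) => r rMN; split.
  + by apply: MP => j; move: (rMN j); rewrite gt_max => /andP[].
  + by apply: NQ => j; move: (rMN j); rewrite gt_max => /andP[].
- by move=> P Q PQ [M MP]; exists M => r rM; exact/PQ/MP.
Qed.

(* the L^{2,oo} quasinorm *)
Definition weakL2norm (g : d.-tuple R -> \bar R) : \bar R :=
  ereal_sup [set (a%:E * (mu [set xi | a%:E < `|g xi|]) `^ 2^-1)%E |
             a in [set a : R | 0 < a]].

End fourier.

(* Main.v *)
Require Import Defs.
From mathcomp Require Import all_boot all_order all_algebra.
From mathcomp Require Import complex.
From mathcomp Require Import all_classical all_reals all_analysis.
From mathcomp Require Import measurable_realfun ring lra.

Set Implicit Arguments.
Unset Strict Implicit.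
Unset Printing Implicit Defensive.

Import Order.TTheory GRing.Theory Num.Theory.
Import numFieldNormedType.Exports.

Local Open Scope classical_set_scope.
Local Open Scope ring_scope.

(* For p = 1 the maximal bound is trivial.  For 1 < p < 2, Plancherel's theorem and
   the L^1 -> L^oo bound interpolate to the Hausdorff-Young inequality.  Since p' > p,
   the Christ-Kiselev lemma, applied to one coordinate after the other, upgrades it to
   the maximal function.  Almost everywhere convergence follows by applying the maximal
   bound to the tails of f outside large cubes.

   For p = 2 and d = 2 the obstruction is the resonance
     a (xy) - x xi - y eta = a (eta/a - x) (xi/a - y) - xi eta / a:
   at R = (eta/a, xi/a) the truncated Fourier integral of a e^{2 pi i a xy} is of order
   log (1/a), whereas the L^2 norm of this function on [0, 2/a]^2 does not depend on a.
   A square summable superposition over rapidly decreasing values of a, living on disjoint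
   annuli, diverges for all xi, eta in [1, 2].  In dimension d > 2 one takes the tensor
   product with indicator functions of [0, 1]. *)

(** The Christ-Kiselev lemma is stated for nonnegative subadditive set operators [U E y] bounded
    through an additive mass [nu]. The maximal operator over one coordinate is again of this kind,
    though no longer linear, so the lemma can be applied to its own output. The gain comes from the
    exponent q/p > 1 of [nu], which is lost at p = 2. The bounds are proved for finitely many radii
    with constants independent of their number; the supremum over all boxes is then recovered from
    countably many. Up to that point everything is real: the transforms have kernel cos (2 pi x.xi -
    c), and a complex Fourier integral combines four of them. Plancherel is needed only as an
    inequality with some constant, so neither inversion nor sharp constants enter. For
    non-integrable f the transform is only given as an extension by continuity. The a.e. limit of
    the truncated integrals is therefore constructed first, then shown to be a value of that
    extension, and finally identified with [fourier p f] by uniqueness up to a null set. *)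

Lemma le_of_eq {d} {T : porderType d} (x y : T) : x = y -> (x <= y)%O.
Proof. by move=> ->. Qed.

Lemma seq_argmax {T : eqType} {R : realType} (f : T -> R) (s : seq T) :
  s != [::] -> exists2 r, r \in s & forall r', r' \in s -> f r' <= f r.
Proof.
elim: s => // a s IH _.
have [->|/IH[r rs rmax]] := eqVneq s [::].
  by exists a; rewrite ?mem_seq1// => r'; rewrite mem_seq1 => /eqP ->.
have [ar|ra] := leP (f a) (f r).
  exists r; first by rewrite inE rs orbT.
  by move=> r'; rewrite inE => /orP[/eqP->//|/rmax].
exists a; first by rewrite inE eqxx.
move=> r'; rewrite inE => /orP[/eqP->//|/rmax r'r].
exact: le_trans r'r (ltW ra).
Qed.

(** Either b <= M a or a < b / M. The point of the parameter is that for large M the factor of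
    [b ^ q] is close to 1. *)
Lemma powRD_le {R : realType} (q M a b : R) : 0 <= q -> 0 < M -> 0 <= a -> 0 <= b ->
  (a + b) `^ q <= (1 + M) `^ q * a `^ q + (1 + M^-1) `^ q * b `^ q.
Proof.
move=> q0 M0 a0 b0; rewrite -!powRM ?addr_ge0// ?invr_ge0 ?(ltW M0)//.
have [bMa|Mab] := leP b (M * a).
  apply: (@le_trans _ _ (((1 + M) * a) `^ q)); last by rewrite lerDl powR_ge0.
  apply: ge0_ler_powR => //; rewrite ?nnegrE ?mulr_ge0 ?addr_ge0 ?(ltW M0)//; lra.
apply: (@le_trans _ _ (((1 + M^-1) * b) `^ q)); last by rewrite lerDr powR_ge0.
apply: ge0_ler_powR => //; rewrite ?nnegrE ?mulr_ge0 ?addr_ge0 ?invr_ge0 ?(ltW M0)//.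
by rewrite mulrDl mul1r addrC lerD2l mulrC ler_pdivlMr// mulrC ltW.
Qed.

(** * The Christ-Kiselev lemma *)

(* With [M] chosen so that [(1 + M^-1) ^ q = delta], this is the fixed point
   [K' = (1 + M) ^ q * K + delta^-1 * K'] of the recursion on the set of radii. *)
Definition christ_kiselev_const {R : realType} (q alpha K : R) : R :=
  let delta := 2 `^ ((alpha - 1) / 2) in
  (1 + (delta `^ q^-1 - 1)^-1) `^ q * K / (1 - delta^-1).

Section christ_kiselev.
Context {R : realType} {dX dY : measure_display}.
Context {X : measurableType dX} {Y : measurableType dY}.
Context (mu : {measure set Y -> \bar R}) (nu : set X -> R) (q alpha : R).
Hypothesis nu_ge0 : forall E, 0 <= nu E.
Hypothesis nuU : forall E F, measurable E -> measurable F -> E `&` F = set0 ->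
  nu (E `|` F) = nu E + nu F.
Hypothesis q_gt0 : 0 < q.
Hypothesis alpha_gt1 : 1 < alpha.

(** The model is U E = |T (g 1_E)| with [nu E] the integral of |g|^p over E; the last clause is then
    the L^p to L^q bound, with [alpha] = q / p. Subadditivity on disjoint sets stands in for
    linearity because it survives taking maxima. *)
Definition set_operator_bounded (K : R) (U : set X -> Y -> R) :=
  [/\ forall E y, 0 <= U E y,
      forall E, measurable E -> measurable_fun setT (U E),
      forall E F y, measurable E -> measurable F -> E `&` F = set0 ->
        U (E `|` F) y <= U E y + U F y &
      forall E, measurable E ->
        (\int[mu]_y (U E y `^ q)%:E <= (K * nu E `^ alpha)%:E)%E].

Definition set_maximal (phi : X -> R) (s : seq R) (U : set X -> Y -> R) E y :=
  \big[Num.max/0]_(r <- s) U (E `&` [set x | phi x <= r]) y.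

Variable phi : X -> R.
Hypothesis mphi : measurable_fun setT phi.

Let msub r : measurable [set x | phi x <= r].
Proof.
rewrite -[X in measurable X]setTI.
exact: (measurable_fun_le measurableT mphi (measurable_cst r)).
Qed.

Let msup r : measurable [set x | r < phi x].
Proof.
rewrite (_ : [set x | _] = ~` [set x | phi x <= r]); first exact: measurableC.
by apply/seteqP; split => x /=; rewrite real_ltNge ?num_real// => /negP.
Qed.

Lemma set_maximal_ge0 s U E y : 0 <= set_maximal phi s U E y.
Proof. by rewrite /set_maximal; elim/big_rec: _ => // r x _ x0; rewrite le_max x0 orbT. Qed.

Lemma set_maximal_ge s U E y r : r \in s ->
  U (E `&` [set x | phi x <= r]) y <= set_maximal phi s U E y.
Proof.
by move=> rs; rewrite /set_maximal; exact: le_bigmax_seq.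
Qed.

Lemma set_maximal_le s U E y c : 0 <= c ->
  (forall r, r \in s -> U (E `&` [set x | phi x <= r]) y <= c) ->
  set_maximal phi s U E y <= c.
Proof.
move=> c0 H; rewrite /set_maximal big_seq; elim/big_rec: _ => // r x rs xc.
by rewrite ge_max H.
Qed.

Lemma measurable_set_maximal s U E :
  (forall E, measurable E -> measurable_fun setT (U E)) ->
  measurable E -> measurable_fun setT (set_maximal phi s U E).
Proof.
move=> mU mE; rewrite /set_maximal; elim: s => [|r s IH].
  by under eq_fun do rewrite big_nil; exact: measurable_cst.
under eq_fun do rewrite big_cons.
by apply: measurable_maxr => //; apply: mU; exact: measurableI.
Qed.

(** With A and B the parts of E where phi <= m and m < phi, a sublevel set of level r > m is A
    together with a sublevel set of B. Hence the maximum is at most U A + max (VL, VR), with VL and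
    VR the maxima over the radii below and above m. The q-th power of that inner maximum is bounded
    by a sum, and [powRD_le] keeps the factor in front of it close to 1. *)
Let integral_split K U s m E N Ks M : set_operator_bounded K U ->
  0 <= K -> 0 < M -> measurable E ->
  nu (E `&` [set x | phi x <= m]) <= N ->
  let sL := [seq r <- s | r < m] in let sR := [seq r <- s | m < r] in
  (\int[mu]_y (set_maximal phi sL U E y `^ q)%:E <= Ks%:E)%E ->
  (\int[mu]_y (set_maximal phi sR U (E `&` [set x | (m < phi x)%R]) y `^ q)%:E
     <= Ks%:E)%E ->
  (\int[mu]_y (set_maximal phi s U E y `^ q)%:E <=
   ((1 + M) `^ q * (K * N `^ alpha) + (1 + M^-1) `^ q * (Ks + Ks))%:E)%E.
Proof.
move=> [U0 mU UU UK] K0 M0 mE NE sL sR IL IR.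
set A := E `&` [set x | phi x <= m] in NE *.
set B := E `&` [set x | m < phi x] in IR *.
have mA : measurable A by exact: measurableI.
have mB : measurable B by exact: measurableI.
have mpow (f : Y -> R) : measurable_fun setT f ->
    measurable_fun setT (fun y => (f y `^ q)%:E).
  move=> mf; apply/measurable_EFinP.
  by apply: (measurableT_comp (measurable_powR q)).
pose VL := set_maximal phi sL U E; pose VR := set_maximal phi sR U B.
have mVL : measurable_fun setT VL by exact: measurable_set_maximal.
have mVR : measurable_fun setT VR by exact: measurable_set_maximal.
have key y : set_maximal phi s U E y <= U A y + Num.max (VL y) (VR y).
  apply: set_maximal_le; first by rewrite addr_ge0// le_max set_maximal_ge0.
  move=> r rs; have [rm|mr|->] := ltgtP r m.
  - apply: (@le_trans _ _ (VL y)); last by rewrite ler_wpDl// le_max lexx.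
    by apply: set_maximal_ge; rewrite mem_filter rm.
  - apply: (@le_trans _ _ (U A y + VR y)); last by rewrite lerD2l le_max lexx orbT.
    apply: (@le_trans _ _ (U A y + U (B `&` [set x | phi x <= r]) y)); last first.
      by rewrite lerD2l; apply: set_maximal_ge; rewrite mem_filter mr.
    have -> : E `&` [set x | phi x <= r] = A `|` (B `&` [set x | phi x <= r]).
      apply/seteqP; split=> x /=.
        by move=> [Ex xr]; have [xm|mx] := leP (phi x) m; [left|right].
      by move=> [[Ex xm]|[[Ex mx] xr]]; split=> //; exact: le_trans xm (ltW mr).
    apply: UU => //; first exact: measurableI.
    rewrite -subset0 => x [[_ /= xm] [[_ /= mx] _]].
    by move: (lt_le_trans mx xm); rewrite ltxx.
  - by rewrite lerDl le_max set_maximal_ge0.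
have q0 := ltW q_gt0.
have key2 y : set_maximal phi s U E y `^ q <= (1 + M) `^ q * U A y `^ q +
   (1 + M^-1) `^ q * (VL y `^ q + VR y `^ q).
  apply: (@le_trans _ _ ((U A y + Num.max (VL y) (VR y)) `^ q)).
    apply: ge0_ler_powR => //; rewrite nnegrE ?set_maximal_ge0//.
    by rewrite addr_ge0// le_max set_maximal_ge0.
  apply: (le_trans (powRD_le q0 M0 _ _)) => //.
    by rewrite le_max set_maximal_ge0.
  rewrite lerD2l ler_wpM2l ?powR_ge0//.
  by case: (leP (VL y) (VR y)) => _; [rewrite lerDr|rewrite lerDl]; rewrite powR_ge0.
apply: (@le_trans _ _ (\int[mu]_y (((1 + M) `^ q)%:E * (U A y `^ q)%:E +
   ((1 + M^-1) `^ q)%:E * ((VL y `^ q)%:E + (VR y `^ q)%:E)))%E).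
  apply: ge0_le_integral => //=.
  - by move=> y _; rewrite lee_fin powR_ge0.
  - by apply: mpow; exact: measurable_set_maximal.
  - apply: emeasurable_funD; apply: measurable_funeM; first exact: mpow (mU _ mA).
    by apply: emeasurable_funD; exact: mpow.
  - by move=> y _; rewrite lee_fin key2.
rewrite ge0_integralD//=; last 4 first.
- by move=> y _; rewrite -EFinM lee_fin mulr_ge0 ?powR_ge0.
- by apply: measurable_funeM; exact: mpow (mU _ mA).
- by move=> y _; rewrite -EFinD -EFinM lee_fin mulr_ge0 ?addr_ge0 ?powR_ge0.
- by apply: measurable_funeM; apply: emeasurable_funD; exact: mpow.
rewrite ge0_integralZl//=; last 3 first.
- exact: mpow (mU _ mA).
- by move=> y _; rewrite lee_fin powR_ge0.
- by rewrite lee_fin powR_ge0.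
rewrite ge0_integralZl//=; last 3 first.
- by apply: emeasurable_funD; exact: mpow.
- by move=> y _; rewrite -EFinD lee_fin addr_ge0 ?powR_ge0.
- by rewrite lee_fin powR_ge0.
rewrite ge0_integralD//=; last 4 first.
- by move=> y _; rewrite lee_fin powR_ge0.
- exact: mpow.
- by move=> y _; rewrite lee_fin powR_ge0.
- exact: mpow.
rewrite EFinD; apply: leeD.
  rewrite (EFinM ((1 + M) `^ q)) lee_wpmul2l ?lee_fin ?powR_ge0//.
  apply: (le_trans (UK _ mA)); rewrite lee_fin ler_wpM2l//.
  apply: ge0_ler_powR; rewrite ?nnegrE ?nu_ge0//.
    by rewrite (le_trans _ (ltW alpha_gt1)).
  exact: le_trans NE.
rewrite (EFinM ((1 + M^-1) `^ q)) lee_wpmul2l ?lee_fin ?powR_ge0//.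
rewrite EFinD; exact: leeD IL IR.
Qed.

(** Induction on the number of radii, with a constant that does not see this number. The induction
    bounds the masses of the sublevel sets of E rather than [nu E], since the recursive call on the
    smaller radii keeps E itself. Two calls of mass N / 2 cost 2 (N / 2)^alpha = delta^-2 N^alpha;
    one factor delta is spent on [powRD_le], the other makes the recursion contract. *)
Lemma set_maximal_bounded (K : R) : 0 <= K ->
  let K' := christ_kiselev_const q alpha K in
  0 <= K' /\ forall s U, set_operator_bounded K U ->
    set_operator_bounded K' (set_maximal phi s U).
Proof.
move=> K0.
have q0 := ltW q_gt0.
pose delta : R := 2 `^ ((alpha - 1) / 2).
have a12 : 0 < (alpha - 1) / 2 by rewrite divr_gt0// subr_gt0.
have delta1 : 1 < delta.
  have <- : 1 `^ ((alpha - 1) / 2) = 1 :> R by rewrite powR1.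
  by apply: gt0_ltr_powR => //; rewrite ?nnegrE// ltr1n.
have delta0 : 0 < delta by rewrite (lt_trans _ delta1).
have deltaE : delta * (2^-1 `^ alpha + 2^-1 `^ alpha) = delta^-1.
  have dd : delta * delta = 2 `^ (alpha - 1).
    rewrite /delta -powRD; last by rewrite pnatr_eq0 implybT.
    by rewrite -splitr.
  have h : 2^-1 `^ alpha * (delta * delta * 2) = 1.
    rewrite dd mulrC mulrC [_ * 2]mulrC mulr_powRB1//; last first.
      by rewrite (lt_trans _ alpha_gt1).
    by rewrite -powRM ?invr_ge0// mulVf ?pnatr_eq0// powR1.
  apply: (mulIf (lt0r_neq0 delta0)); rewrite mulVf ?gt_eqF//.
  by rewrite -[RHS]h; ring.
have dq1 : 1 < delta `^ q^-1.
  have <- : 1 `^ q^-1 = 1 :> R by rewrite powR1.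
  by apply: gt0_ltr_powR => //; rewrite ?nnegrE ?invr_gt0// ltW.
pose M := (delta `^ q^-1 - 1)^-1.
have M0 : 0 < M by rewrite invr_gt0 subr_gt0.
have MqE : (1 + M^-1) `^ q = delta.
  by rewrite invrK addrC subrK -powRrM mulVf ?gt_eqF// powRr1 ?ltW.
have dV1 : 0 < 1 - delta^-1 by rewrite subr_gt0 invf_lt1.
rewrite /christ_kiselev_const; set K' := _ / _.
have K'0 : 0 <= K' by rewrite divr_ge0 ?(ltW dV1)// mulr_ge0 ?powR_ge0.
have K'E : (1 + M) `^ q * K + delta^-1 * K' = K'.
  have -> : (1 + M) `^ q * K = (1 - delta^-1) * K'.
    by rewrite /K' [RHS]mulrC divfK ?gt_eqF.
  by rewrite -mulrDl subrK mul1r.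
have a0 : 0 <= alpha by rewrite (le_trans _ (ltW alpha_gt1)).
(* The radii are split at the least one that catches half of the mass: the sets before
   it and the increments after it both have mass at most [N / 2]. *)
have bound n : forall s U E N, (size s <= n)%N -> set_operator_bounded K U ->
    measurable E -> 0 <= N ->
    (forall r, r \in s -> nu (E `&` [set x | phi x <= r]) <= N) ->
    (\int[mu]_y (set_maximal phi s U E y `^ q)%:E <= (K' * N `^ alpha)%:E)%E.
  elim: n => [|n IH] s U E N sn UK mE N0 sN.
    move: sn; rewrite leqn0 size_eq0 => /eqP ->; rewrite /set_maximal.
    under eq_integral do rewrite big_nil powR0 ?gt_eqF//.
    by rewrite integral0 lee_fin mulr_ge0// powR_ge0.
  have [s0|s0] := eqVneq s [::]; first by rewrite s0; apply: IH.
  (* The threshold is half of the largest mass N1 occurring on [s], not N / 2: some radius has to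
     reach it, and the increments beyond m must be at most N1 - N1 / 2. *)
  have [r1 r1s r1max] := seq_argmax (fun r => nu (E `&` [set x | phi x <= r])) s0.
  set N1 := nu (E `&` [set x | phi x <= r1]) in r1max.
  have N10 : 0 <= N1 by exact: nu_ge0.
  have [m [ms mN1 mmin]] : exists m, [/\ m \in s,
      N1 / 2 <= nu (E `&` [set x | phi x <= m]) &
      forall r, r \in s -> r < m -> nu (E `&` [set x | phi x <= r]) <= N1 / 2].
    pose t := [seq r <- s | N1 / 2 <= nu (E `&` [set x | phi x <= r])].
    have t0 : t != [::].
      have : r1 \in t.
        by rewrite mem_filter r1s andbT -/N1 ler_pdivrMr// ler_peMr// ler1n.
      by case: t.
    have [m] := seq_argmax (fun r : R => - r) t0.
    rewrite mem_filter => /andP[mN1 ms] mt; exists m; split => // r rs rm.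
    rewrite leNgt; apply/negP => /ltW Nr.
    have /mt : r \in t by rewrite mem_filter Nr.
    by rewrite lerN2 leNgt rm.
  have NK : (1 + M) `^ q * (K * N `^ alpha) + (1 + M^-1) `^ q *
      (K' * (N / 2) `^ alpha + K' * (N / 2) `^ alpha) = K' * N `^ alpha.
    rewrite MqE powRM ?invr_ge0// -[RHS](congr1 (fun z => z * _) K'E) -deltaE; ring.
  rewrite -NK.
  have N1N : N1 / 2 <= N / 2 by rewrite ler_pM2r ?invr_gt0//; exact: sN.
  have fsz (P : pred R) : ~~ P m -> (size [seq r <- s | P r] <= n)%N.
    move=> Pm; rewrite -ltnS (leq_trans _ sn)// size_filter -(count_predC P s).
    by rewrite -addn1 leq_add2l -has_count; apply/hasP; exists m.
  have [_ _ _ _] := UK.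
  apply: (integral_split (m := m)) => //.
  - exact: sN.
  - apply: IH => //; rewrite ?fsz ?ltxx// ?divr_ge0// => r.
    by rewrite mem_filter => /andP[rm rs]; rewrite (le_trans _ N1N) ?mmin.
  - apply: IH => //; rewrite ?fsz ?ltxx// ?divr_ge0//; first exact: measurableI.
    move=> r; rewrite mem_filter => /andP[mr rs]; rewrite (le_trans _ N1N)//.
    have := r1max _ rs.
    have -> : E `&` [set x | phi x <= r] = (E `&` [set x | phi x <= m]) `|`
        (E `&` [set x | m < phi x] `&` [set x | phi x <= r]).
      apply/seteqP; split=> x /=.
        by move=> [Ex xr]; have [xm|mx] := leP (phi x) m; [left|right].
      by move=> [[Ex xm]|[[Ex mx] xr]]; split=> //; exact: le_trans xm (ltW mr).
    rewrite nuU; [|exact: measurableI|by apply: measurableI => //; exact: measurableI|]; last first.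
      rewrite -subset0 => x [[_ /= xm] [[_ /= mx] _]].
      by move: (lt_le_trans mx xm); rewrite ltxx.
    by move: mN1; lra.
have nu_le A B : measurable A -> measurable B -> A `<=` B -> nu A <= nu B.
  move=> mA mB AB; rewrite -(setDUK AB).
  rewrite nuU//; [by rewrite lerDl|exact: measurableD|].
  by rewrite setDE setICA setICr setI0.
split=> // s U UK; have [U0 mU UU _] := UK; split.
- by move=> E y; exact: set_maximal_ge0.
- by move=> E mE; exact: measurable_set_maximal.
- move=> E F y mE mF EF; apply: set_maximal_le.
    by rewrite addr_ge0// set_maximal_ge0.
  move=> r rs; rewrite setIUl; apply: (le_trans (UU _ _ _ _ _ _)).
  + exact: measurableI.
  + exact: measurableI.
  + by rewrite setIACA EF set0I.
  + by rewrite lerD// set_maximal_ge.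
- move=> E mE; apply: (bound _ s U E _ (leqnn _)) => // r rs.
  by apply: nu_le => //; exact: measurableI.
Qed.
End christ_kiselev.

(** Each further function phi_m takes one more maximum of the operator obtained so far. The constant
    is quantified before [nu], [s] and [U], so it depends neither on the function transformed nor on
    the radii. *)
Lemma iterated_set_maximal {R : realType} {dX dY : measure_display}
    {X : measurableType dX} {Y : measurableType dY}
    (mu : {measure set Y -> \bar R}) (q alpha K : R) (phi : nat -> X -> R) m :
  0 < q -> 1 < alpha -> 0 <= K -> (forall j, measurable_fun setT (phi j)) ->
  exists2 K', 0 <= K' & forall (nu : set X -> R) (s : seq R) (U : set X -> Y -> R),
    (forall E, 0 <= nu E) ->
    (forall E F, measurable E -> measurable F -> E `&` F = set0 ->
      nu (E `|` F) = nu E + nu F) ->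
    set_operator_bounded mu nu q alpha K U ->
  exists2 V, set_operator_bounded mu nu q alpha K' V &
    forall (r : nat -> R) E y, (forall j, (j < m)%N -> r j \in s) ->
      U (E `&` [set x | forall j, (j < m)%N -> phi j x <= r j]) y <= V E y.
Proof.
move=> q0 alpha1 K0 mphi; elim: m => [|m [K1 K10 IH]].
  exists K => // nu s U nu0 nuU UK; exists U => // r E y _.
  rewrite (_ : [set x | _] = setT) ?setIT//.
  by apply/seteqP; split.
exists (christ_kiselev_const q alpha K1).
  (* Only the sign of the constant is wanted here, and it does not involve the mass, so the zero
     mass will do. *)
  have [] := @set_maximal_bounded _ _ _ _ _ mu (fun=> 0) q alpha _ _ q0 alpha1 _ (mphi 0%N)
    K1 K10 => //.
  by move=> *; rewrite addr0.
move=> nu s U nu0 nuU UK; have [V VK UV] := IH nu s U nu0 nuU UK.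
have [_ /(_ s _ VK) WK] := set_maximal_bounded mu nu0 nuU q0 alpha1 (mphi m) K10.
exists (set_maximal (phi m) s V) => // r E y rs.
apply: le_trans (set_maximal_ge _ _ _ _ (rs m (ltnSn m))).
rewrite (_ : [set x | _] = [set x | phi m x <= r m] `&`
  [set x | forall j, (j < m)%N -> phi j x <= r j]).
  by rewrite setIA; apply: UV => j jm; apply: rs; rewrite ltnS ltnW.
apply/seteqP; split => x /= xr.
  by split=> [|j jm]; apply: xr => //; rewrite ltnS ltnW.
by move=> j; rewrite ltnS leq_eqVlt => /predU1P[->|]; [exact: xr.1|exact: xr.2].
Qed.

(** The surviving terms form a geometric series of ratio 2^-b whose largest term is at most c^b; the
    bound is uniform in [L] and [n]. *)
Lemma geometric_cutoff_sum {R : realType} (b : R) : 0 < b -> exists2 D : R, 0 <= D &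
  forall n (L c : R), 0 <= L -> 0 <= c ->
  \sum_(0 <= k < n) (if L / 2 ^+ k <= c then (L / 2 ^+ k) `^ b else 0) <= D * c `^ b.
Proof.
move=> b0; pose rho : R := 2^-1 `^ b.
have rho1 : rho < 1.
  have <- : 1 `^ b = 1 :> R by rewrite powR1.
  by apply: gt0_ltr_powR => //; rewrite ?nnegrE ?invr_ge0//; lra.
have r0 : 0 < 1 - rho by rewrite subr_gt0.
exists (1 - rho)^-1; first by rewrite invr_ge0 ltW.
have pos c : 0 <= (1 - rho)^-1 * c `^ b by rewrite mulr_ge0 ?powR_ge0// invr_ge0 ltW.
elim=> [|n IH] L c L0 c0; first by rewrite big_geq.
have shift d : \sum_(1 <= k < n.+1) (if L / 2 ^+ k <= d then (L / 2 ^+ k) `^ b else 0)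
   = \sum_(0 <= k < n) (if (L / 2) / 2 ^+ k <= d then ((L / 2) / 2 ^+ k) `^ b else 0).
  rewrite big_add1 /=; apply: eq_bigr => k _.
  by rewrite -mulrA -invfM -exprS.
have L20 : 0 <= L / 2 by rewrite divr_ge0.
rewrite big_ltn// shift expr0 divr1; case: ifPn => [Lc|_]; last by rewrite add0r; exact: IH.
apply: (@le_trans _ _ ((1 - rho)^-1 * L `^ b)); last first.
  rewrite ler_wpM2l ?invr_ge0 ?(ltW r0)//.
  by apply: ge0_ler_powR; rewrite ?nnegrE// ltW.
have -> : (1 - rho)^-1 * L `^ b = L `^ b + (1 - rho)^-1 * (L / 2) `^ b.
  rewrite (powRM _ L0) ?invr_ge0// -/rho; field.
  by rewrite gt_eqF.
(* Once L <= c, all later terms are at most L / 2, so the cutoff may be lowered to L / 2 before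
   using induction. *)
rewrite lerD2l; apply: le_trans (IH _ _ L20 L20).
apply: ler_sum => k _; rewrite [in leRHS]ifT; last first.
  by rewrite ler_pdivrMr ?exprn_gt0// ler_peMr// exprn_ege1// ler1n.
by case: ifPn => // _; rewrite powR_ge0.
Qed.

Section nneseries_integral.
Context {R : realType} {d : measure_display} {T : measurableType d}.
Context (mu : {measure set T -> \bar R}).
Implicit Types (f : T -> \bar R) (u : nat -> T -> \bar R).
Local Open Scope ereal_scope.

Let measurable_series u : (forall k, measurable_fun setT (u k)) ->
  (forall k x, 0 <= u k x) -> measurable_fun setT (fun x => \sum_(k <oo) u k x).
Proof. by move=> mu0 u0; apply: ge0_emeasurable_sum. Qed.

Lemma integral_le_nneseries f u : measurable_fun setT f -> (forall x, 0 <= f x) ->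
  (forall k, measurable_fun setT (u k)) -> (forall k x, 0 <= u k x) ->
  (forall x, f x <= \sum_(k <oo) u k x) ->
  \int[mu]_x f x <= \sum_(k <oo) \int[mu]_x u k x.
Proof.
move=> mf f0 mu0 u0 fu; rewrite -integral_nneseries//.
by apply: ge0_le_integral => //; exact: measurable_series.
Qed.

Lemma nneseries_le_integral f u : measurable_fun setT f ->
  (forall k, measurable_fun setT (u k)) -> (forall k x, 0 <= u k x) ->
  (forall x, \sum_(k <oo) u k x <= f x) ->
  \sum_(k <oo) \int[mu]_x u k x <= \int[mu]_x f x.
Proof.
move=> mf mu0 u0 uf; rewrite -integral_nneseries//.
by apply: ge0_le_integral => //; [move=> x _; exact: nneseries_ge0|exact: measurable_series].
Qed.

Lemma nneseries_le (u : nat -> \bar R) c : (forall k, 0 <= u k) ->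
  (forall n, \sum_(0 <= k < n) u k <= c) -> \sum_(k <oo) u k <= c.
Proof.
move=> u0 uc; apply: lime_le; first exact: is_cvg_nneseries.
by apply: nearW => n; exact: uc.
Qed.

Lemma nneseries_ge (u : nat -> \bar R) k : (forall k, 0 <= u k) ->
  u k <= \sum_(k <oo) u k.
Proof.
move=> u0; apply: le_trans (nneseries_lim_ge k.+1 _) => //.
by rewrite big_nat_recr//= leeDr// sume_ge0.
Qed.
End nneseries_integral.

(** * Interpolation *)

Section interpolation.
Context {R : realType} {dX dY : measure_display}.
Context {X : measurableType dX} {Y : measurableType dY}.
Context (mX : {measure set X -> \bar R}) (mY : {measure set Y -> \bar R}).
Local Notation L1 g := (mX.-integrable setT (fun x => (g x)%:E)).
Context (T : (X -> R) -> Y -> R) (B p : R).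
Hypothesis mT : forall g, L1 g -> measurable_fun setT (T g).
Hypothesis TD : forall f g y, L1 f -> L1 g -> `|T (f \+ g) y| <= `|T f y| + `|T g y|.
Hypothesis T_sup : forall g y, L1 g -> (`|T g y|%:E <= \int[mX]_x `|g x|%:E)%E.
Hypothesis B_ge0 : 0 <= B.
Hypothesis T_L2 : forall g, L1 g ->
  (\int[mY]_y (T g y ^+ 2)%:E <= B%:E * \int[mX]_x (g x ^+ 2)%:E)%E.
Hypothesis p1 : 1 < p.
Hypothesis p2 : p < 2.

Let q := p / (p - 1).
Let p10 : 0 < p - 1. Proof. by rewrite subr_gt0. Qed.
Let p0 : 0 < p. Proof. by rewrite (lt_trans _ p1). Qed.
Let q20 : 0 < q - 2.
Proof. by rewrite /q subr_gt0 ltr_pdivlMr//; move: p1 p2; lra. Qed.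
Let q0 : 0 < q. Proof. by rewrite divr_gt0. Qed.

Let mpowR (d : measure_display) (Z : measurableType d) (f : Z -> R) r :
  measurable_fun setT f -> measurable_fun setT (fun x => (`|f x| `^ r)).
Proof.
move=> mf; apply: (measurableT_comp (measurable_powR r)).
exact: measurableT_comp.
Qed.

Let split_L1 (g : X -> R) (E : set X) : L1 g -> measurable E -> L1 (g \* \1_E).
Proof.
move=> ig mE; apply: (@le_integrable _ _ _ _ setT measurableT _ (EFin \o g)) => //.
  apply/measurable_EFinP; apply: measurable_funM; last exact: measurable_indic.
  by apply/measurable_EFinP; exact: measurable_int ig.
move=> x _ /=; rewrite lee_fin normrM ler_piMr// indicE.
by case: (x \in E); rewrite ?normr1 ?normr0.
Qed.

(** A real interpolation in which g is cut at a height depending on the dyadic level of T g. Since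
    one endpoint is L^1 to L^oo, the discarded part is controlled pointwise, and the L^2 bound
    handles the rest. Summing over the levels inside the integral over x leaves a geometric sum. *)
Lemma interpolation : exists2 K : R, 0 <= K & forall g (A : R), L1 g -> 0 <= A ->
  (\int[mX]_x (`|g x| `^ p)%:E <= A%:E)%E ->
  (\int[mY]_y (`|T g y| `^ q)%:E <= (K * A `^ (q - 1))%:E)%E.
Proof.
have [D D0 geo] := @geometric_cutoff_sum R _ q20.
(* The value |T g y|^q is split as |T g y|^(q - 2) |T g y|^2; the first factor uses |T g y| <= 2 l
   at level l, the second |T g y| <= 2 |T (h k) y|. *)
pose C : R := 2 `^ (q - 2) * 4.
have C0 : 0 <= C by rewrite mulr_ge0 ?powR_ge0.
exists (C * B * (D * 2 `^ (q - 2))); first by rewrite !mulr_ge0 ?powR_ge0.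
move=> g A ig A0 gA.
have mg : measurable_fun setT g by apply/measurable_EFinP; exact: measurable_int ig.
pose L := fine (\int[mX]_x `|g x|%:E).
have LE : (\int[mX]_x `|g x|%:E = L%:E)%E.
  by rewrite /L fineK//; exact: (integrable_fin_num _ (integrable_abse ig)).
have L0 : 0 <= L by rewrite -lee_fin -LE; apply: integral_ge0.
have TL y : `|T g y| <= L by rewrite -lee_fin -LE; exact: T_sup.
pose E k := [set x | L / 2 ^+ k * `|g x| `^ (p - 1) <= 2 * A].
have mE k : measurable (E k).
  rewrite -[X in measurable X]setTI; apply: measurable_fun_le => //.
  by apply: measurable_funM => //; exact: mpowR.
(* [g] is cut so that the part off [E k] contributes at most half of the level [L / 2 ^ k];
   where [|T g|] is of that order, the other part carries it. *)
pose h k := g \* \1_(E k).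
have indicB k x : \1_(~` E k) x = 1 - \1_(E k) x :> R.
  by rewrite indicC indicE; case: (x \in E k); rewrite ?subrr ?subr0.
have ih k : L1 (h k) by exact: split_L1.
have nn c r t : 0 <= c -> (0 <= (c * (r `^ (q - 2) * t ^+ 2))%:E)%E.
  move=> c0; rewrite lee_fin; apply: mulr_ge0 => //.
  by apply: mulr_ge0; [exact: powR_ge0|exact: sqr_ge0].
have key y : ((`|T g y| `^ q)%:E <=
   \sum_(k <oo) (C * ((L / 2 ^+ k) `^ (q - 2) * T (h k) y ^+ 2))%:E)%E.
  have [v0|v0] := eqVneq `|T g y| 0.
    by rewrite v0 powR0 ?gt_eqF//; apply: nneseries_ge0 => k _ _; exact: nn.
  have {v0}vp : 0 < `|T g y| by rewrite lt0r v0 /=.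
  (* A is about to be a divisor. If it were 0, then g = 0 a.e., so L = 0 and [TL] would contradict T
     g y != 0. *)
  have A_gt0 : 0 < A.
    rewrite lt0r A0 andbT; apply/eqP => A_eq0.
    suff L_eq0 : L = 0 by move: (lt_le_trans vp (TL y)); rewrite L_eq0 ltxx.
    apply: EFin_inj; rewrite -LE.
    have mgp : measurable_fun setT (fun x => (`|g x| `^ p)%:E).
      by apply/measurable_EFinP; exact: mpowR.
    have /(ae_eq_integral_abs mX measurableT mgp) gp0 :
        (\int[mX]_x `|(`|g x| `^ p)%:E| = 0)%E.
      apply/eqP; rewrite eq_le integral_ge0// andbT.
      under eq_integral do rewrite gee0_abs ?lee_fin ?powR_ge0//.
      by move: gA; rewrite A_eq0.
    have mgE : measurable_fun setT (EFin \o g) by apply/measurable_EFinP.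
    apply: ((ae_eq_integral_abs mX measurableT mgE).2 _).
    apply: filterS gp0 => x /= /(_ I) [] gx0 _.
    by congr EFin; exact/normr0_eq0/(powR_eq0_eq0 gx0).
  have ex : exists k, L / 2 ^+ k < `|T g y|.
    exists (Num.bound (L / `|T g y|)); rewrite ltr_pdivrMr ?exprn_gt0//.
    rewrite mulrC -ltr_pdivrMr//; apply: (lt_trans (archi_boundP _)).
      by rewrite divr_ge0.
    by rewrite -natrX ltr_nat ltn_expl.
  (* The least k with L / 2^k < |T g y| is positive by [TL], and its minimality gives the upper
     estimate [vk]. *)
  case: (ex_minnP ex) => -[|k] kv kmin.
    by move: kv; rewrite expr0 divr1 ltNge TL.
  have vk : `|T g y| <= 2 * (L / 2 ^+ k.+1).
    rewrite leNgt; apply/negP => H; have /kmin : L / 2 ^+ k < `|T g y|.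
      by apply: le_lt_trans H; rewrite exprS invfM; lra.
    by rewrite ltnn.
  have lk0 : 0 <= L / 2 ^+ k.+1 by rewrite divr_ge0// exprn_ge0.
  apply: (le_trans _ (nneseries_ge k.+1 _)); last by move=> j; exact: nn.
  move: kv vk lk0; set l := L / _ => kv vk lk0.
  have i1 : L1 (g \* \1_(~` E k.+1)) by apply: split_L1 => //; exact: measurableC.
  have T1 : `|T (g \* \1_(~` E k.+1)) y| <= l / 2.
    rewrite -lee_fin; apply: le_trans (T_sup y i1) _.
    apply: (@le_trans _ _ (\int[mX]_x ((l / (2 * A))%:E * (`|g x| `^ p)%:E))%E).
      apply: ge0_le_integral => //.
      - apply/measurable_EFinP; apply: measurableT_comp => //.
        by apply/measurable_EFinP; exact: measurable_int i1.
      - by apply: measurable_funeM; apply/measurable_EFinP; exact: mpowR.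
      (* Off the set E one has l |g|^(p - 1) > 2 A, that is |g| <= l / (2 A) |g|^p. *)
      - move=> x _; rewrite -EFinM lee_fin normrM indicB.
        have g0 : 0 <= l / (2 * A) * `|g x| `^ p.
          by rewrite mulr_ge0 ?powR_ge0// divr_ge0// mulr_ge0.
        case: (pselect (E k.+1 x)) => [Ex|nEx].
          by rewrite indicE mem_set//= mulr1n subrr normr0 mulr0.
        rewrite indicE memNset//= mulr0n subr0 normr1 mulr1 -mulr_powRB1//.
        rewrite [leRHS](_ : _ = `|g x| * (l * `|g x| `^ (p - 1) / (2 * A))); last by ring.
        rewrite ler_peMr// ler_pdivlMr ?mul1r ?mulr_gt0// ltW// ltNge.
        exact/negP.
    rewrite ge0_integralZl//; last 2 first.
    - by apply/measurable_EFinP; exact: mpowR.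
    - by rewrite lee_fin divr_ge0// mulr_ge0.
    apply: (@le_trans _ _ ((l / (2 * A))%:E * A%:E)%E).
      by rewrite lee_wpmul2l// lee_fin divr_ge0// mulr_ge0.
    rewrite -EFinM lee_fin; apply: le_of_eq.
    by field; rewrite gt_eqF.
  have vh : `|T g y| <= 2 * `|T (h k.+1) y|.
    have : `|T g y| <= `|T (h k.+1) y| + `|T (g \* \1_(~` E k.+1)) y|.
      have gE : g = h k.+1 \+ (g \* \1_(~` E k.+1)).
        by apply/funext => x /=; rewrite /h /= indicB; ring.
      by rewrite {1}gE; exact: TD.
    by move: T1 kv; lra.
  rewrite lee_fin -[X in _ `^ X](subrK 2) powRD; last by rewrite (gt_eqF vp) implybT.
  have a1 : `|T g y| `^ (q - 2) <= 2 `^ (q - 2) * l `^ (q - 2).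
    rewrite -powRM//; apply: ge0_ler_powR; rewrite ?nnegrE//; first exact: ltW.
    by rewrite mulr_ge0.
  have a2 : `|T g y| `^ 2 <= 4 * T (h k.+1) y ^+ 2.
    rewrite powR_mulrn// -[T (h _) y ^+ 2]real_normK ?num_real//.
    rewrite [leRHS](_ : _ = (2 * `|T (h k.+1) y|) ^+ 2); last by ring.
    by rewrite ler_sqr ?nnegrE ?mulr_ge0.
  rewrite /C [leRHS](_ : _ = (2 `^ (q - 2) * l `^ (q - 2)) * (4 * T (h k.+1) y ^+ 2)); last by ring.
  by apply: ler_pM; rewrite ?powR_ge0.
have mTh k : measurable_fun setT (T (h k)) by exact: mT.
apply: (le_trans (integral_le_nneseries _ _ _ _ _ key)).
- by apply/measurable_EFinP; apply: mpowR; exact: mT.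
- by move=> y; rewrite lee_fin powR_ge0.
- move=> k; apply/measurable_EFinP.
  by do 2 apply: measurable_funM => //; apply: measurable_funX; exact: mTh.
- by move=> k y; apply: nn; rewrite ?mulr_ge0.
have step k : (\int[mY]_y (C * ((L / 2 ^+ k) `^ (q - 2) * T (h k) y ^+ 2))%:E <=
  \int[mX]_x (C * B * ((L / 2 ^+ k) `^ (q - 2) * h k x ^+ 2))%:E)%E.
  under eq_integral do rewrite mulrA EFinM.
  rewrite ge0_integralZl//; last 3 first.
  - by apply/measurable_EFinP; apply: measurable_funX; exact: mTh.
  - by move=> y _; rewrite lee_fin sqr_ge0.
  - by rewrite lee_fin !mulr_ge0 ?powR_ge0.
  set lam := _ `^ _.
  apply: (@le_trans _ _ ((C * lam)%:E * (B%:E * \int[mX]_x (h k x ^+ 2)%:E))%E).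
    by rewrite lee_wpmul2l ?T_L2// lee_fin mulr_ge0 ?powR_ge0.
  rewrite muleA -EFinM -ge0_integralZl//; last 3 first.
  - apply/measurable_EFinP; apply: measurable_funX.
    by apply/measurable_EFinP; exact: measurable_int (ih k).
  - by move=> y _; rewrite lee_fin sqr_ge0.
  - by rewrite lee_fin !mulr_ge0 ?powR_ge0.
  apply: le_of_eq; apply: eq_integral => x _.
  by rewrite -EFinM; congr EFin; ring.
apply: (le_trans (lee_nneseries _ (fun k _ => step k))).
  by move=> k _ _; apply: integral_ge0 => y _; exact: nn.
(* For fixed x the cut keeps the levels below c = 2 A / |g x|^(p - 1). Since (p - 1)(q - 2) = 2 - p,
   the product of c^(q - 2) and |g x|^2 is (2 A)^(q - 2) |g x|^p. *)
have pw x : (\sum_(k <oo) (C * B * ((L / 2 ^+ k) `^ (q - 2) * h k x ^+ 2))%:E <=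
   (C * B * (D * 2 `^ (q - 2)) * A `^ (q - 2) * `|g x| `^ p)%:E)%E.
  apply: nneseries_le => [k|n]; first by apply: nn; rewrite mulr_ge0.
  rewrite sumEFin lee_fin.
  have [gx0|gx0] := eqVneq (g x) 0.
    rewrite big1 ?mulr_ge0 ?powR_ge0 ?mulr_ge0 ?powR_ge0// => k _.
    by rewrite /h /= gx0 mul0r expr0n !mulr0.
  have gp : 0 < `|g x| by rewrite normr_gt0.
  pose c := 2 * A / `|g x| `^ (p - 1).
  have gpp : 0 < `|g x| `^ (p - 1) by rewrite powR_gt0.
  have c0 : 0 <= c by rewrite divr_ge0 ?mulr_ge0 ?powR_ge0.
  rewrite (eq_bigr (fun k => C * B * g x ^+ 2 *
      (if L / 2 ^+ k <= c then (L / 2 ^+ k) `^ (q - 2) else 0))); last first.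
    move=> k _; rewrite /h /= indicE /c ler_pdivlMr//.
    case: (pselect (E k x)) => [Ex|nEx].
      by rewrite mem_set//= mulr1n mulr1 (_ : L / 2 ^+ k * _ <= _ = true)//; ring.
    rewrite memNset//= mulr0n mulr0 expr0n !mulr0 (_ : L / 2 ^+ k * _ <= _ = false) ?mulr0//.
    exact/negP.
  rewrite -mulr_sumr; apply: (@le_trans _ _ (C * B * g x ^+ 2 * (D * c `^ (q - 2)))).
    apply: ler_wpM2l; last exact: geo.
    by apply: mulr_ge0; [exact: mulr_ge0|exact: sqr_ge0].
  have e1 : c `^ (q - 2) * `|g x| `^ (2 - p) = 2 `^ (q - 2) * A `^ (q - 2).
    rewrite -[RHS]powRM// (_ : 2 - p = (p - 1) * (q - 2)); last first.
      by rewrite /q; field; rewrite gt_eqF.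
    by rewrite powRrM -powRM ?powR_ge0// /c divfK// gt_eqF.
  have e2 : g x ^+ 2 = `|g x| `^ (2 - p) * `|g x| `^ p.
    rewrite -powRD; last by rewrite normr_eq0 gx0 implybT.
    by rewrite subrK powR_mulrn// real_normK ?num_real.
  rewrite e2 [leRHS](_ : _ = C * B * D * `|g x| `^ p * (2 `^ (q - 2) * A `^ (q - 2))); last by ring.
  by rewrite -e1; apply: le_of_eq; ring.
apply: (le_trans (nneseries_le_integral _ _ _ _ pw)).
- by apply/measurable_EFinP; apply: measurable_funM => //; exact: mpowR.
- move=> k; apply/measurable_EFinP.
  do 2 apply: measurable_funM => //; apply: measurable_funX.
  by apply/measurable_EFinP; exact: measurable_int (ih k).
- by move=> k y; apply: nn; rewrite ?mulr_ge0.
under eq_integral do rewrite EFinM.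
rewrite ge0_integralZl//; last 2 first.
- by apply/measurable_EFinP; exact: mpowR.
- by rewrite lee_fin !mulr_ge0 ?powR_ge0.
apply: (@le_trans _ _ ((C * B * (D * 2 `^ (q - 2)) * A `^ (q - 2))%:E * A%:E)%E).
  by rewrite lee_wpmul2l// lee_fin !mulr_ge0 ?powR_ge0.
have q1 : 0 < q - 1 by have := q20; lra.
rewrite -EFinM lee_fin -(mulr_powRB1 A0 q1) (_ : q - 1 - 1 = q - 2); last by ring.
by apply: le_of_eq; ring.
Qed.
End interpolation.

(** * Calculus and Fubini tools *)

Lemma integral_FTC {R : realType} (f F : R -> R) (a b : R) : a <= b ->
  (forall x : R, a <= x <= b -> is_derive x (1 : R) F (f x)) ->
  (forall x : R, a <= x <= b -> {for x, continuous f}) ->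
  (\int[lebesgue_measure]_(x in `[a, b]) (f x)%:E = (F b - F a)%:E)%E.
Proof.
rewrite le_eqVlt => /predU1P[<- _ _|ab dF cf].
  by rewrite set_itv1 integral_set1 subrr.
have cF x : a <= x <= b -> {for x, continuous F}.
  by move=> /dF dFx; apply/differentiable_continuous/derivable1_diffP.
rewrite EFinB; apply: continuous_FTC2 => //.
- by apply: continuous_in_subspaceT => x; rewrite inE/= in_itv/=; exact: cf.
- split.
  + move=> x; rewrite in_itv/= => /andP[ax xb].
    by have [] := dF x; rewrite ?(ltW ax) ?(ltW xb).
  + by apply: cvg_at_right_filter; apply: cF; rewrite lexx ltW.
  + by apply: cvg_at_left_filter; apply: cF; rewrite lexx ltW.
- move=> x; rewrite in_itv/= => /andP[ax xb].
  have axb : a <= x <= b by rewrite (ltW ax) (ltW xb).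
  by rewrite derive1E; have [] := dF x axb.
Qed.

Lemma itv_lty {R : realType} (a b : R) : (@lebesgue_measure R `[a, b] < +oo)%E.
Proof. by rewrite lebesgue_measure_itv/=; case: ifP => _; rewrite ?ltry// -EFinB ltry. Qed.

Section rectangular.
Context {R : realType} {d1 d2 : measure_display}.
Context {T1 : measurableType d1} {T2 : measurableType d2}.
Context (m1 : {sigma_finite_measure set T1 -> \bar R}).
Context (m2 : {sigma_finite_measure set T2 -> \bar R}).

(** A class closed under multiplication by bounded phases and under partial integration, on which
    Fubini applies and all integrals are finite. *)
Definition bounded_support d (T : measurableType d) (m : {measure set T -> \bar R})
  (M : R) (A : set T) (f : T -> R) :=
  [/\ measurable_fun setT f, measurable A, (m A < +oo)%E, 0 <= M &
      forall x, `|f x| <= M * \1_A x].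

Lemma integrable_indic_lty d (T : measurableType d) (m : {measure set T -> \bar R}) A :
  measurable A -> (m A < +oo)%E -> m.-integrable setT (EFin \o (\1_A : T -> R)).
Proof.
move=> mA Aoo; apply/integrableP; split.
  by apply/measurable_EFinP; exact: measurable_indic.
by under eq_integral do rewrite /= ger0_norm//; rewrite integral_indic// setIT.
Qed.

Lemma bounded_support_integrable d (T : measurableType d)
    (m : {measure set T -> \bar R}) M A f :
  bounded_support m M A f -> m.-integrable setT (EFin \o f).
Proof.
move=> [mf mA Aoo M0 fM].
have i1 := integrableZl measurableT M (integrable_indic_lty mA Aoo).
apply: le_integrable i1 => //; first exact/measurable_EFinP.
move=> x _ /=; rewrite lee_fin (le_trans (fM x))//.
by rewrite ger0_norm// mulr_ge0.
Qed.

Lemma bounded_supportM d (T : measurableType d)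
    (m : {measure set T -> \bar R}) (M N : R) A (f g : T -> R) :
  bounded_support m M A f -> measurable_fun setT g -> 0 <= N ->
  (forall x, `|g x| <= N) -> bounded_support m (M * N) A (fun x => f x * g x).
Proof.
move=> [mf mA Aoo M0 fM] mg N0 gN; split => //; first exact: measurable_funM.
  by rewrite mulr_ge0.
by move=> x; rewrite normrM mulrAC; apply: ler_pM.
Qed.

Context (F : T1 * T2 -> R) (M : R) (A : set T1) (B : set T2).
Hypotheses (mF : measurable_fun setT F) (mA : measurable A) (mB : measurable B).
Hypotheses (Aoo : (m1 A < +oo)%E) (Boo : (m2 B < +oo)%E) (M0 : 0 <= M).
Hypothesis FM : forall x y, `|F (x, y)| <= M * \1_A x * \1_B y.

Let FM' : bounded_support (m1 \x m2)%E M (A `*` B) F.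
Proof.
split => //; first exact: measurableX.
  rewrite [X in (X < _)%E](_ : _ = (m1 A * m2 B)%E); last exact: product_measure1E.
  by rewrite lte_mul_pinfty// ge0_fin_numE.
move=> [x y]; apply: le_trans (FM x y) _; rewrite -mulrA ler_wpM2l//.
rewrite !indicE in_setX/=.
by case: (x \in A); case: (y \in B); rewrite ?mulr1 ?mulr0.
Qed.

Let iF : (m1 \x m2)%E.-integrable setT (EFin \o F).
Proof. exact: bounded_support_integrable FM'. Qed.

Lemma bounded_support_section1 x : bounded_support m2 (M * \1_A x) B (fun y => F (x, y)).
Proof.
split => //.
- by apply: measurableT_comp mF _; exact: pair1_measurable.
- by rewrite mulr_ge0.
Qed.

Lemma bounded_support_section2 y : bounded_support m1 (M * \1_B y) A (fun x => F (x, y)).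
Proof.
split => //.
- by apply: measurableT_comp mF _; exact: pair2_measurable.
- by rewrite mulr_ge0.
- by move=> x; rewrite mulrAC.
Qed.

Lemma measurable_Rintegral1 : measurable_fun setT (fun x => \int[m2]_y F (x, y)).
Proof.
apply: (measurableT_comp (fine_measurable measurableT)).
exact: (measurable_fubini_F iF).
Qed.

Lemma bounded_support_Rintegral1 :
  bounded_support m1 (M * fine (m2 B)) A (fun x => \int[m2]_y F (x, y)).
Proof.
split => //; first exact: measurable_Rintegral1.
  by rewrite mulr_ge0// fine_ge0.
move=> x; have i1 := bounded_support_integrable (bounded_support_section1 x).
apply: (le_trans (le_normr_Rintegral measurableT i1)).
have iB : m2.-integrable setT (EFin \o (\1_B : T2 -> R)) by exact: integrable_indic_lty.
apply: (@le_trans _ _ (\int[m2]_y (M * \1_A x * \1_B y))).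
  apply: le_Rintegral => //.
  - exact: integrable_norm.
  - exact: (integrableZl measurableT (M * \1_A x) iB).
rewrite RintegralZl// mulrAC ler_wpM2r//= ler_wpM2l//.
by rewrite /Rintegral integral_indic// setIT.
Qed.

Lemma Rintegral_fubini :
  \int[m1]_x \int[m2]_y F (x, y) = \int[m2]_y \int[m1]_x F (x, y).
Proof.
rewrite /Rintegral; congr fine.
transitivity (\int[m1]_x (\int[m2]_y (F (x, y))%:E))%E.
  apply: eq_integral => x _; rewrite fineK//; apply: integrable_fin_num => //.
  exact: bounded_support_integrable (bounded_support_section1 x).
rewrite (Fubini iF); apply: eq_integral => y _; rewrite fineK//.
apply: integrable_fin_num => //.
exact: bounded_support_integrable (bounded_support_section2 y).
Qed.
End rectangular.

Section real_derivatives.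
Context {R : realType}.
Implicit Types (f g : R -> R) (x a b : R).

(** The differentiation rules are restated for explicit abstractions so that [derive_step] can
    select them by the shape of the body. *)
Lemma is_derive_fcst x a : is_derive x (1 : R) (fun _ : R => a) 0.
Proof. exact: is_derive_cst. Qed.

Lemma is_derive_fid x : is_derive x (1 : R) (fun t : R => t) 1.
Proof. exact: is_derive_id. Qed.

Lemma is_derive_fD f g x a b : is_derive x (1 : R) f a -> is_derive x (1 : R) g b ->
  is_derive x (1 : R) (fun t => f t + g t) (a + b).
Proof. exact: is_deriveD. Qed.

Lemma is_derive_fB f g x a b : is_derive x (1 : R) f a -> is_derive x (1 : R) g b ->
  is_derive x (1 : R) (fun t => f t - g t) (a - b).
Proof. exact: is_deriveB. Qed.

Lemma is_derive_fN f x a : is_derive x (1 : R) f a ->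
  is_derive x (1 : R) (fun t => - f t) (- a).
Proof. exact: is_deriveN. Qed.

Lemma is_derive_fM f g x a b : is_derive x (1 : R) f a -> is_derive x (1 : R) g b ->
  is_derive x (1 : R) (fun t => f t * g t) (f x * b + g x * a).
Proof. exact: is_deriveM. Qed.

Lemma is_derive_fV f x a : f x != 0 -> is_derive x (1 : R) f a ->
  is_derive x (1 : R) (fun t => (f t)^-1) (- (f x) ^- 2 * a).
Proof. by move=> fx0 df; apply: is_deriveV. Qed.

Lemma is_derive_fX2 f x a : is_derive x (1 : R) f a ->
  is_derive x (1 : R) (fun t => f t ^+ 2) (2 * f x * a).
Proof.
move=> df; have := is_derive_fM df df.
under [X in is_derive _ _ X _]eq_fun do rewrite -expr2.
by move=> h; apply: is_derive_eq; ring.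
Qed.

Lemma is_derive_fsin f x a : is_derive x (1 : R) f a ->
  is_derive x (1 : R) (fun t => sin (f t)) (cos (f x) * a).
Proof. by move=> df; exact: is_derive1_comp. Qed.

Lemma is_derive_fcos f x a : is_derive x (1 : R) f a ->
  is_derive x (1 : R) (fun t => cos (f t)) (- sin (f x) * a).
Proof. by move=> df; exact: is_derive1_comp. Qed.

Lemma is_derive_fatan f x a : is_derive x (1 : R) f a ->
  is_derive x (1 : R) (fun t => atan (f t)) ((1 + f x ^+ 2)^-1 * a).
Proof. by move=> df; exact: is_derive1_comp. Qed.

Lemma is_derive_fln f x a : 0 < f x -> is_derive x (1 : R) f a ->
  is_derive x (1 : R) (fun t => ln (f t)) ((f x)^-1 * a).
Proof. by move=> fx0 df; have := is_derive1_ln fx0 => ?; exact: is_derive1_comp. Qed.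

Lemma is_derive_continuous f x a : is_derive x (1 : R) f a -> {for x, continuous f}.
Proof. by move=> df; apply/differentiable_continuous/derivable1_diffP. Qed.
End real_derivatives.

(** Constants are tried first, so that a subterm free of the variable is never expanded, and
    differences before the sums that they unfold to. *)
Ltac derive_step :=
  first [ notypeclasses refine (is_derive_fcst _ _)
        | notypeclasses refine (is_derive_fid _)
        | notypeclasses refine (is_derive_fB _ _)
        | notypeclasses refine (is_derive_fD _ _)
        | notypeclasses refine (is_derive_fN _)
        | notypeclasses refine (is_derive_fX2 _)
        | notypeclasses refine (is_derive_fsin _)
        | notypeclasses refine (is_derive_fcos _)
        | notypeclasses refine (is_derive_fatan _)
        | notypeclasses refine (is_derive_fln _ _)
        | notypeclasses refine (is_derive_fM _ _)
        | notypeclasses refine (is_derive_fV _ _) ].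
Lemma is_derive_val {R : realType} (f : R -> R) (x a b : R) :
  is_derive x (1 : R) f a -> a = b -> is_derive x (1 : R) f b.
Proof. by move=> df <-. Qed.
Ltac continuous_tac :=
  notypeclasses refine (is_derive_continuous _); repeat derive_step.
Ltac derive_tac := notypeclasses refine (is_derive_val _ _); [repeat derive_step|].

Section exhaustion.
Context {R : realType} {d : measure_display} {T : measurableType d}.
Context (m : {measure set T -> \bar R}).

Lemma integral_exhaustion (F : (set T)^nat) (f : T -> \bar R) (c : \bar R) :
  {homo F : i j / (i <= j)%N >-> (i <= j)%O} -> (forall i, measurable (F i)) ->
  \bigcup_i F i = setT -> measurable_fun setT f -> (forall x, (0 <= f x)%E) ->
  (forall i, (\int[m]_(x in F i) f x <= c)%E) -> (\int[m]_x f x <= c)%E.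
Proof.
move=> ndF mF FT mf f0 fc.
have mfF i : measurable_fun (F i) f by exact: measurable_funTS.
have := @ge0_nondecreasing_set_cvg_integral _ _ _ F f m ndF mF mfF (fun _ x _ => f0 x).
rewrite FT => h; rewrite -(cvg_lim _ h)//.
by apply: lime_le; [apply/cvg_ex; eexists; exact: h|exact: nearW].
Qed.
End exhaustion.

Lemma bigcup_itv_nat {R : realType} : \bigcup_n `[- n%:R, n%:R]%classic = [set: R].
Proof.
apply/seteqP; split => // x _.
exists (Num.bound `|x|) => //=; rewrite in_itv/= -ler_norml.
by rewrite ltW// archi_boundP.
Qed.

Lemma homo_itv_nat {R : realType} :
  {homo (fun n => `[- n%:R, n%:R]%classic : set R) : i j / (i <= j)%N >-> (i <= j)%O}.
Proof.
move=> i j ij; apply/subsetPset => x /=; rewrite !in_itv/= => /andP[ix xi].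
have : i%:R <= j%:R :> R by rewrite ler_nat.
by move=> ?; apply/andP; split; lra.
Qed.

(** * The Plancherel inequality *)

Section fejer.
Context {R : realType}.

(** Repeated integration by parts; the term of order 1/b carries the weight and vanishes at both end
    points. *)
Let weight_primitive (b N x : R) : b != 0 -> N != 0 ->
  is_derive x (1 : R) (fun t : R => (1 - t ^+ 2 / N ^+ 2) * (sin (b * t) / b)
    - 2 * t / N ^+ 2 * cos (b * t) / b ^+ 2 + 2 / N ^+ 2 * sin (b * t) / b ^+ 3)
  ((1 - x ^+ 2 / N ^+ 2) * cos (b * x)).
Proof. by move=> b0 N0; derive_tac; rewrite /=; field; rewrite b0 N0. Qed.

Let continuous_weight (b N x : R) :
  {for x, continuous (fun t : R => (1 - t ^+ 2 / N ^+ 2) * cos (b * t))}.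
Proof. by continuous_tac. Qed.

(* The weight [1 - x^2 / N^2] vanishes at the end points, so its cosine transform decays
   quadratically; this makes Schur's test available. *)
Lemma weight_cos_bound (b N : R) : 0 < N ->
  `|\int[lebesgue_measure]_(x in `[- N, N]) ((1 - x ^+ 2 / N ^+ 2) * cos (b * x))|
    <= 16 * N / (1 + N ^+ 2 * b ^+ 2).
Proof.
move=> N0; have d0 : 0 < 1 + N ^+ 2 * b ^+ 2.
  by rewrite ltr_pwDl// mulr_ge0// sqr_ge0.
(* For N |b| <= 1 the length 2 N of the interval is a good enough bound; otherwise the primitive
   gives 8 / (N b^2). *)
have [Nb1|Nb1] := leP (N ^+ 2 * b ^+ 2) 1.
  have sqx (x : R) : - N <= x <= N -> 0 <= x ^+ 2 / N ^+ 2 <= 1.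
    move=> /andP[Nx xN]; rewrite divr_ge0 ?sqr_ge0//= ler_pdivrMr ?exprn_gt0//; nra.
  apply: (@le_trans _ _ (2 * N)).
    have ci : lebesgue_measure.-integrable `[- N, N]
        (EFin \o (fun x => (1 - x ^+ 2 / N ^+ 2) * cos (b * x))).
      apply: continuous_compact_integrable; first exact: segment_compact.
      by apply: continuous_subspaceT => x; exact: continuous_weight.
    have c1 : lebesgue_measure.-integrable `[- N, N] (EFin \o (fun=> 1 : R)).
      apply: continuous_compact_integrable; first exact: segment_compact.
      by apply: continuous_subspaceT => x; exact: cst_continuous.
    apply: (le_trans (le_normr_Rintegral _ ci)) => //.
    apply: (@le_trans _ _ (\int[lebesgue_measure]_(x in `[- N, N]) 1)).
      apply: le_Rintegral => //; first exact: integrable_norm.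
      move=> x /=; rewrite in_itv/= => /sqx xN2; rewrite normrM -[leRHS]mulr1; apply: ler_pM => //; last exact: cos_max.
      by rewrite ger0_norm; lra.
    rewrite Rintegral_cst//= lebesgue_measure_itv/= lte_fin ifT; last by lra.
    by rewrite -EFinB/=; lra.
  rewrite ler_pdivlMr//; nra.
have b0 : b != 0 by apply/eqP => b0; move: Nb1; rewrite b0 expr0n mulr0 ltr10.
have Nn0 : N != 0 by rewrite gt_eqF.
have b2 : 0 < b ^+ 2 by rewrite lt0r sqrf_eq0 b0 sqr_ge0.
have NN : - N <= N by lra.
rewrite /Rintegral (integral_FTC NN (fun x _ => weight_primitive x b0 Nn0))/=; last first.
  by move=> x _; exact: continuous_weight.
rewrite mulrN sinN cosN sqrrN divff ?sqrf_eq0// subrr !mul0r.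
set s := sin _; set c := cos _.
have -> : 0 - 2 * N / N ^+ 2 * c / b ^+ 2 + 2 / N ^+ 2 * s / b ^+ 3 -
   (0 - 2 * - N / N ^+ 2 * c / b ^+ 2 + 2 / N ^+ 2 * - s / b ^+ 3) =
   4 / (N * b ^+ 2) * (s / (N * b) - c).
  by field; rewrite b0 Nn0.
rewrite normrM ger0_norm; last by rewrite divr_ge0// mulr_ge0 ?sqr_ge0 ?ltW.
apply: (@le_trans _ _ (4 / (N * b ^+ 2) * 2)).
  apply: ler_wpM2l; first by rewrite divr_ge0// mulr_ge0 ?sqr_ge0 ?(ltW N0).
  apply: (le_trans (ler_normB _ _)).
  have : `|c| <= 1 by exact: cos_max.
  suff : `|s / (N * b)| <= 1 by lra.
  rewrite normrM normfV ler_pdivrMr ?normr_gt0 ?mulf_neq0// mul1r.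
  apply: (@le_trans _ _ 1); first exact: sin_max.
  rewrite -[leRHS]ger0_norm// -ler_sqr ?nnegrE//.
  by rewrite normr_id real_normK ?num_real// exprMn expr1n ltW.
set u := b ^+ 2 in b2 Nb1 d0 *; move: u b2 Nb1 d0 => u b2 Nb1 d0.
rewrite [leLHS](_ : _ = 8 / (N * u)); last by field; rewrite Nn0 gt_eqF.
rewrite ler_pdivrMr ?mulr_gt0// mulrAC ler_pdivlMr//.
rewrite [leRHS](_ : _ = 16 * (N ^+ 2 * u)); last by ring.
by lra.
Qed.

(** The primitive is (8 / pi) times an arctangent, whose total variation is pi. That N disappears
    makes Schur's test uniform in the cutoff. *)
Lemma integral_weight_bound (N x : R) : 0 < N ->
  (\int[lebesgue_measure]_y (16 * N / (1 + N ^+ 2 * (2 * pi * (x - y)) ^+ 2))%:E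
    <= 8%:E)%E.
Proof.
move=> N0.
pose f y := 16 * N / (1 + N ^+ 2 * (2 * pi * (x - y)) ^+ 2).
have den y : 0 < 1 + N ^+ 2 * (2 * pi * (x - y)) ^+ 2.
  by rewrite ltr_pwDl// mulr_ge0// sqr_ge0.
have f0 y : 0 <= f y by rewrite divr_ge0// ?ltW// mulr_gt0.
have pi0 : 0 < pi :> R by exact: pi_gt0.
pose F (y : R) := - (8 / pi * atan (2 * pi * N * (x - y))).
have dF y : is_derive y (1 : R) F (f y).
  rewrite /F; derive_tac; rewrite /= /f.
  have := den y; set t := x - y => ty.
  move: (pi : R) pi0 => p p0 in ty *.
  have h := sqr_ge0 (2 * N * p * t).
  field; rewrite (gt_eqF p0) andbT; apply: lt0r_neq0; lra.
have cf y : {for y, continuous f}.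
  rewrite /f; continuous_tac.
  exact: lt0r_neq0 (den y).
have mf : measurable_fun setT f by exact: continuous_measurable_fun.
have bnd (n : nat) : (\int[lebesgue_measure]_(y in `[(- n%:R)%R, n%:R%R]) (f y)%:E <= 8%:E)%E.
  have nn : - n%:R <= n%:R :> R by rewrite (@le_trans _ _ 0)// oppr_le0.
  rewrite (integral_FTC nn (fun y _ => dF y) (fun y _ => cf y)).
  rewrite lee_fin /F.
  have h1 := atan_gtNpi2 (2 * pi * N * (x - n%:R)).
  have h2 := atan_ltpi2 (2 * pi * N * (x - - n%:R)).
  set u := atan _ in h2 *; set v := atan _ in h1 *.
  rewrite (_ : _ - _ = 8 / pi * (u - v)); last by ring.
  rewrite mulrAC ler_pdivrMr// ler_pM2l//; lra.
apply: (@integral_exhaustion _ _ _ lebesgue_measure _ _ _ homo_itv_nat _ bigcup_itv_nat) => //.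
exact/measurable_EFinP.
Qed.
End fejer.

Section measurable_parameter.
Context {R : realType} {d1 d2 : measure_display}.
Context {T1 : measurableType d1} {T2 : measurableType d2}.
Context (m2 : {sigma_finite_measure set T2 -> \bar R}).

Lemma measurable_Rintegral (F : T1 * T2 -> R) : measurable_fun setT F ->
  measurable_fun setT (fun x => \int[m2]_y F (x, y)).
Proof.
move=> mF; apply: (measurableT_comp (fine_measurable measurableT)).
have mE : measurable_fun setT (EFin \o F) by exact/measurable_EFinP.
rewrite (_ : (fun x => _) = ((fun x => \int[m2]_y ((EFin \o F)^\+ (x, y))) \-
   (fun x => \int[m2]_y ((EFin \o F)^\- (x, y))))%E); last first.
  apply/funext => x; rewrite [LHS]integralE.
  by congr (_ - _)%E; apply: eq_integral => y _; rewrite ?funeposE ?funenegE.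
apply: emeasurable_funB.
  exact: (measurable_fun_fubini_tonelli_F _ (measurable_funepos mE)).
exact: (measurable_fun_fubini_tonelli_F _ (measurable_funeneg mE)).
Qed.
End measurable_parameter.

Section plancherel1.
Context {R : realType}.
Local Notation mu := (@lebesgue_measure R).

Definition cos_transform1 (g : R -> R) (c xi : R) : R :=
  \int[mu]_x (g x * cos (2 * pi * (x * xi) - c)).

Lemma cosBpi2 (a : R) : cos (a - pi / 2) = sin a.
Proof. by rewrite cosB cos_pihalf sin_pihalf mulr0 mulr1 add0r. Qed.

Lemma measurable_fcos (d : measure_display) (T : measurableType d) (f : T -> R) :
  measurable_fun setT f -> measurable_fun setT (fun x => cos (f x)).
Proof.
move=> mf; apply: (measurableT_comp _ mf).
by apply: continuous_measurable_fun; exact: continuous_cos.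
Qed.

Lemma measurable_fsin (d : measure_display) (T : measurableType d) (f : T -> R) :
  measurable_fun setT f -> measurable_fun setT (fun x => sin (f x)).
Proof.
move=> mf; apply: (measurableT_comp _ mf).
by apply: continuous_measurable_fun; exact: continuous_sin.
Qed.

Lemma measurable_cos_transform1 (g : R -> R) c : measurable_fun setT g ->
  measurable_fun setT (cos_transform1 g c).
Proof.
move=> mg; suff mphase : measurable_fun setT
    (fun z : R * R => g z.2 * cos (2 * pi * (z.2 * z.1) - c)).
  exact: (measurable_Rintegral mu mphase).
apply: measurable_funM; first exact: measurableT_comp.
apply: measurable_fcos; apply: measurable_funB => //; apply: measurable_funM => //.
exact: measurable_funM.
Qed.

Context (g : R -> R) (M : R) (A : set R).
Hypothesis bg : bounded_support mu M A g.

Let mg : measurable_fun setT g. Proof. by case: bg. Qed.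
Let mA : measurable A. Proof. by case: bg. Qed.
Let Aoo : (mu A < +oo)%E. Proof. by case: bg. Qed.
Let M0 : 0 <= M. Proof. by case: bg. Qed.
Let gM x : `|g x| <= M * \1_A x. Proof. by case: bg. Qed.
Let mcos := measurable_fcos.

Let bphase c xi : bounded_support mu (M * 1) A
  (fun x => g x * cos (2 * pi * (x * xi) - c)).
Proof.
apply: bounded_supportM => //; last by move=> x; exact: cos_max.
by apply: mcos; apply: measurable_funB => //; do 2 apply: measurable_funM => //.
Qed.

Let iphase c xi := bounded_support_integrable (bphase c xi).

Let mh c : measurable_fun setT (cos_transform1 g c).
Proof. exact: measurable_cos_transform1. Qed.

Let hM c xi : `|cos_transform1 g c xi| <= M * fine (mu A).
Proof.
apply: (le_trans (le_normr_Rintegral measurableT (iphase c xi))).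
have iA : mu.-integrable setT (EFin \o (\1_A : R -> R)) by exact: integrable_indic_lty.
apply: (@le_trans _ _ (\int[mu]_y (M * \1_A y))).
  apply: le_Rintegral => //.
  - exact: integrable_norm.
  - exact: (integrableZl measurableT M iA).
  - move=> x _; have [_ _ _ _ /(_ x)] := bphase c xi; by rewrite mulr1.
rewrite RintegralZl//= ler_wpM2l//.
by rewrite /Rintegral integral_indic// setIT.
Qed.

Variable N : R.
Hypothesis N0 : 0 < N.

Let k (xi : R) : R := (1 - xi ^+ 2 / N ^+ 2) * \1_`[- N, N] xi.

Let mk : measurable_fun setT k.
Proof.
apply: measurable_funM; last exact: measurable_indic.
by apply: measurable_funB => //; apply: measurable_funM => //.
Qed.

Let k01 xi : 0 <= k xi <= \1_`[- N, N] xi.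
Proof.
rewrite /k indicE; case: (boolP (xi \in _)) => [|_]; last by rewrite mulr0 !lexx.
rewrite inE/= in_itv/= => /andP[Nx xN]; rewrite mulr1.
have : 0 <= xi ^+ 2 / N ^+ 2 <= 1.
  rewrite divr_ge0 ?sqr_ge0//= ler_pdivrMr ?exprn_gt0//; nra.
by move=> h; apply/andP; split; lra.
Qed.

(** Expanding the squares in [energy] below and integrating over xi first turns it into the double
    integral of g(x) g(y) D(x, y); [J] is the inner integral without the factor g(x). *)
Let D x y : R := \int[mu]_xi (k xi * cos (2 * pi * ((x - y) * xi))).
Let J x : R := \int[mu]_y (g y * D x y).
Let C := cos_transform1 g 0.
Let S := cos_transform1 g (pi / 2).

Let energy : R := \int[mu]_xi (k xi * (C xi ^+ 2 + S xi ^+ 2)).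

Let cos0 (a : R) : cos (a - 0) = cos a. Proof. by rewrite subr0. Qed.

Let mI : measurable (`[- N, N]%classic : set R). Proof. exact: measurable_itv. Qed.

Let Ioo : (mu `[(- N)%R, N]%classic < +oo)%E. Proof. exact: itv_lty. Qed.

Let bk : bounded_support mu 1 `[- N, N]%classic k.
Proof.
split => // xi; have /andP[k0 k1] := k01 xi.
by rewrite ger0_norm// mul1r.
Qed.

Let C_le xi : `|C xi| <= M * fine (mu A). Proof. exact: hM. Qed.
Let S_le xi : `|S xi| <= M * fine (mu A). Proof. exact: hM. Qed.

Let k_norm xi : `|k xi| <= \1_`[- N, N] xi.
Proof. by have [_ _ _ _ /(_ xi)] := bk; rewrite mul1r. Qed.

(** Fubini in (xi, y), followed by the addition formula for cos (2 pi (x - y) xi). *)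
Let JE x : J x = \int[mu]_xi (k xi * (cos (2 * pi * (x * xi)) * C xi +
  sin (2 * pi * (x * xi)) * S xi)).
Proof.
pose F (z : R * R) := k z.1 * g z.2 * cos (2 * pi * ((x - z.2) * z.1)).
have mF : measurable_fun setT F.
  apply: measurable_funM.
    by apply: measurable_funM; exact: measurableT_comp.
  apply: mcos; apply: measurable_funM => //; apply: measurable_funM => //.
  exact: measurable_funB.
have FM xi y : `|F (xi, y)| <= M * \1_`[- N, N] xi * \1_A y.
  rewrite /F/= (normrM (_ * _)) (normrM (k xi)) -[leRHS]mulr1 (mulrC M) -(mulrA _ M).
  by apply: ler_pM; [exact: mulr_ge0|exact: normr_ge0|exact: ler_pM|exact: cos_max].
transitivity (\int[mu]_y \int[mu]_xi F (xi, y)).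
  apply: eq_Rintegral => y _; rewrite -RintegralZl//; last first.
    have bkc : bounded_support mu (1 * 1) `[- N, N]%classic
        (fun xi => k xi * cos (2 * pi * ((x - y) * xi))).
      apply: bounded_supportM => //; last by move=> ?; exact: cos_max.
      by apply: mcos; do 2 apply: measurable_funM => //.
    exact: bounded_support_integrable bkc.
  by apply: eq_Rintegral => xi _; rewrite /F/=; ring.
rewrite -(Rintegral_fubini (m1 := mu) (m2 := mu) mF mI mA Ioo Aoo M0 FM).
apply: eq_Rintegral => xi _.
have -> : (fun y => F (xi, y)) = (fun y => k xi *
   (cos (2 * pi * (x * xi)) * (g y * cos (2 * pi * (y * xi) - 0)) +
    sin (2 * pi * (x * xi)) * (g y * cos (2 * pi * (y * xi) - pi / 2)))).
  apply/funext => y; rewrite /F/= cos0 cosBpi2 mulrBl mulrBr cosB; ring.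
have i1 r c : mu.-integrable setT (EFin \o (fun y => r * (g y * cos (2 * pi * (y * xi) - c)))).
  exact: (integrableZl measurableT r (iphase c xi)).
rewrite RintegralZl//; last exact: (integrableD measurableT (i1 _ 0) (i1 _ (pi / 2))).
by rewrite RintegralD// !RintegralZl// ?iphase//; exact: iphase.
Qed.

Let mC : measurable_fun setT C. Proof. exact: mh. Qed.
Let mS : measurable_fun setT S. Proof. exact: mh. Qed.

Let K := M * fine (mu A).
Let K0 : 0 <= K. Proof. by rewrite mulr_ge0// fine_ge0. Qed.

Let energyE : energy = \int[mu]_x (g x * J x) /\
  mu.-integrable setT (EFin \o (fun x => g x * J x)).
Proof.
pose F (z : R * R) := k z.2 * g z.1 * (cos (2 * pi * (z.1 * z.2)) * C z.2 +
  sin (2 * pi * (z.1 * z.2)) * S z.2).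
have mt c : measurable_fun setT (fun z : R * R => cos (2 * pi * (z.1 * z.2) - c)).
  apply: mcos; apply: measurable_funB => //; apply: measurable_funM => //.
  exact: measurable_funM.
have mF : measurable_fun setT F.
  apply: measurable_funM.
    by apply: measurable_funM; exact: measurableT_comp.
  rewrite (_ : (fun z => _) = (fun z : R * R => cos (2 * pi * (z.1 * z.2) - 0) * C z.2 +
    cos (2 * pi * (z.1 * z.2) - pi / 2) * S z.2)); last first.
    by apply/funext => z; rewrite cos0 cosBpi2.
  by apply: measurable_funD; (apply: measurable_funM; [exact: mt|exact: measurableT_comp]).
have FM x xi : `|F (x, xi)| <= M * (K + K) * \1_A x * \1_`[- N, N] xi.
  rewrite /F/= (normrM (_ * _)) (normrM (k xi)) [leRHS](_ : _ = \1_`[- N, N] xi * (M * \1_A x) * (K + K)); last by ring.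
  apply: ler_pM; [exact: mulr_ge0|exact: normr_ge0|exact: ler_pM|].
  apply: (le_trans (ler_normD _ _)); rewrite !normrM -[X in _ <= X + _]mul1r -[X in _ <= _ + X]mul1r.
  by apply: lerD; apply: ler_pM => //; rewrite ?cos_max ?sin_max ?C_le ?S_le.
have MK0 : 0 <= M * (K + K) by rewrite mulr_ge0// addr_ge0.
have FgJ : (fun x => \int[mu]_xi F (x, xi)) = (fun x => g x * J x).
  apply/funext => x; rewrite JE -RintegralZl//.
    by apply: eq_Rintegral => xi _; rewrite /F/=; ring.
  suff bkc : bounded_support mu (1 * (K + K)) `[- N, N]%classic
      (fun xi => k xi * (cos (2 * pi * (x * xi)) * C xi + sin (2 * pi * (x * xi)) * S xi)).
    exact: bounded_support_integrable bkc.
  apply: bounded_supportM => //; last 2 first.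
  - by rewrite addr_ge0.
  - move=> xi; apply: (le_trans (ler_normD _ _)); rewrite !normrM.
    rewrite -[X in _ <= X + _]mul1r -[X in _ <= _ + X]mul1r.
    by apply: lerD; apply: ler_pM => //; rewrite ?cos_max ?sin_max ?C_le ?S_le.
  have ml : measurable_fun setT (fun xi : R => 2 * pi * (x * xi)).
    by do 2 apply: measurable_funM => //.
  apply: measurable_funD; apply: measurable_funM => //; first exact: mcos.
  exact: measurable_fsin.
split; last first.
  rewrite -FgJ; apply: bounded_support_integrable.
  exact: (bounded_support_Rintegral1 (m1 := mu) (m2 := mu) mF mA mI Aoo Ioo MK0 FM).
rewrite -FgJ (Rintegral_fubini (m1 := mu) (m2 := mu) mF mA mI Aoo Ioo MK0 FM).
apply: eq_Rintegral => xi _.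
have -> : (fun y => F (y, xi)) = (fun y => k xi *
   (C xi * (g y * cos (2 * pi * (y * xi) - 0)) +
    S xi * (g y * cos (2 * pi * (y * xi) - pi / 2)))).
  by apply/funext => y; rewrite /F/= cos0 cosBpi2; ring.
have i1 r c : mu.-integrable setT (EFin \o (fun y => r * (g y * cos (2 * pi * (y * xi) - c)))).
  exact: (integrableZl measurableT r (iphase c xi)).
rewrite RintegralZl//; last exact: (integrableD measurableT (i1 _ 0) (i1 _ (pi / 2))).
by rewrite RintegralD// !RintegralZl// ?iphase//; exact: iphase.
Qed.

Let bound x y : R := 16 * N / (1 + N ^+ 2 * (2 * pi * (x - y)) ^+ 2).

Let D_le x y : `|D x y| <= bound x y.
Proof.
have := weight_cos_bound (2 * pi * (x - y)) N0.
rewrite Rintegral_mkcond; congr (_ <= _); congr Num.norm.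
apply: eq_Rintegral => xi _; rewrite /k patchE indicE; case: ifPn => _.
  by rewrite mulr1 !mulrA.
by rewrite mulr0 mul0r.
Qed.

Let bound_gt0 x y : 0 < 1 + N ^+ 2 * (2 * pi * (x - y)) ^+ 2.
Proof. by rewrite ltr_pwDl// mulr_ge0// sqr_ge0. Qed.

Let bound_ge0 x y : 0 <= bound x y.
Proof. by rewrite divr_ge0 ?(ltW (bound_gt0 _ _))// mulr_ge0// ltW. Qed.

Let mbound : measurable_fun setT (fun z : R * R => bound z.1 z.2).
Proof.
have mphi : measurable_fun setT (fun t : R => 16 * N / (1 + N ^+ 2 * (2 * pi * t) ^+ 2)).
  apply: continuous_measurable_fun => t; continuous_tac.
  by have := lt0r_neq0 (bound_gt0 t 0); rewrite subr0.
by apply: (measurableT_comp mphi); exact: measurable_funB.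
Qed.

Let boundC x y : bound x y = bound y x.
Proof. by rewrite /bound -[y - x]opprB mulrN sqrrN. Qed.

Let integral_bound r x : 0 <= r -> (\int[mu]_y (r * bound x y)%:E <= r%:E * 8%:E)%E.
Proof.
move=> r0; under eq_integral do rewrite EFinM.
rewrite ge0_integralZl//.
- by rewrite lee_wpmul2l ?lee_fin// integral_weight_bound.
- by apply/measurable_EFinP; exact: measurableT_comp mbound (pair1_measurable x).
- by move=> y _; rewrite lee_fin.
Qed.

Let gJ_le x : (`|g x * J x|%:E <=
  \int[mu]_y (2^-1 * (g x ^+ 2 + g y ^+ 2) * bound x y)%:E)%E.
Proof.
have mD : measurable_fun setT (D x).
  suff mF : measurable_fun setT (fun z : R * R => k z.2 * cos (2 * pi * ((x - z.1) * z.2))).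
    exact: (measurable_Rintegral mu mF).
  apply: measurable_funM; first exact: measurableT_comp.
  by apply: mcos; apply: measurable_funM => //; apply: measurable_funM => //; exact: measurable_funB.
have bgD : bounded_support mu (M * (16 * N)) A (fun y => g y * D x y).
  apply: bounded_supportM => //; first by rewrite mulr_ge0// ltW.
  move=> y; apply: (le_trans (D_le x y)); rewrite ler_pdivrMr ?bound_gt0//.
  by rewrite ler_peMr ?mulr_ge0 ?(ltW N0)// lerDl mulr_ge0 ?sqr_ge0.
have igD := bounded_support_integrable bgD.
have mgD := measurable_int _ igD.
rewrite normrM EFinM (EFin_normr_Rintegral measurableT igD).
apply: (@le_trans _ _ (`|g x|%:E * \int[mu]_y `|(g y * D x y)%:E|)%E).
  by rewrite lee_wpmul2l ?lee_fin//; exact: le_abse_integral.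
rewrite -ge0_integralZl//; last exact: measurableT_comp.
apply: ge0_le_integral => //.
- by apply: measurable_funeM; exact: measurableT_comp.
- apply/measurable_EFinP; apply: measurable_funM.
    by apply: measurable_funM => //; apply: measurable_funD => //; exact: measurable_funX.
  exact: measurableT_comp mbound (pair1_measurable x).
- move=> y _; rewrite -EFinM lee_fin normrM mulrA.
  apply: ler_pM => //.
  have := sqr_ge0 (`|g x| - `|g y|); rewrite sqrrB !real_normK ?num_real// => h.
  by lra.
Qed.

(** Schur's test: [gJ_le] has decoupled g(x) g(y) into half the sum of the squares, and the kernel
    integrates to at most 8 in either variable. Each half thus contributes 4; the one with g(y)
    first needs the order of integration exchanged and the symmetry of [bound]. *)
Let energy_le : (energy%:E <= 8%:E * \int[mu]_x (g x ^+ 2)%:E)%E.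
Proof.
have [-> igJ] := energyE.
have mgJ := measurable_int _ igJ.
have mg2 : measurable_fun setT (fun x => (g x ^+ 2)%:E).
  by apply/measurable_EFinP; exact: measurable_funX.
pose f1 (z : R * R) := (2^-1 * g z.1 ^+ 2 * bound z.1 z.2)%:E.
pose f2 (z : R * R) := (2^-1 * g z.2 ^+ 2 * bound z.1 z.2)%:E.
have f10 z : (0 <= f1 z)%E by rewrite lee_fin mulr_ge0// mulr_ge0// sqr_ge0.
have f20 z : (0 <= f2 z)%E by rewrite lee_fin mulr_ge0// mulr_ge0// sqr_ge0.
have mf1 : measurable_fun setT f1.
  apply/measurable_EFinP; apply: measurable_funM => //; apply: measurable_funM => //.
  by apply: measurable_funX; exact: measurableT_comp.
have mf2 : measurable_fun setT f2.
  apply/measurable_EFinP; apply: measurable_funM => //; apply: measurable_funM => //.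
  by apply: measurable_funX; exact: measurableT_comp.
have half (f : R * R -> \bar R) : (forall x, (\int[mu]_y f (x, y) <= (2^-1 * g x ^+ 2)%:E * 8%:E)%E) ->
   (forall z, (0 <= f z)%E) -> measurable_fun setT f ->
   (\int[mu]_x \int[mu]_y f (x, y) <= 4%:E * \int[mu]_x (g x ^+ 2)%:E)%E.
  move=> fg f0 mf; rewrite -ge0_integralZl//; last by move=> x _; rewrite lee_fin sqr_ge0.
  apply: ge0_le_integral => //.
  - by move=> x _; exact: integral_ge0.
  - exact: (measurable_fun_fubini_tonelli_F (m2 := mu) _ mf f0).
  - exact: measurable_funeM.
  - move=> x _; apply: (le_trans (fg x)); rewrite -!EFinM lee_fin; lra.
apply: (@le_trans _ _ (\int[mu]_x `|g x * J x|%:E)%E).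
  apply: (@le_trans _ _ (`|\int[mu]_x (g x * J x)|%:E)); first by rewrite lee_fin ler_norm.
  by rewrite (EFin_normr_Rintegral measurableT igJ); exact: le_abse_integral.
apply: (@le_trans _ _ (\int[mu]_x (\int[mu]_y f1 (x, y) + \int[mu]_y f2 (x, y)))%E).
  apply: ge0_le_integral => //.
  - by apply/measurable_EFinP; apply: measurableT_comp => //; exact/measurable_EFinP.
  - apply: emeasurable_funD; [exact: (measurable_fun_fubini_tonelli_F (m2 := mu) _ mf1 f10)|exact: (measurable_fun_fubini_tonelli_F (m2 := mu) _ mf2 f20)].
  - move=> x _; apply: (le_trans (gJ_le x)); rewrite -ge0_integralD//; last 2 first.
    + exact: measurableT_comp mf1 (pair1_measurable x).
    + exact: measurableT_comp mf2 (pair1_measurable x).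
    apply: le_of_eq; apply: eq_integral => y _.
    by rewrite /f1 /f2/= -EFinD; congr EFin; ring.
rewrite ge0_integralD//; last 4 first.
- by move=> x _; exact: integral_ge0.
- exact: (measurable_fun_fubini_tonelli_F (m2 := mu) _ mf1 f10).
- by move=> x _; exact: integral_ge0.
- exact: (measurable_fun_fubini_tonelli_F (m2 := mu) _ mf2 f20).
have -> : (8%:E = 4%:E + 4%:E :> \bar R)%E by rewrite -EFinD; congr EFin; lra.
rewrite ge0_muleDl ?lee_fin//; apply: leeD.
  apply: (half f1) => // x; rewrite /f1/=.
  by apply: integral_bound; rewrite mulr_ge0// sqr_ge0.
rewrite [leLHS](fubini_tonelli (m1 := mu) (m2 := mu) f2 mf2 f20).
apply: (half (fun z => f2 (z.2, z.1))) => //.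
- move=> x; rewrite /f2/=; under eq_integral do rewrite boundC.
  by apply: integral_bound; rewrite mulr_ge0// sqr_ge0.
- by apply: measurableT_comp mf2 _; exact: measurable_swap.
Qed.

(** The weight is at least 3/4 on the half interval, and 4/3 times 8 is below 11. A general phase
    reduces to [C] and [S], because cos c and sin c are the coordinates of a unit vector. *)
Lemma plancherel1_cutoff c : (\int[mu]_(xi in `[(- (N / 2))%R, (N / 2)%R])
   (cos_transform1 g c xi ^+ 2)%:E <= 11%:E * \int[mu]_x (g x ^+ 2)%:E)%E.
Proof.
pose G xi := k xi * (C xi ^+ 2 + S xi ^+ 2).
have G0 xi : 0 <= G xi by rewrite mulr_ge0// ?addr_ge0 ?sqr_ge0//; case/andP: (k01 xi).
have mG : measurable_fun setT G.
  by apply: measurable_funM => //; apply: measurable_funD; exact: measurable_funX.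
have h2 xi : cos_transform1 g c xi ^+ 2 <= C xi ^+ 2 + S xi ^+ 2.
  have -> : cos_transform1 g c xi = cos c * C xi + sin c * S xi.
    rewrite -!RintegralZl//; try exact: iphase.
    rewrite -RintegralD//; last 2 first.
    - exact: (integrableZl measurableT _ (iphase _ xi)).
    - exact: (integrableZl measurableT _ (iphase _ xi)).
    by apply: eq_Rintegral => x _; rewrite cos0 cosBpi2 cosB; ring.
  have := cos2Dsin2 c; set u := cos c; set v := sin c => uv.
  rewrite -subr_ge0 (_ : _ - _ = (v * C xi - u * S xi) ^+ 2 + (1 - (u ^+ 2 + v ^+ 2)) * (C xi ^+ 2 + S xi ^+ 2)); last by ring.
  by rewrite uv subrr mul0r addr0 sqr_ge0.
have N2 : 0 < N / 2 by rewrite divr_gt0.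
apply: (@le_trans _ _ ((4 / 3)%:E * \int[mu]_xi (G xi)%:E)%E).
  rewrite -ge0_integralZl//; last 2 first.
  - exact/measurable_EFinP.
  - by move=> xi _; rewrite lee_fin.
  rewrite [leLHS]integral_mkcond; apply: ge0_le_integral => //.
  - by move=> xi _; rewrite patchE; case: ifP => _//; rewrite lee_fin sqr_ge0.
  - apply/(measurable_restrictT _ _).1 => //.
    by apply: measurable_funTS; apply/measurable_EFinP; apply: measurable_funX; exact: mh.
  - by apply: measurable_funeM; exact/measurable_EFinP.
  - move=> xi _; rewrite patchE -EFinM; case: ifPn => [|_]; last by rewrite lee_fin mulr_ge0// divr_ge0.
    rewrite inE/= in_itv/= => /andP[Nx xN]; rewrite lee_fin; apply: (le_trans (h2 xi)).
    rewrite /G mulrA ler_peMl ?addr_ge0 ?sqr_ge0// /k indicE mem_set ?mulr1; last first.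
      by rewrite /= in_itv/=; apply/andP; split; lra.
    have : xi ^+ 2 / N ^+ 2 <= 4^-1.
      by rewrite ler_pdivrMr ?exprn_gt0//; nra.
    by lra.
have bG : bounded_support mu (1 * (K ^+ 2 + K ^+ 2)) `[- N, N]%classic G.
  apply: bounded_supportM => //.
  - by apply: measurable_funD; exact: measurable_funX.
  - by rewrite addr_ge0 ?sqr_ge0.
  - move=> xi; rewrite ger0_norm ?addr_ge0 ?sqr_ge0//.
    have := C_le xi; have := S_le xi; rewrite -/K.
    rewrite -(real_normK (num_real (C xi))) -(real_normK (num_real (S xi))).
    by move=> h1 h3; rewrite lerD// ler_sqr ?nnegrE.
have EG : (\int[mu]_xi (G xi)%:E = energy%:E)%E.
  by rewrite /energy /Rintegral fineK//; exact: integrable_fin_num (bounded_support_integrable bG).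
rewrite EG; apply: (@le_trans _ _ ((4 / 3)%:E * (8%:E * \int[mu]_x (g x ^+ 2)%:E))%E).
  by rewrite lee_wpmul2l// lee_fin; lra.
rewrite muleA -EFinM lee_wpmul2r//; last by rewrite lee_fin; lra.
by apply: integral_ge0 => x _; rewrite lee_fin sqr_ge0.
Qed.
End plancherel1.

Lemma plancherel1 {R : realType} (g : R -> R) M A c :
  bounded_support lebesgue_measure M A g ->
  (\int[lebesgue_measure]_xi (cos_transform1 g c xi ^+ 2)%:E <=
    11%:E * \int[lebesgue_measure]_x (g x ^+ 2)%:E)%E.
Proof.
move=> bg; have [mg _ _ _ _] := bg.
have mh : measurable_fun setT (fun xi => (cos_transform1 g c xi ^+ 2)%:E).
  by apply/measurable_EFinP; apply: measurable_funX; exact: measurable_cos_transform1.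
apply: (@integral_exhaustion _ _ _ lebesgue_measure _ _ _ homo_itv_nat _ bigcup_itv_nat) => //.
  by move=> x; rewrite lee_fin sqr_ge0.
move=> i.
(* The cutoff N = 2 (i + 1) is positive even for i = 0, and half of it covers [-i, i]. *)
have N0 : 0 < 2 * i.+1%:R :> R by rewrite mulr_gt0.
apply: le_trans (plancherel1_cutoff bg N0 c).
apply: ge0_subset_integral => //.
- exact: measurable_funTS.
- by move=> x _; rewrite lee_fin sqr_ge0.
- move=> x /=; rewrite !in_itv/= mulrC mulKf// => /andP[ix xi].
  have : i%:R <= i.+1%:R :> R by rewrite ler_nat.
  by move=> h; apply/andP; split; lra.
Qed.

(** * Integration on R^n one coordinate at a time, and Plancherel by induction on n *)

Section tuple_integral.
Context {R : realType}.
Local Notation la := (@lebesgue_measure R).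
Local Notation mu n := (@lebesgue_Rn R n).

Lemma dot_cons n (x xi : R) (t eta : n.-tuple R) :
  dot (tuple_cons (x, t)) (tuple_cons (xi, eta)) = x * xi + dot t eta.
Proof.
rewrite /dot big_ord_recl !tnth0; congr (_ + _).
by apply: eq_bigr => j _; rewrite !tnthS.
Qed.

Lemma measurable_dot d (T : measurableType d) n (f g : T -> n.-tuple R) :
  measurable_fun setT f -> measurable_fun setT g ->
  measurable_fun setT (fun x => dot (f x) (g x)).
Proof.
move=> mf mg; rewrite /dot; apply: measurable_sum => j.
apply: measurable_funM.
  exact: (measurableT_comp (measurable_tnth j) mf).
exact: (measurableT_comp (measurable_tnth j) mg).
Qed.

Definition product_Rn n : {measure set _ -> \bar R} :=
  product_measure1 la (mu n).

Local Notation lR := (g_sigma_algebraType R.-ocitv.-measurable).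

(* [tuple_cons] seen from the type on which [lebesgue_measure] lives *)
Lemma measurable_lebesgue_cons n :
  measurable_fun setT (@tuple_cons R n : lR * n.-tuple R -> n.+1.-tuple R).
Proof. exact: measurable_tuple_cons. Qed.

Lemma ge0_integral_tuple_cons n (F : n.+1.-tuple R -> \bar R) :
  measurable_fun setT F -> (forall t, (0 <= F t)%E) ->
  (\int[mu n.+1]_t F t = \int[la]_x \int[mu n]_t F (tuple_cons (x, t)))%E.
Proof.
move=> mF F0.
have mc := @measurable_lebesgue_cons n.
rewrite [LHS](ge0_integral_pushforward mc (product_Rn n) measurableT)//.
rewrite preimage_setT /product_Rn (fubini_tonelli1 (m1 := la) (m2 := mu n))//=.
exact: (measurableT_comp mF mc).
Qed.

Lemma integrable_tuple_cons n (F : n.+1.-tuple R -> \bar R) :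
  (mu n.+1).-integrable setT F ->
  (product_Rn n).-integrable setT (F \o @tuple_cons R n).
Proof.
move=> /integrableP[mF Foo]; have mc := @measurable_lebesgue_cons n.
apply/integrableP; split; first exact: (measurableT_comp mF mc).
rewrite -(preimage_setT (@tuple_cons R n)).
rewrite -(@ge0_integral_pushforward _ _ _ _ _ _ mc (product_Rn n) setT (fun t => `|F t|%E))//.
exact: measurableT_comp.
Qed.

Lemma integral_tuple_cons n (F : n.+1.-tuple R -> \bar R) :
  (mu n.+1).-integrable setT F ->
  (\int[mu n.+1]_t F t = \int[product_Rn n]_z F (tuple_cons z))%E.
Proof.
move=> iF; have mc := @measurable_lebesgue_cons n.
have iF' : (product_Rn n).-integrable (@tuple_cons R n @^-1` setT) (F \o @tuple_cons R n).
  by rewrite preimage_setT; exact: integrable_tuple_cons.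
rewrite [LHS](integral_pushforward mc (measurable_int _ iF) iF' measurableT).
by rewrite preimage_setT.
Qed.

(** Cubes are the supports of choice since they factor along [tuple_cons], as induction on the
    dimension requires. *)
Definition cube n (r : R) : set (n.-tuple R) := [set t | forall j, `|tnth t j| <= r].

Lemma measurable_cube n r : measurable (@cube n r).
Proof.
rewrite (_ : @cube n r = \bigcap_(j in [set: 'I_n]) [set t | `|tnth t j| <= r]).
  apply: fin_bigcap_measurable => // j _; rewrite -[X in measurable X]setTI.
  apply: measurable_fun_le => //; apply: measurableT_comp => //.
  exact: measurable_tnth.
by apply/seteqP; split => t /= tr => [j _|j]; [exact: tr|exact: (tr j I)].
Qed.

Lemma cube_cons n r x (t : n.-tuple R) :
  cube r (tuple_cons (x, t)) <-> `|x| <= r /\ cube r t.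
Proof.
split=> [h|[xr tr] j].
  split; first by have := h ord0; rewrite tnth0.
  by move=> j; have := h (lift ord0 j); rewrite tnthS.
by case: (unliftP ord0 j) => [k ->|->]; rewrite ?tnthS ?tnth0//; exact: tr.
Qed.

Lemma indic_cube_cons n r x (t : n.-tuple R) :
  \1_(cube r) (tuple_cons (x, t)) = \1_`[- r, r] x * \1_(cube r) t :> R.
Proof.
rewrite !indicE -natrM mulnb; congr (nat_of_bool _)%:R; apply/idP/andP.
  by rewrite inE => /cube_cons[xr tr]; rewrite !inE/= in_itv/= -ler_norml.
by rewrite !inE/= in_itv/= -ler_norml => -[xr tr]; apply/cube_cons.
Qed.

Lemma measure_cube n (r : R) : 0 <= r -> mu n (cube r) = ((2 * r) ^+ n)%:E.
Proof.
move=> r0; elim: n => [|n IH].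
  by rewrite /= diracE expr0 mem_set// => -[].
have -> : mu n.+1 (cube r) = (la \x mu n)%E (`[(- r)%R, r]%classic `*` cube r).
  rewrite /= /pushforward; congr (_ _); apply/seteqP; split => -[x t] /=.
    by move=> /cube_cons[xr tr]; rewrite in_itv/= -ler_norml.
  by rewrite in_itv/= -ler_norml => -[xr tr]; apply/cube_cons.
rewrite (_ : (_ \x _)%E _ = (la `[(- r)%R, r] * mu n (cube r))%E); last first.
  by apply: product_measure1E => //; exact: measurable_cube.
rewrite IH lebesgue_measure_itv/= exprS EFinM; congr (_ * _)%E.
rewrite lte_fin; case: ltP => [_|]; first by rewrite -EFinB; congr EFin; ring.
by move=> rr; rewrite (_ : r = 0) ?mulr0//; lra.
Qed.

Lemma cube_lty n r : (mu n (cube r) < +oo)%E.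
Proof.
apply: (@le_lt_trans _ _ (mu n (cube `|r|))); last by rewrite measure_cube ?ltry.
apply: le_measure; rewrite ?inE; [exact: measurable_cube..|].
by move=> t tr j; exact: le_trans (tr j) (ler_norm r).
Qed.

(* The phases [c = 0] and [c = pi / 2] give the real part and, up to sign, the imaginary
   part of the Fourier transform of a real function. *)
Definition cos_transform n (g : n.-tuple R -> R) (c : R) (xi : n.-tuple R) : R :=
  \int[mu n]_t (g t * cos (2 * pi * dot t xi - c)).

Lemma measurable_cos_transform n (g : n.-tuple R -> R) c : measurable_fun setT g ->
  measurable_fun setT (cos_transform g c).
Proof.
move=> mg; suff mphase : measurable_fun setT
    (fun z : n.-tuple R * n.-tuple R => g z.2 * cos (2 * pi * dot z.2 z.1 - c)).
  exact: (measurable_Rintegral (mu n) mphase).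
apply: measurable_funM; first exact: measurableT_comp.
apply: measurable_fcos; apply: measurable_funB => //; apply: measurable_funM => //.
exact: measurable_dot.
Qed.
End tuple_integral.

Section plancherel_cube.
Context {R : realType}.
Local Notation la := (@lebesgue_measure R).
Local Notation mu n := (@lebesgue_Rn R n).

Let mE d (T : measurableType d) (m : {measure set T -> \bar R}) M A (f : T -> R) :
  bounded_support m M A f -> measurable_fun setT f.
Proof. by case. Qed.

Let cube_le n M r (g : n.+1.-tuple R -> R) :
  bounded_support (mu n.+1) M (cube r) g ->
  forall x t, `|g (tuple_cons (x, t))| <= M * \1_`[- r, r] x * \1_(cube r) t.
Proof. by move=> [_ _ _ _ gM] x t; rewrite -mulrA -indic_cube_cons. Qed.

Let mI (r : R) : measurable (`[- r, r]%classic : set R). Proof. exact: measurable_itv. Qed.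

Let mcons n (g : n.+1.-tuple R -> R) : measurable_fun setT g ->
  measurable_fun setT (fun z : R * n.-tuple R => g (tuple_cons z)).
Proof. by move=> mg; exact: (measurableT_comp mg (@measurable_tuple_cons R n)). Qed.

Lemma Rintegral_tuple_cons n M r (g : n.+1.-tuple R -> R) :
  bounded_support (mu n.+1) M (cube r) g ->
  \int[mu n.+1]_t g t = \int[mu n]_t \int[la]_x g (tuple_cons (x, t)).
Proof.
move=> bg; have ig := bounded_support_integrable bg.
rewrite /Rintegral (integral_tuple_cons ig); congr fine.
rewrite -(integral21_prod_meas1 (m1 := la) (m2 := mu n) (integrable_tuple_cons ig)).
apply: eq_integral => t _ /=; rewrite fineK//; apply: integrable_fin_num => //.
have [_ _ _ M0 _] := bg.
have bs := bounded_support_section2 (m1 := la) (mcons (mE bg)) (mI r) (itv_lty _ _) M0 (cube_le bg).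
exact: bounded_support_integrable (bs t).
Qed.

Definition partial_transform n (g : n.+1.-tuple R -> R) (a xi : R) (t : n.-tuple R) : R :=
  cos_transform1 (fun x => g (tuple_cons (x, t))) a xi.

Lemma measurable_partial_transform n (g : n.+1.-tuple R -> R) a : measurable_fun setT g ->
  measurable_fun setT (fun z : R * n.-tuple R => partial_transform g a z.1 z.2).
Proof.
move=> mg; suff mF : measurable_fun setT (fun w : (R * n.-tuple R) * R =>
    g (tuple_cons (w.2, w.1.2)) * cos (2 * pi * (w.2 * w.1.1) - a)).
  exact: (measurable_Rintegral la mF).
apply: measurable_funM.
  apply: (measurableT_comp (mcons mg)); apply/measurable_fun_pair => //=.
  exact: measurableT_comp.
apply: measurable_fcos; apply: measurable_funB => //; apply: measurable_funM => //.
by apply: measurable_funM => //; exact: measurableT_comp.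
Qed.

Lemma bounded_support_section n M r (g : n.+1.-tuple R -> R) t :
  bounded_support (mu n.+1) M (cube r) g ->
  bounded_support la (M * \1_(cube r) t) `[- r, r]%classic (fun x => g (tuple_cons (x, t))).
Proof.
move=> bg; have [_ _ _ M0 _] := bg.
exact: (bounded_support_section2 (m1 := la) (mcons (mE bg)) (mI r) (itv_lty _ _) M0 (cube_le bg)).
Qed.

Let bcos d (T : measurableType d) (m : {measure set T -> \bar R}) M A (f g : T -> R) :
  bounded_support m M A f -> measurable_fun setT g ->
  bounded_support m (M * 1) A (fun x => f x * cos (g x)).
Proof.
move=> bf mg; apply: bounded_supportM => //; last by move=> x; exact: cos_max.
exact: measurable_fcos.
Qed.

Lemma bounded_support_partial_transform n M r (g : n.+1.-tuple R -> R) a xi :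
  bounded_support (mu n.+1) M (cube r) g ->
  bounded_support (mu n) (M * fine (la `[- r, r]%classic)) (cube r) (partial_transform g a xi).
Proof.
move=> bg; have [mg _ _ M0 _] := bg.
pose F (z : n.-tuple R * R) := g (tuple_cons (z.2, z.1)) * cos (2 * pi * (z.2 * xi) - a).
have mF : measurable_fun setT F.
  apply: measurable_funM.
    by apply: (measurableT_comp (mcons mg)); exact: measurable_swap.
  apply: measurable_fcos; apply: measurable_funB => //; apply: measurable_funM => //.
  exact: measurable_funM.
have FM t x : `|F (t, x)| <= M * \1_(cube r) t * \1_`[- r, r] x.
  rewrite normrM -[leRHS]mulr1; apply: ler_pM => //; last exact: cos_max.
  by rewrite mulrAC; exact: cube_le.
exact: (bounded_support_Rintegral1 (m1 := mu n) (m2 := la) mF (@measurable_cube _ _ _)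
  (mI r) (cube_lty n r) (itv_lty _ _) M0 FM).
Qed.

(** The formula for cos (u + v) with both sines written as cosines shifted by pi/2, so that the
    family of transforms with a phase is closed under splitting off a variable. *)
Lemma cos_transform_cons n M r (g : n.+1.-tuple R -> R) c xi eta :
  bounded_support (mu n.+1) M (cube r) g ->
  cos_transform g c (tuple_cons (xi, eta)) =
  cos_transform (partial_transform g 0 xi) c eta -
  cos_transform (partial_transform g (pi / 2) xi) (c + pi / 2) eta.
Proof.
move=> bg; have [mg _ _ M0 _] := bg.
have mdot (k : nat) (s : k.-tuple R) (b : R) :
    measurable_fun setT (fun t : k.-tuple R => 2 * pi * dot t s - b).
  apply: measurable_funB => //; apply: measurable_funM => //.
  exact: measurable_dot.
rewrite {1}/cos_transform (Rintegral_tuple_cons (bcos bg (mdot _ _ c))).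
have ih a b := bounded_support_integrable
  (bcos (bounded_support_partial_transform a xi bg) (mdot _ eta b)).
rewrite /cos_transform -RintegralB//.
apply: eq_Rintegral => t _.
have mx a : measurable_fun setT (fun x : R => 2 * pi * (x * xi) - a).
  by apply: measurable_funB => //; do 2 apply: measurable_funM => //.
have ix a := bounded_support_integrable (bcos (bounded_support_section t bg) (mx a)).
rewrite /partial_transform /cos_transform1 -!RintegralZr//.
rewrite -RintegralB//; last 2 first.
- have := integrableZr measurableT (cos (2 * pi * dot t eta - c)) (ix 0); exact.
- have := integrableZr measurableT (cos (2 * pi * dot t eta - (c + pi / 2))) (ix (pi / 2)); exact.
apply: eq_Rintegral => x _; rewrite dot_cons -!mulrA -mulrBr; congr (_ * _).
rewrite subr0 opprD addrA !cosBpi2 -cosD; congr cos; ring.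
Qed.

(** Induction on n: [plancherel1] in the first variable for each fixed tail, the induction
    hypothesis in the others. In dimension 0 the measure is a point mass and only cos^2 <= 1
    remains. *)
Lemma plancherel_cube n : exists2 B : R, 0 <= B & forall M r (g : n.-tuple R -> R) c,
  bounded_support (mu n) M (cube r) g ->
  (\int[mu n]_xi (cos_transform g c xi ^+ 2)%:E <= B%:E * \int[mu n]_x (g x ^+ 2)%:E)%E.
Proof.
elim: n => [|n [B B0 IH]].
  exists 1 => // M r g c bg; have [mg _ _ _ _] := bg; rewrite mul1e.
  have I0 (f : 0.-tuple R -> \bar R) : measurable_fun setT f ->
      (\int[mu 0]_t f t = f [tuple])%E.
    by move=> mf; rewrite /= [LHS]integral_dirac// diracT mul1e.
  have mcT := measurable_cos_transform c mg.
  rewrite !I0; last 2 first.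
  - by apply/measurable_EFinP; exact: measurable_funX.
  - by apply/measurable_EFinP; exact: measurable_funX.
  rewrite lee_fin /cos_transform /Rintegral I0; last first.
    apply/measurable_EFinP; apply: measurable_funM => //; apply: measurable_fcos.
    by apply: measurable_funB => //; apply: measurable_funM => //; exact: measurable_dot.
  rewrite /= exprMn; set a := _ - c; apply: ler_piMr; first exact: sqr_ge0.
  by have := cos2Dsin2 a; have := sqr_ge0 (sin a); lra.
(* 44 = 2 + 2 times 11: [cos_transform_cons] has two terms, (u - v)^2 <= 2 u^2 + 2 v^2, and
   [plancherel1] costs 11 for each. *)
exists (44 * B); first by rewrite mulr_ge0.
move=> M r g c bg; have [mg _ _ M0 _] := bg.
have mg2 : measurable_fun setT (fun t => (g t ^+ 2)%:E).
  by apply/measurable_EFinP; exact: measurable_funX.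
pose h a (z : R * n.-tuple R) := (partial_transform g a z.1 z.2 ^+ 2)%:E.
have mh a : measurable_fun setT (h a).
  apply/measurable_EFinP; apply: measurable_funX; exact: measurable_partial_transform.
have h0 a z : (0 <= h a z)%E by rewrite lee_fin sqr_ge0.
have I0 : (0 <= \int[mu n.+1]_x (g x ^+ 2)%:E)%E.
  by apply: integral_ge0 => t _; rewrite lee_fin sqr_ge0.
have hI a : (\int[la]_xi \int[mu n]_t h a (xi, t) <= 11%:E * \int[mu n.+1]_x (g x ^+ 2)%:E)%E.
  rewrite (fubini_tonelli (m1 := la) (m2 := mu n) (h a) (mh a) (h0 a)).
  rewrite ge0_integral_tuple_cons//; last by move=> t; rewrite lee_fin sqr_ge0.
  pose g2 (z : R * n.-tuple R) := (g (tuple_cons z) ^+ 2)%:E.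
  have mg2' : measurable_fun setT g2.
    by apply/measurable_EFinP; apply: measurable_funX; exact: mcons.
  have g20 z : (0 <= g2 z)%E by rewrite lee_fin sqr_ge0.
  rewrite [X in (_ <= _ * X)%E](fubini_tonelli (m1 := la) (m2 := mu n) g2 mg2' g20).
  rewrite -ge0_integralZl//; last 2 first.
  - exact: (measurable_fun_fubini_tonelli_G (m1 := la) g2 mg2' g20).
  - by move=> t _; exact: integral_ge0.
  apply: ge0_le_integral => //.
  - by move=> t _; exact: integral_ge0.
  - exact: (measurable_fun_fubini_tonelli_G (m1 := la) _ (mh a) (h0 a)).
  - apply: measurable_funeM; exact: (measurable_fun_fubini_tonelli_G (m1 := la) g2 mg2' g20).
  - move=> t _; exact: (plancherel1 a (bounded_support_section t bg)).
rewrite [leLHS]ge0_integral_tuple_cons; last 2 first.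
- apply/measurable_EFinP; apply: measurable_funX; exact: measurable_cos_transform.
- by move=> t; rewrite lee_fin sqr_ge0.
apply: (@le_trans _ _ (\int[la]_xi ((2 * B)%:E * \int[mu n]_t h 0%R (xi, t) +
   (2 * B)%:E * \int[mu n]_t h (pi / 2)%R (xi, t)))%E).
  have mct := measurable_cos_transform c mg.
  have mu2 a b xi : measurable_fun setT
      (fun eta => (cos_transform (partial_transform g a xi) b eta ^+ 2)%:E).
    apply/measurable_EFinP; apply: measurable_funX; apply: measurable_cos_transform.
    exact: mE (bounded_support_partial_transform a xi bg).
  apply: ge0_le_integral => //.
  - by move=> xi _; apply: integral_ge0 => eta _; rewrite lee_fin sqr_ge0.
  - apply: (measurable_fun_fubini_tonelli_F (m2 := mu n)
      (fun z => (cos_transform g c (tuple_cons z) ^+ 2)%:E)).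
      by apply/measurable_EFinP; apply: measurable_funX; exact: mcons.
    by move=> z; rewrite lee_fin sqr_ge0.
  - apply: emeasurable_funD; apply: measurable_funeM.
    + exact: (measurable_fun_fubini_tonelli_F (m2 := mu n) _ (mh 0) (h0 0)).
    + exact: (measurable_fun_fubini_tonelli_F (m2 := mu n) _ (mh (pi / 2)) (h0 (pi / 2))).
  move=> xi _.
  apply: (@le_trans _ _ (\int[mu n]_eta
    (2%:E * (cos_transform (partial_transform g 0 xi) c eta ^+ 2)%:E +
     2%:E * (cos_transform (partial_transform g (pi / 2) xi) (c + pi / 2) eta ^+ 2)%:E))%E).
    apply: ge0_le_integral => //.
    - by move=> eta _; rewrite lee_fin sqr_ge0.
    - apply/measurable_EFinP; apply: measurable_funX.
      exact: (measurableT_comp (mcons mct) (pair1_measurable xi)).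
    - by apply: emeasurable_funD; apply: measurable_funeM; exact: mu2.
    - move=> eta _; rewrite (cos_transform_cons _ _ _ bg) -!EFinM -EFinD lee_fin.
      set u := cos_transform _ _ _; set v := cos_transform _ _ _.
      have := sqr_ge0 (u + v); rewrite -subr_ge0.
      by rewrite -[X in _ -> 0 <= X](_ : (u + v) ^+ 2 = _)//; ring.
  rewrite ge0_integralD//; last 4 first.
  - by move=> eta _; rewrite -EFinM lee_fin mulr_ge0 ?sqr_ge0.
  - by apply: measurable_funeM; exact: mu2.
  - by move=> eta _; rewrite -EFinM lee_fin mulr_ge0 ?sqr_ge0.
  - by apply: measurable_funeM; exact: mu2.
  have two a b : (\int[mu n]_eta (2%:E * (cos_transform (partial_transform g a xi) b eta ^+ 2)%:E)
      <= (2 * B)%:E * \int[mu n]_t h a (xi, t))%E.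
    rewrite ge0_integralZl//; last first.
      by move=> eta _; rewrite lee_fin sqr_ge0.
    rewrite (EFinM 2 B) -muleA; apply: lee_wpmul2l => //.
    exact: IH (bounded_support_partial_transform a xi bg).
  by apply: leeD; exact: two.
have B20 : (0 <= (2 * B)%:E)%E by rewrite lee_fin mulr_ge0.
have mhI a : measurable_fun setT (fun xi => \int[mu n]_t h a (xi, t))%E.
  exact: (measurable_fun_fubini_tonelli_F (m2 := mu n) _ (mh a) (h0 a)).
have hI0 a xi : (0 <= \int[mu n]_t h a (xi, t))%E by exact: integral_ge0.
rewrite ge0_integralD//; last 4 first.
- by move=> xi _; rewrite mule_ge0.
- by apply: measurable_funeM; exact: mhI.
- by move=> xi _; rewrite mule_ge0.
- by apply: measurable_funeM; exact: mhI.
have Z a : (\int[la]_xi ((2 * B)%:E * \int[mu n]_t h a (xi, t)) <=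
    (2 * B)%:E * (11%:E * \int[mu n.+1]_x (g x ^+ 2)%:E))%E.
  rewrite (ge0_integralZl la measurableT (mhI a) (fun xi _ => hI0 a xi) B20).
  exact: lee_wpmul2l.
apply: (le_trans (leeD (Z 0) (Z (pi / 2)))).
rewrite muleA -EFinM -ge0_muleDl ?lee_fin ?mulr_ge0// -EFinD lee_wpmul2r// lee_fin; lra.
Qed.
End plancherel_cube.

(** * The maximal inequality *)

Lemma fatou_le {R : realType} d (T : measurableType d) (mu : {measure set T -> \bar R})
    (f : T -> \bar R) (u : nat -> T -> \bar R) (c : \bar R) :
  (forall k, measurable_fun setT (u k)) -> (forall k x, (0 <= u k x)%E) ->
  (forall x, u ^~ x @ \oo --> f x) -> (forall k, (\int[mu]_x u k x <= c)%E) ->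
  (\int[mu]_x f x <= c)%E.
Proof.
move=> mu0 u0 uf uc.
rewrite (eq_integral (fun x => limn_einf (u ^~ x))); last first.
  by move=> x _; rewrite (cvg_limn_einf_sup (uf x)).1.
apply: (le_trans (fatou mu measurableT mu0 (fun k x _ => u0 k x))).
rewrite limn_einf_lim; apply: lime_le; first exact: is_cvg_einfs.
apply: nearW => k; apply: le_trans (uc k).
by apply: ereal_inf_lbound; exists k => /=.
Qed.

Section hausdorff_young.
Context {R : realType} (n : nat).
Local Notation mu := (@lebesgue_Rn R n).
Implicit Types (g h : n.-tuple R -> R) (xi : n.-tuple R).

Lemma integrable_phase g c xi : mu.-integrable setT (EFin \o g) ->
  mu.-integrable setT (EFin \o (fun t => g t * cos (2 * pi * dot t xi - c))).
Proof.
move=> ig; have mg : measurable_fun setT g by apply/measurable_EFinP; exact: measurable_int ig.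
apply: le_integrable ig => //.
  apply/measurable_EFinP; apply: measurable_funM => //; apply: measurable_fcos.
  by apply: measurable_funB => //; apply: measurable_funM => //; exact: measurable_dot.
by move=> x _ /=; rewrite lee_fin normrM ler_piMr// cos_max.
Qed.

Lemma cos_transformD g h c xi : mu.-integrable setT (EFin \o g) ->
  mu.-integrable setT (EFin \o h) ->
  cos_transform (g \+ h) c xi = cos_transform g c xi + cos_transform h c xi.
Proof.
move=> ig ih; rewrite /cos_transform -RintegralD//; [|exact: integrable_phase..].
by apply: eq_Rintegral => t _; rewrite mulrDl.
Qed.

Lemma cos_transform_le g c xi : mu.-integrable setT (EFin \o g) ->
  (`|cos_transform g c xi|%:E <= \int[mu]_t `|g t|%:E)%E.
Proof.
move=> ig; have ip := integrable_phase c xi ig.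
have mg : measurable_fun setT g by apply/measurable_EFinP; exact: measurable_int ig.
rewrite (EFin_normr_Rintegral measurableT ip).
apply: (le_trans (le_abse_integral _ _ _)) => //; first exact: measurable_int ip.
apply: ge0_le_integral => //.
- by apply: measurableT_comp => //; exact: measurable_int ip.
- by apply/measurable_EFinP; exact: measurableT_comp.
- by move=> t _ /=; rewrite lee_fin normrM ler_piMr// cos_max.
Qed.

Lemma cos_transform_cvg (g : n.-tuple R -> R) (u : nat -> n.-tuple R -> R) c xi :
  mu.-integrable setT (EFin \o g) -> (forall k, measurable_fun setT (u k)) ->
  forall h, measurable_fun setT h ->
  (forall k t, `|u k t| <= `|g t|) -> (forall t, u ^~ t @ \oo --> h t) ->
  (cos_transform (u k) c xi @[k --> \oo] --> cos_transform h c xi).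
Proof.
move=> ig mu0 h mh ug uh.
have mph (v : n.-tuple R -> R) : measurable_fun setT v ->
    measurable_fun setT (fun t => (v t * cos (2 * pi * dot t xi - c))%:E).
  move=> mv; apply/measurable_EFinP; apply: measurable_funM => //; apply: measurable_fcos.
  by apply: measurable_funB => //; apply: measurable_funM => //; exact: measurable_dot.
have hg t : `|h t| <= `|g t|.
  have uh' : `|u k t| @[k --> \oo] --> `|h t| by apply: cvg_norm; exact: uh.
  rewrite -(cvg_lim _ uh')//; apply: limr_le; first by apply/cvg_ex; exists `|h t|.
  by apply: nearW => k; exact: ug.
have cc v t : `|v * cos (2 * pi * dot t xi - c)| <= `|v|.
  by rewrite normrM ler_piMr// cos_max.
have cv : (\int[mu]_t (u k t * cos (2 * pi * dot t xi - c))%:E @[k --> \oo] -->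
    \int[mu]_t (h t * cos (2 * pi * dot t xi - c))%:E)%E.
  have [] := @dominated_convergence _ _ _ mu setT measurableT
    (fun k t => (u k t * cos (2 * pi * dot t xi - c))%:E)
    (fun t => (h t * cos (2 * pi * dot t xi - c))%:E) (fun t => `|(g t)%:E|%E) => //.
  - by move=> k; exact: mph.
  - exact: mph.
  - apply: aeW => t _; apply: cvg_EFin; first by apply: nearW.
    by apply: cvgM; [exact: uh|exact: cvg_cst].
  - exact: integrable_abse.
  - by apply: aeW => t k _; rewrite lee_fin; apply: le_trans (cc _ _) (ug k t).
apply: fine_cvg; rewrite fineK//.
apply: integrable_fin_num => //.
apply: le_integrable ig => //; first exact: mph.
by move=> t _; rewrite lee_fin (le_trans (cc _ _)).
Qed.

(** Truncate g both in space and in height. The transforms of the truncations converge pointwise by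
    dominated convergence, and Fatou's lemma passes the inequality to the limit; the right-hand side
    may be infinite. *)
Lemma plancherel_integrable : exists2 B : R, 0 <= B & forall g c,
  mu.-integrable setT (EFin \o g) ->
  (\int[mu]_xi (cos_transform g c xi ^+ 2)%:E <= B%:E * \int[mu]_x (g x ^+ 2)%:E)%E.
Proof.
have [B B0 HB] := @plancherel_cube R n; exists B => // g c ig.
have mg : measurable_fun setT g by apply/measurable_EFinP; exact: measurable_int ig.
pose E k : set (n.-tuple R) := cube k%:R `&` [set t | `|g t| <= k%:R].
have mE k : measurable (E k).
  apply: measurableI; first exact: measurable_cube.
  rewrite -[X in measurable X]setTI; apply: measurable_fun_le => //.
  exact: measurableT_comp.
pose u k t := g t * \1_(E k) t.
have mu0 k : measurable_fun setT (u k).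
  by apply: measurable_funM => //; exact: measurable_indic.
have ug k t : `|u k t| <= `|g t|.
  by rewrite normrM ler_piMr// indicE; case: (_ \in _); rewrite ?normr1 ?normr0.
have ulim t : u ^~ t @ \oo --> g t.
  apply: cvg_near_cst.
  have [N tN] : exists N : nat, cube N%:R t /\ `|g t| <= N%:R.
    pose s := \sum_(j < n) `|tnth t j| + `|g t|.
    have s0 : 0 <= s by rewrite addr_ge0// sumr_ge0.
    have sN := ltW (archi_boundP s0).
    exists (Num.bound s); split => [j|]; apply: le_trans sN.
      by rewrite /s (bigD1 j)//= -addrA lerDl addr_ge0// sumr_ge0.
    by rewrite lerDr sumr_ge0.
  near=> k; rewrite /u indicE mem_set ?mulr1//.
  have Nk : N%:R <= k%:R :> R by rewrite ler_nat; near: k; exact: nbhs_infty_ge.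
  by split => [j|] /=; [apply: le_trans (tN.1 j) Nk|apply: le_trans tN.2 Nk].
apply: (@fatou_le _ _ _ _ _ (fun k xi => (cos_transform (u k) c xi ^+ 2)%:E)).
- move=> k; apply/measurable_EFinP; apply: measurable_funX.
  exact: measurable_cos_transform.
- by move=> k x; rewrite lee_fin sqr_ge0.
- move=> x; apply: cvg_EFin; first by apply: nearW.
  have := @cos_transform_cvg g u c x ig mu0 g mg ug ulim.
  by move=> h; rewrite expr2; under eq_fun do rewrite expr2; exact: cvgM.
move=> k; apply: (@le_trans _ _ (B%:E * \int[mu]_x (u k x ^+ 2)%:E)%E).
  apply: (HB k%:R k%:R); split => //; [exact: measurable_cube|exact: cube_lty|].
  move=> t; rewrite /u normrM !indicE; case: (boolP (t \in E k)) => [|_].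
    by rewrite inE => -[tk gk]; rewrite mem_set//= normr1 !mulr1.
  by rewrite normr0 mulr0 mulr_ge0.
rewrite lee_wpmul2l ?lee_fin//; apply: ge0_le_integral => //.
- by move=> t _; rewrite lee_fin sqr_ge0.
- by apply/measurable_EFinP; apply: measurable_funX.
- by apply/measurable_EFinP; apply: measurable_funX.
- move=> t _; rewrite lee_fin -(real_normK (num_real (u k t))).
  by rewrite -(real_normK (num_real (g t))) ler_sqr ?nnegrE.
Unshelve. all: by end_near. Qed.

Lemma hausdorff_young p c : 1 < p -> p < 2 -> let q := p / (p - 1) in
  exists2 K : R, 0 <= K & forall g (A : R), mu.-integrable setT (EFin \o g) -> 0 <= A ->
  (\int[mu]_x (`|g x| `^ p)%:E <= A%:E)%E ->
  (\int[mu]_y (`|cos_transform g c y| `^ q)%:E <= (K * A `^ (q - 1))%:E)%E.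
Proof.
move=> p1 p2 q; have [B B0 HB] := plancherel_integrable.
have := @interpolation R _ _ _ _ mu mu (fun g => cos_transform g c) B p.
apply => //.
- move=> g ig; apply: measurable_cos_transform.
  by apply/measurable_EFinP; exact: measurable_int ig.
- by move=> f g y fi gi; rewrite cos_transformD// ler_normD.
- by move=> g y gi; exact: cos_transform_le.
- by move=> g gi; exact: HB.
Qed.

(** Christ-Kiselev with U E = |cos_transform (g 1_E)|, [nu E] the integral of |g|^p over E and phi_j
    = |x_j|, whose sublevel sets intersect to boxes. The exponent q - 1 = q / p exceeds 1 exactly
    because p < 2. *)
Lemma maximal_cos_transform p c : 1 < p -> p < 2 -> let q := p / (p - 1) in
  exists2 K : R, 0 <= K & forall g (A : R) (s : seq R),
    mu.-integrable setT (EFin \o g) -> 0 <= A ->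
    (\int[mu]_x (`|g x| `^ p)%:E = A%:E)%E ->
    exists V : n.-tuple R -> R, [/\ measurable_fun setT V, forall xi, 0 <= V xi,
      (\int[mu]_y (V y `^ q)%:E <= (K * A `^ (q - 1))%:E)%E &
      forall (r : 'rV[R]_n) xi, (forall j, r ord0 j \in s) ->
        `|cos_transform (fun t => g t * \1_(box r) t) c xi| <= V xi].
Proof.
move=> p1 p2 q; have [K0 K00 HY] := hausdorff_young c p1 p2.
have q1 : 1 < q - 1.
  rewrite /q -subr_gt0 (_ : _ - 1 = (2 - p) / (p - 1)); last first.
    by field; rewrite subr_eq0 gt_eqF.
  by rewrite divr_gt0 ?subr_gt0.
have q0 : 0 < q by lra.
(* The iteration is indexed by natural numbers; the value 0 beyond the dimension is a harmless
   filler. *)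
pose phi j (t : n.-tuple R) : R := if (insub j : option 'I_n) is Some i then `|tnth t i| else 0.
have mphi j : measurable_fun setT (phi j).
  rewrite /phi; case: (insub j : option 'I_n) => [i|]; last exact: measurable_cst.
  by apply: measurableT_comp => //; exact: measurable_tnth.
have [K K_ge0 HK] := @iterated_set_maximal R _ _ _ _ mu q (q - 1) K0 phi n q0 q1 K00 mphi.
exists K => // g A s ig A0 gA.
pose nu (E : set (n.-tuple R)) : R := fine (\int[mu]_(t in E) (`|g t| `^ p)%:E)%E.
have mg : measurable_fun setT g by apply/measurable_EFinP; exact: measurable_int ig.
have mgp : measurable_fun setT (fun t => (`|g t| `^ p)%:E).
  apply/measurable_EFinP; apply: (measurableT_comp (measurable_powR p)).
  exact: measurableT_comp.
have gp0 t : (0 <= (`|g t| `^ p)%:E)%E by rewrite lee_fin powR_ge0.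
have nufin E : measurable E -> (\int[mu]_(t in E) (`|g t| `^ p)%:E)%E \is a fin_num.
  move=> mE; rewrite ge0_fin_numE; last by apply: integral_ge0.
  apply: (@le_lt_trans _ _ A%:E); last exact: ltry.
  rewrite -gA; apply: ge0_subset_integral => //.
have nu0 E : 0 <= nu E by rewrite fine_ge0//; apply: integral_ge0.
have nuU E F : measurable E -> measurable F -> E `&` F = set0 ->
    nu (E `|` F) = nu E + nu F.
  move=> mE mF EF; rewrite /nu ge0_integral_setU//.
  - by rewrite fineD//; exact: nufin.
  - by apply: measurable_funTS.
  - by apply/disj_setPS; rewrite EF.
have mgE (E : set (n.-tuple R)) : measurable E -> measurable_fun setT (fun t => g t * \1_E t).
  by move=> mE; apply: measurable_funM => //; exact: measurable_indic.
have igE (E : set (n.-tuple R)) : measurable E ->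
    mu.-integrable setT (EFin \o (fun t => g t * \1_E t)).
  move=> mE; apply: le_integrable ig => //; first by apply/measurable_EFinP; exact: mgE.
  move=> t _ /=; rewrite lee_fin normrM ler_piMr// indicE.
  by case: (_ \in _); rewrite ?normr1 ?normr0.
pose U (E : set (n.-tuple R)) xi : R := `|cos_transform (fun t => g t * \1_E t) c xi|.
have UK : set_operator_bounded mu nu q (q - 1) K0 U.
  split.
  - by move=> E y; exact: normr_ge0.
  - move=> E mE; have mT := measurable_cos_transform c (mgE _ mE).
    by rewrite /U; apply: measurableT_comp.
  - move=> E F y mE mF EF; apply: le_trans (ler_normD _ _).
    rewrite -cos_transformD; [|exact: igE|exact: igE].
    rewrite /U (_ : (fun t => g t * \1_(E `|` F) t) =
      (fun t => g t * \1_E t) \+ (fun t => g t * \1_F t))//.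
    apply/funext => t /=; rewrite -mulrDr !indicE in_setU.
    case: (boolP (t \in E)) => tE; case: (boolP (t \in F)) => tF //=; rewrite ?addr0 ?add0r//.
    exfalso; move: tE tF; rewrite !inE => tE tF.
    by have : (E `&` F) t by []; rewrite EF.
  - move=> E mE; apply: HY; [exact: igE|exact: nu0|].
    rewrite /nu fineK; last exact: nufin.
    rewrite [leRHS]integral_mkcond; apply: le_of_eq.
    apply: eq_integral => t _; rewrite patchE indicE; case: ifPn => _ /=.
      by rewrite mulr1.
    by rewrite mulr0 normr0 powR0// gt_eqF// (lt_trans _ p1).
have [V [V0 mV _ VK] UV] := HK nu s U nu0 nuU UK.
exists (V setT); split.
- exact: mV.
- exact: V0.
- by have := VK _ measurableT; rewrite {1}/nu gA.
move=> r xi rs.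
pose r' j : R := if insub j is Some i then r ord0 i else 0.
have r's j : (j < n)%N -> r' j \in s.
  by move=> jn; rewrite /r' insubT; exact: rs.
have := UV r' setT xi r's; rewrite /U setTI.
rewrite (_ : [set x | _] = box r)//; apply/seteqP; split => t /= H.
  move=> j; have := H j (ltn_ord j); rewrite /phi /r' insubT//= => jn.
  by rewrite (_ : Sub _ _ = j) ?ler_norml//; exact: val_inj.
move=> j jn; rewrite /phi /r' insubT/= ler_norml; exact: H.
Qed.
End hausdorff_young.

(** * Complex functions: Fourier integrals through four real transforms *)

Section complex_parts.
Context {R : realType}.
Implicit Types z w : R[i].

Lemma normcE z : Normc.normc z = Num.sqrt (complex.Re z ^+ 2 + complex.Im z ^+ 2).
Proof. by case: z. Qed.

Lemma normr_Re_le z : `|complex.Re z| <= Normc.normc z.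
Proof. by rewrite normcE -sqrtr_sqr ler_wsqrtr// lerDl sqr_ge0. Qed.

Lemma normr_Im_le z : `|complex.Im z| <= Normc.normc z.
Proof. by rewrite normcE -sqrtr_sqr ler_wsqrtr// lerDr sqr_ge0. Qed.

Lemma normc_le_parts z : Normc.normc z <= `|complex.Re z| + `|complex.Im z|.
Proof.
rewrite normcE -[leRHS]ger0_norm ?addr_ge0// -sqrtr_sqr ler_wsqrtr//.
rewrite sqrrD !real_normK ?num_real// -addrA lerD2l lerDr.
by rewrite mulrn_wge0// mulr_ge0.
Qed.

Lemma normc_ge0 z : 0 <= Normc.normc z.
Proof. by rewrite normcE sqrtr_ge0. Qed.

Lemma normcD z w : Normc.normc (z + w) <= Normc.normc z + Normc.normc w.
Proof. exact: le_normcD. Qed.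

Lemma normcN z : Normc.normc (- z) = Normc.normc z.
Proof. by rewrite !normcE; case: z => a b /=; rewrite !sqrrN. Qed.

Lemma ReD z w : complex.Re (z + w) = complex.Re z + complex.Re w.
Proof. by case: z; case: w. Qed.

Lemma ImD z w : complex.Im (z + w) = complex.Im z + complex.Im w.
Proof. by case: z; case: w. Qed.

Lemma ReN z : complex.Re (- z) = - complex.Re z.
Proof. by case: z. Qed.

Lemma ImN z : complex.Im (- z) = - complex.Im z.
Proof. by case: z. Qed.

Lemma complex_eq z w : complex.Re z = complex.Re w -> complex.Im z = complex.Im w -> z = w.
Proof. by case: z; case: w => a b c d /= -> ->. Qed.
End complex_parts.

Lemma poweR_lty_fin {R : realType} (I : \bar R) (r : R) : r != 0 ->
  (0 <= I)%E -> (I `^ r < +oo)%E -> exists2 A : R, 0 <= A & I = A%:E.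
Proof.
by move=> r0; case: I => [A| |]// I0; [exists A|rewrite poweRyr].
Qed.

Section complex_transform.
Context {R : realType} (n : nat).
Local Notation mu := (@lebesgue_Rn R n).
Local Notation re f := (fun x => complex.Re (f x)).
Local Notation im f := (fun x => complex.Im (f x)).
Local Notation cut := Defs.cut.
Implicit Types (f g : n.-tuple R -> R[i]) (xi : n.-tuple R) (r : 'rV[R]_n).

Lemma measurable_normc f : cmeasurable f -> measurable_fun setT (fun x => Normc.normc (f x)).
Proof.
move=> [mre mim]; under eq_fun do rewrite normcE.
apply: (measurableT_comp (continuous_measurable_fun (@sqrt_continuous R))).
by apply: measurable_funD; exact: measurable_funX.
Qed.

Definition cintegrable f := cmeasurable f /\ mu.-integrable setT (fun x => (Normc.normc (f x))%:E).

Lemma cintegrable_re f : cintegrable f -> mu.-integrable setT (EFin \o (re f)).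
Proof.
move=> [[mre _] i]; apply: le_integrable i => //; first exact/measurable_EFinP.
by move=> x _ /=; rewrite lee_fin (ger0_norm (normc_ge0 _)) normr_Re_le.
Qed.

Lemma cintegrable_im f : cintegrable f -> mu.-integrable setT (EFin \o (im f)).
Proof.
move=> [[_ mim] i]; apply: le_integrable i => //; first exact/measurable_EFinP.
by move=> x _ /=; rewrite lee_fin (ger0_norm (normc_ge0 _)) normr_Im_le.
Qed.

Lemma fourier_integralE f xi : cintegrable f ->
  fourier_integral f xi =
  ((cos_transform (re f) 0 xi + cos_transform (im f) (pi / 2) xi) +i*
   (cos_transform (im f) 0 xi - cos_transform (re f) (pi / 2) xi))%C.
Proof.
move=> fi; have ir := cintegrable_re fi; have ii := cintegrable_im fi.
rewrite /fourier_integral /cintegral /cos_transform.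
congr (_ +i* _)%C.
  rewrite -RintegralD//; [|exact: integrable_phase..].
  apply: eq_Rintegral => x _; rewrite subr0 cosBpi2 /fourier_kernel.
  by case: (f x) => a b /=; ring.
rewrite -RintegralB//; [|exact: integrable_phase..].
apply: eq_Rintegral => x _; rewrite subr0 cosBpi2 /fourier_kernel.
by case: (f x) => a b /=; ring.
Qed.

Lemma normc_fourier_le f xi : cintegrable f ->
  Normc.normc (fourier_integral f xi) <=
  `|cos_transform (re f) 0 xi| + `|cos_transform (im f) (pi / 2) xi| +
  (`|cos_transform (im f) 0 xi| + `|cos_transform (re f) (pi / 2) xi|).
Proof.
move=> fi; apply: (le_trans (normc_le_parts _)); rewrite fourier_integralE//=.
by apply: lerD; [exact: ler_normD|exact: ler_normB].
Qed.

Lemma box_cube r N : (forall j, r ord0 j <= N) -> box r `<=` cube N.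
Proof.
move=> rN t tr j; rewrite ler_norml; have /andP[a b] := tr j.
by have := rN j => c; apply/andP; split; lra.
Qed.

Lemma measurable_box r : measurable (box r).
Proof.
rewrite (_ : box r = \bigcap_(j in [set: 'I_n]) [set t | `|tnth t j| <= r ord0 j]).
  apply: fin_bigcap_measurable => // j _; rewrite -[X in measurable X]setTI.
  apply: measurable_fun_le => //; apply: measurableT_comp => //.
  exact: measurable_tnth.
apply/seteqP; split => t /= tr => [j _|j] /=; first by rewrite ler_norml; exact: tr.
by rewrite -ler_norml; exact: (tr j I).
Qed.

Lemma box_lty r : (mu (box r) < +oo)%E.
Proof.
have rN j : r ord0 j <= \sum_(k < n) `|r ord0 k|.
  by rewrite (bigD1 j)//= (le_trans (ler_norm _))// lerDl sumr_ge0.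
apply: le_lt_trans (cube_lty n (\sum_(k < n) `|r ord0 k|)).
apply: le_measure; rewrite ?inE; [exact: measurable_box|exact: measurable_cube|exact: box_cube].
Qed.

Lemma re_cut r f x : complex.Re (cut r f x) = complex.Re (f x) * \1_(box r) x.
Proof. by rewrite /cut; case: (f x) => a b /=; rewrite mulr0 subr0. Qed.

Lemma im_cut r f x : complex.Im (cut r f x) = complex.Im (f x) * \1_(box r) x.
Proof. by rewrite /cut; case: (f x) => a b /=; rewrite mulr0 add0r. Qed.

Lemma cut_cmeasurable r f : cmeasurable f -> cmeasurable (cut r f).
Proof.
move=> [mre mim]; split.
  under eq_fun do rewrite re_cut; apply: measurable_funM => //.
  by apply: measurable_indic; exact: measurable_box.
under eq_fun do rewrite im_cut; apply: measurable_funM => //.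
by apply: measurable_indic; exact: measurable_box.
Qed.

Lemma normc_cut r f x : Normc.normc (cut r f x) = Normc.normc (f x) * \1_(box r) x.
Proof.
rewrite !normcE re_cut im_cut !exprMn -mulrDl sqrtrM ?addr_ge0 ?sqr_ge0//.
by rewrite sqrtr_sqr ger0_norm.
Qed.

Lemma Rintegral_indic d (T : measurableType d) (m : {measure set T -> \bar R})
    (D : set T) (h : T -> R) :
  \int[m]_(x in D) h x = \int[m]_x (h x * \1_D x).
Proof.
rewrite Rintegral_mkcond; apply: eq_Rintegral => x _; rewrite patchE indicE.
by case: (x \in D); rewrite ?mulr1 ?mulr0.
Qed.

Lemma box_fourier_cut f r xi : box_fourier_integral f r xi = fourier_integral (cut r f) xi.
Proof.
rewrite /box_fourier_integral /fourier_integral /cintegral.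
by congr (_ +i* _)%C; rewrite Rintegral_indic; apply: eq_Rintegral => x _;
  rewrite /Defs.cut /fourier_kernel; case: (f x) => a b /=; ring.
Qed.

Section finite_p.
Variable p : R.
Hypothesis p1 : 1 <= p.

Lemma cLpP f : cLp p%:E f -> exists2 A : R, 0 <= A &
  (\int[mu]_x (Normc.normc (f x) `^ p)%:E = A%:E)%E.
Proof.
have pV0 : p^-1 != 0 by rewrite invr_neq0// gt_eqF// (lt_le_trans _ p1).
move=> [mf]; rewrite /cLnorm unlock => foo.
have E : (\int[mu]_x `|(Normc.normc (f x))%:E| `^ p = \int[mu]_x (Normc.normc (f x) `^ p)%:E)%E.
  by apply: eq_integral => x _; rewrite /= (ger0_norm (normc_ge0 _)).
rewrite E in foo.
have I0 : (0 <= \int[mu]_x (Normc.normc (f x) `^ p)%:E)%E.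
  by apply: integral_ge0 => x _; rewrite lee_fin powR_ge0.
exact: (poweR_lty_fin pV0 I0 foo).
Qed.

Lemma cLnormE f A : (\int[mu]_x (Normc.normc (f x) `^ p)%:E = A%:E)%E ->
  cLnorm p%:E f = (A `^ p^-1)%:E.
Proof.
rewrite /cLnorm unlock => fA.
rewrite (eq_integral (fun x => (Normc.normc (f x) `^ p)%:E)) ?fA//.
by move=> x _; rewrite /= (ger0_norm (normc_ge0 _)).
Qed.

(** On the box |f| <= 1 + |f|^p, and the box has finite measure. *)
Lemma cut_cintegrable r f : cLp p%:E f -> cintegrable (cut r f).
Proof.
move=> fp; have [A A0 fA] := cLpP fp; have [mf _] := fp.
have mn := measurable_normc mf.
split; first exact: cut_cmeasurable.
have ip : mu.-integrable setT (fun x => (Normc.normc (f x) `^ p)%:E).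
  apply/integrableP; split.
    by apply/measurable_EFinP; exact: (measurableT_comp (measurable_powR p)).
  under eq_integral do rewrite gee0_abs ?lee_fin ?powR_ge0//.
  by rewrite fA ltry.
have i1 := integrable_indic_lty (measurable_box r) (box_lty r).
apply: (le_integrable measurableT _ _ (integrableD measurableT i1 ip)).
  by apply/measurable_EFinP; apply: measurable_normc; exact: cut_cmeasurable.
move=> x _ /=; rewrite lee_fin (ger0_norm (normc_ge0 _)) normc_cut ger0_norm ?addr_ge0 ?powR_ge0//.
rewrite indicE; case: (_ \in _); last by rewrite mulr0 add0r powR_ge0.
rewrite mulr1; set v := Normc.normc _.
have [v1|v1] := leP v 1; first by rewrite ler_wpDr ?powR_ge0.
rewrite ler_wpDl//; rewrite -{1}[v]powRr1 ?normc_ge0//.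
by apply: ler_powR => //; exact: ltW.
Qed.
End finite_p.
End complex_transform.

Section maximal.
Context {R : realType} (n : nat).
Local Notation mu := (@lebesgue_Rn R n).
Local Notation re f := (fun x => complex.Re (f x)).
Local Notation im f := (fun x => complex.Im (f x)).
Local Notation cut := Defs.cut.
Implicit Types (f g : n.-tuple R -> R[i]) (xi : n.-tuple R) (r : 'rV[R]_n).

(* An enumeration of the vectors of positive rationals; the truncated integrals are
   continuous from above in the radii, so the supremum may be taken over these. *)
Definition dense_radius (m : nat) : 'rV[R]_n :=
  \row_j (let c := odflt [ffun=> (0%N, 0%N)] (unpickle m : option {ffun 'I_n -> nat * nat}) j in
          c.1.+1%:R / c.2.+1%:R).

Lemma dense_radius_gt0 m j : 0 < dense_radius m ord0 j.
Proof. by rewrite mxE divr_gt0. Qed.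

Lemma dense_radius_above r k : (forall j, 0 < r ord0 j) ->
  exists m, forall j, r ord0 j < dense_radius m ord0 j <= r ord0 j + k.+1%:R^-1.
Proof.
move=> r0; pose c : {ffun 'I_n -> nat * nat} := [ffun j => (Num.truncn (r ord0 j * k.+1%:R), k)].
exists (pickle c) => j; rewrite mxE pickleK /= ffunE /=.
have k0 : 0 < k.+1%:R :> R by [].
have rk0 : 0 <= r ord0 j * k.+1%:R by rewrite mulr_ge0// ltW.
have /andP[t1 t2] := truncn_itv rk0.
rewrite ltr_pdivlMr// t2/= ler_pdivrMr// mulrDl mulVf ?gt_eqF//.
by rewrite -natr1 lerD2r.
Qed.

(** Boxes are closed, hence limits of larger boxes at every point; approximation by smaller boxes
    would lose the faces. *)
Lemma box_above_cvg r (m : nat -> 'rV[R]_n) t :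
  (forall k j, r ord0 j < m k ord0 j <= r ord0 j + k.+1%:R^-1) ->
  \1_(box (m k)) t @[k --> \oo] --> (\1_(box r) t : R).
Proof.
move=> rm; apply: cvg_near_cst; rewrite !indicE.
have [tr|tr] := pselect (box r t).
  apply: nearW => k; rewrite indicE !mem_set//= => j.
  have /andP[a b] := tr j; have /andP[c _] := rm k j.
  by apply/andP; split; lra.
have [j jr] : exists j, r ord0 j < `|tnth t j|.
  apply: contrapT => H; apply: tr => j; rewrite -ler_norml leNgt; apply/negP => H'.
  by apply: H; exists j.
near=> k; rewrite indicE !memNset// => tk.
have := tk j; rewrite -ler_norml leNgt => /negP; apply.
have /andP[_] := rm k j; move=> /le_lt_trans; apply.
rewrite -ltrBrDl; near: k.
by apply: (near_infty_natSinv_lt (PosNum _)); rewrite ?subr_gt0.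
Unshelve. all: by end_near. Qed.

Lemma cmeasurable_fourier f : cintegrable f -> cmeasurable (fourier_integral f).
Proof.
move=> ic; have [[mre mim] _] := ic.
split; under eq_fun do rewrite (fourier_integralE _ ic) /=.
  by apply: measurable_funD; exact: measurable_cos_transform.
by apply: measurable_funB; exact: measurable_cos_transform.
Qed.

Section exponent.
Variable p : R.
Hypothesis p1 : 1 <= p.

Lemma fourier_cut_approx f r xi : cLp p%:E f -> (forall j, 0 < r ord0 j) ->
  exists m : nat -> nat,
    Normc.normc (fourier_integral (cut (dense_radius (m k)) f) xi) @[k --> \oo] -->
    Normc.normc (fourier_integral (cut r f) xi).
Proof.
move=> fp r0; have [m rm] := choice (fun k => dense_radius_above k r0).
exists m.
(* All approximating boxes lie in this one, since 1 / (k + 1) <= 1, and f is integrable on it: this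
   is the dominating function. *)
pose S : 'rV[R]_n := \row_j (r ord0 j + 1).
have mS k : box (dense_radius (m k)) `<=` box S.
  move=> t tk j; rewrite mxE; have /andP[a b] := tk j; have /andP[_ c] := rm k j.
  have d : dense_radius (m k) ord0 j <= r ord0 j + 1.
    by apply: (le_trans c); rewrite lerD2l invf_le1// ler1n.
  by apply/andP; split; move: a b d; set u := dense_radius _ _ _; lra.
have rS : box r `<=` box S.
  by move=> t tk j; rewrite mxE; have /andP[a b] := tk j; apply/andP; split; lra.
have iS := cut_cintegrable p1 S fp.
have [mf _] := fp.
have cv (h : n.-tuple R -> R) c : measurable_fun setT h ->
    mu.-integrable setT (EFin \o (fun t => h t * \1_(box S) t)) ->
    cos_transform (fun t => h t * \1_(box (dense_radius (m k))) t) c xi @[k --> \oo]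
      --> cos_transform (fun t => h t * \1_(box r) t) c xi.
  move=> mh ih; have mbox s : measurable_fun setT (fun t => h t * \1_(box s) t).
    by apply: measurable_funM => //; apply: measurable_indic; exact: measurable_box.
  apply: (@cos_transform_cvg _ _ _ (fun k t => h t * \1_(box (dense_radius (m k))) t) c xi ih) => //.
    move=> k t; rewrite !normrM ler_wpM2l// !indicE.
    case: (boolP (t \in box (dense_radius (m k)))) => [|_]; last by rewrite normr0.
    by rewrite inE => /mS tS; rewrite mem_set.
  by move=> t; apply: cvgM; [exact: cvg_cst|exact: box_above_cvg].
have icut s := cut_cintegrable p1 s fp.
have reS : mu.-integrable setT (EFin \o (fun t => re f t * \1_(box S) t)).
  by have := cintegrable_re (icut S); under [X in EFin \o X]eq_fun do rewrite re_cut.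
have imS : mu.-integrable setT (EFin \o (fun t => im f t * \1_(box S) t)).
  by have := cintegrable_im (icut S); under [X in EFin \o X]eq_fun do rewrite im_cut.
have recut s : re (cut s f) = (fun t => re f t * \1_(box s) t).
  by apply/funext => t; rewrite re_cut.
have imcut s : im (cut s f) = (fun t => im f t * \1_(box s) t).
  by apply/funext => t; rewrite im_cut.
under eq_fun do rewrite normcE (fourier_integralE _ (icut _)) /= recut imcut.
rewrite normcE (fourier_integralE _ (icut _)) /= recut imcut.
apply: continuous_cvg; first exact: sqrt_continuous.
have sq (u : nat -> R) (l : R) : u k @[k --> \oo] --> l -> u k ^+ 2 @[k --> \oo] --> l ^+ 2.
  by move=> ul; rewrite expr2; under eq_fun do rewrite expr2; exact: cvgM.
have [mre mim] := mf.
have c1 c := cv _ c mre reS; have c2 c := cv _ c mim imS.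
by apply: cvgD; apply: sq; [exact: cvgD|exact: cvgB].
Qed.

(** The reduction to a countable supremum gives measurability and lets finite maxima exhaust the
    maximal function. *)
Lemma maximal_fourierE f xi : cLp p%:E f -> maximal_fourier f xi =
  ereal_sup (range (fun m => (Normc.normc (fourier_integral (cut (dense_radius m) f) xi))%:E)).
Proof.
move=> fp; apply/eqP; rewrite eq_le; apply/andP; split; last first.
  apply: ereal_sup_le => _ [m _ <-]; exists (dense_radius m) => // j.
  exact: dense_radius_gt0.
apply: ge_ereal_sup => _ [r r0 <-].
have [m rm] := fourier_cut_approx xi fp r0.
have cE : (Normc.normc (fourier_integral (cut (dense_radius (m k)) f) xi))%:E @[k --> \oo] -->
    (Normc.normc (fourier_integral (cut r f) xi))%:E.
  by apply: cvg_EFin => //; exact: nearW.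
rewrite -(cvg_lim _ cE)//; apply: lime_le; first by apply/cvg_ex; eexists; exact: cE.
by apply: nearW => k; apply: ereal_sup_ubound; exists (m k).
Qed.

Lemma measurable_fourier_cut f r : cLp p%:E f ->
  cmeasurable (fourier_integral (cut r f)).
Proof. by move=> fp; apply: cmeasurable_fourier; exact: cut_cintegrable fp. Qed.

Lemma measurable_maximal_fourier f : cLp p%:E f -> measurable_fun setT (maximal_fourier f).
Proof.
move=> fp; pose u m xi : \bar R := (Normc.normc (fourier_integral (cut (dense_radius m) f) xi))%:E.
have mu0 m : measurable_fun setT (u m).
  by apply/measurable_EFinP; apply: measurable_normc; exact: measurable_fourier_cut.
rewrite (_ : maximal_fourier f = fun xi => esups (u ^~ xi) 0); first exact: measurable_fun_esups.
apply/funext => xi; rewrite (maximal_fourierE _ fp) /esups/=; congr ereal_sup.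
by apply/seteqP; split => _ [m _ <-]; exists m.
Qed.
End exponent.
End maximal.

Lemma powR_sum4_le {R : realType} (q a b c d : R) : 0 <= q ->
  0 <= a -> 0 <= b -> 0 <= c -> 0 <= d ->
  (a + b + (c + d)) `^ q <= 2 `^ q * 2 `^ q * (a `^ q + b `^ q + (c `^ q + d `^ q)).
Proof.
move=> q0 a0 b0 c0 d0.
have two x y : 0 <= x -> 0 <= y -> (x + y) `^ q <= 2 `^ q * (x `^ q + y `^ q).
  move=> x0 y0; have := powRD_le q0 ltr01 x0 y0.
  by rewrite invr1 -[1 + 1]/(2 : R) -mulrDr.
apply: (le_trans (two _ _ (addr_ge0 a0 b0) (addr_ge0 c0 d0))).
rewrite -mulrA ler_wpM2l ?powR_ge0// mulrDr.
by apply: lerD; exact: two.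
Qed.

Section maximal_inequality.
Context {R : realType} (n : nat).
Local Notation mu := (@lebesgue_Rn R n).
Local Notation re f := (fun x => complex.Re (f x)).
Local Notation im f := (fun x => complex.Im (f x)).
Local Notation cut := Defs.cut.
Implicit Types (f g : n.-tuple R -> R[i]) (xi : n.-tuple R) (r : 'rV[R]_n).

Variable p : R.
Hypotheses (p1 : 1 < p) (p2 : p < 2).
Let q := p / (p - 1).
Let p10 : 0 < p - 1. Proof. by rewrite subr_gt0. Qed.
Let q0 : 0 < q. Proof. by rewrite divr_gt0// (lt_trans _ p1). Qed.
Let q1 : 0 < q - 1.
Proof.
rewrite /q (_ : _ - 1 = (p - 1)^-1) ?invr_gt0//.
by field; rewrite gt_eqF.
Qed.
Let p_ge1 := ltW p1.

Fixpoint partial_max f k xi : R :=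
  if k is m.+1 then Num.max (partial_max f m xi)
    (Normc.normc (fourier_integral (cut (dense_radius n m) f) xi)) else 0.

Let partial_max_le f k xi c : 0 <= c ->
  (forall m, (m < k)%N -> Normc.normc (fourier_integral (cut (dense_radius n m) f) xi) <= c) ->
  partial_max f k xi <= c.
Proof.
move=> c0; elim: k => //= k IH H; rewrite ge_max H// andbT.
by apply: IH => m mk; apply: H; rewrite ltnS ltnW.
Qed.

Let partial_max_ge0 f k xi : 0 <= partial_max f k xi.
Proof. by elim: k => //= k IH; rewrite le_max IH. Qed.

Let measurable_partial_max f k : cLp p%:E f -> measurable_fun setT (partial_max f k).
Proof.
move=> fp; elim: k => [|k IH] /=; first exact: measurable_cst.
apply: measurable_maxr => //.
exact: (measurable_normc (measurable_fourier_cut p_ge1 _ fp)).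
Qed.

(** Only k boxes enter, so all of them lie in one large box outside of which h can be set to 0; this
    makes it integrable without changing the truncated transforms. [K] does not depend on k. *)
Let real_part_bound c : exists2 K : R, 0 <= K & forall (h : n.-tuple R -> R) (A : R) k,
  measurable_fun setT h -> 0 <= A -> (\int[mu]_x (`|h x| `^ p)%:E <= A%:E)%E ->
  (forall r, mu.-integrable setT (EFin \o (fun t => h t * \1_(box r) t))) ->
  exists V : n.-tuple R -> R, [/\ measurable_fun setT V, forall xi, 0 <= V xi,
    (\int[mu]_y (V y `^ q)%:E <= (K * A `^ (q - 1))%:E)%E &
    forall m xi, (m < k)%N ->
      `|cos_transform (fun t => h t * \1_(box (dense_radius n m)) t) c xi| <= V xi].
Proof.
have [K K0 HK] := @maximal_cos_transform R n p c p1 p2.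
exists K => // h A k mh A0 hA ih.
pose N : R := \sum_(m < k) \sum_(j < n) dense_radius n m ord0 j.
have rN (m : 'I_k) j : dense_radius n m ord0 j <= N.
  rewrite /N (bigD1 m)//= (bigD1 j)//= -addrA lerDl addr_ge0//.
    by apply: sumr_ge0 => i _; exact/ltW/dense_radius_gt0.
  by apply: sumr_ge0 => i _; apply: sumr_ge0 => l _; exact/ltW/dense_radius_gt0.
pose S : 'rV[R]_n := \row_j N.
pose g t := h t * \1_(box S) t.
have mg : measurable_fun setT g.
  by apply: measurable_funM => //; apply: measurable_indic; exact: measurable_box.
have mpow (v : n.-tuple R -> R) : measurable_fun setT v ->
    measurable_fun setT (fun t => (`|v t| `^ p)%:E).
  move=> mv; apply/measurable_EFinP; apply: (measurableT_comp (measurable_powR p)).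
  exact: measurableT_comp.
have gh : (\int[mu]_x (`|g x| `^ p)%:E <= \int[mu]_x (`|h x| `^ p)%:E)%E.
  apply: ge0_le_integral => //; [exact: mpow|exact: mpow|].
  move=> t _; rewrite lee_fin; apply: ge0_ler_powR; rewrite ?nnegrE//.
    by rewrite (le_trans _ p_ge1).
  rewrite /g normrM ler_piMr// indicE; case: (_ \in _); rewrite ?normr1 ?normr0//.
have gA := le_trans gh hA.
have g0 : (0 <= \int[mu]_x (`|g x| `^ p)%:E)%E.
  by apply: integral_ge0 => t _; rewrite lee_fin powR_ge0.
have [A' A'0 gA'] : exists2 A' : R, 0 <= A' & (\int[mu]_x (`|g x| `^ p)%:E)%E = A'%:E.
  move: gA g0; case: (\int[mu]_x (`|g x| `^ p)%:E)%E => [A'| |] // _ A'0; by exists A'.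
have A'A : A' <= A by move: gA; rewrite gA' lee_fin.
(* One list serves all coordinates: the maximum runs over the grid of vectors with entries in [s],
   which contains the k radii in question. *)
pose s : seq R := [seq dense_radius n m.1 ord0 m.2 | m : 'I_k * 'I_n].
have [V [mV V0 VA Vg]] := HK g A' s (ih S) A'0 gA'.
exists V; split => //.
  apply: (le_trans VA); rewrite lee_fin ler_wpM2l//.
  by apply: ge0_ler_powR; rewrite ?nnegrE// ltW.
move=> m xi mk; have := Vg (dense_radius n m) xi; rewrite (_ : (fun t => g t * _) =
    (fun t => h t * \1_(box (dense_radius n m)) t)).
  apply; move=> j; apply/mapP; exists (Ordinal mk, j) => //.
  by rewrite mem_enum.
apply/funext => t; rewrite /g -mulrA; congr (_ * _); rewrite !indicE.
case: (boolP (t \in box (dense_radius n m))) => [|_]; last by rewrite mulr0.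
rewrite inE => tm; rewrite mem_set ?mulr1// => j; rewrite mxE.
have /andP[a b] := tm j; have c1 := rN (Ordinal mk) j.
by apply/andP; split; move: a b c1 => /=; set u := dense_radius _ _ _ _; lra.
Qed.

Lemma partial_maximal_bound : exists2 K : R, 0 <= K & forall f (A : R) k,
  cLp p%:E f -> (\int[mu]_x (Normc.normc (f x) `^ p)%:E = A%:E)%E -> 0 <= A ->
  (\int[mu]_xi (partial_max f k xi `^ q)%:E <= (K * A `^ (q - 1))%:E)%E.
Proof.
have [K0 K00 H0] := real_part_bound 0; have [K1 K10 H1] := real_part_bound (pi / 2).
exists (2 `^ q * 2 `^ q * (K0 + K1 + (K0 + K1))).
  by rewrite mulr_ge0 ?mulr_ge0 ?powR_ge0 ?addr_ge0.
move=> f A k fp fA A0; have [[mre mim] _] := fp.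
have mn := measurable_normc fp.1.
have part (h : n.-tuple R -> R) : measurable_fun setT h ->
    (forall t, `|h t| <= Normc.normc (f t)) -> (\int[mu]_x (`|h x| `^ p)%:E <= A%:E)%E.
  move=> mh hf; rewrite -fA; apply: ge0_le_integral => //.
  - apply/measurable_EFinP; apply: (measurableT_comp (measurable_powR p)).
    exact: measurableT_comp.
  - by apply/measurable_EFinP; exact: (measurableT_comp (measurable_powR p)).
  - move=> t _; rewrite lee_fin; apply: ge0_ler_powR; rewrite ?nnegrE ?normc_ge0//.
    by rewrite (le_trans _ p_ge1).
have icut r := cut_cintegrable p_ge1 r fp.
have recut s : re (cut s f) = (fun t => re f t * \1_(box s) t).
  by apply/funext => t; rewrite re_cut.
have imcut s : im (cut s f) = (fun t => im f t * \1_(box s) t).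
  by apply/funext => t; rewrite im_cut.
have ire r : mu.-integrable setT (EFin \o (fun t => re f t * \1_(box r) t)).
  by have := cintegrable_re (icut r); rewrite recut.
have iim r : mu.-integrable setT (EFin \o (fun t => im f t * \1_(box r) t)).
  by have := cintegrable_im (icut r); rewrite imcut.
have pre := part _ mre (fun t => normr_Re_le (f t)).
have pim := part _ mim (fun t => normr_Im_le (f t)).
have [V1 [mV1 V10 V1A V1f]] := H0 _ _ k mre A0 pre ire.
have [V2 [mV2 V20 V2A V2f]] := H1 _ _ k mim A0 pim iim.
have [V3 [mV3 V30 V3A V3f]] := H0 _ _ k mim A0 pim iim.
have [V4 [mV4 V40 V4A V4f]] := H1 _ _ k mre A0 pre ire.
have bound xi : partial_max f k xi <= V1 xi + V2 xi + (V3 xi + V4 xi).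
  apply: partial_max_le => [|m mk]; first by rewrite !addr_ge0.
  apply: (le_trans (normc_fourier_le _ (icut _))); rewrite recut imcut.
  apply: lerD; apply: lerD; [exact: V1f|exact: V2f|exact: V3f|exact: V4f].
have pm0 xi := partial_max_ge0 f k xi.
have mpm := measurable_partial_max k fp.
have mq (V : n.-tuple R -> R) : measurable_fun setT V -> measurable_fun setT (fun y => (V y `^ q)%:E).
  by move=> mV; apply/measurable_EFinP; exact: (measurableT_comp (measurable_powR q)).
have v0 (V : n.-tuple R -> R) y : (0 <= (V y `^ q)%:E)%E by rewrite lee_fin powR_ge0.
pose W xi := ((V1 xi `^ q)%:E + (V2 xi `^ q)%:E + ((V3 xi `^ q)%:E + (V4 xi `^ q)%:E))%E.
have m12 : measurable_fun setT (fun xi => (V1 xi `^ q)%:E + (V2 xi `^ q)%:E)%E.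
  by apply: emeasurable_funD; exact: mq.
have m34 : measurable_fun setT (fun xi => (V3 xi `^ q)%:E + (V4 xi `^ q)%:E)%E.
  by apply: emeasurable_funD; exact: mq.
have mW : measurable_fun setT W by exact: emeasurable_funD.
apply: (@le_trans _ _ (\int[mu]_xi ((2 `^ q * 2 `^ q)%:E * W xi))%E).
  apply: ge0_le_integral => //.
  - exact: mq.
  - exact: measurable_funeM.
  - move=> xi _; rewrite /W -!EFinD -EFinM lee_fin.
    apply: le_trans (powR_sum4_le (ltW q0) (V10 xi) (V20 xi) (V30 xi) (V40 xi)).
    by apply: ge0_ler_powR; rewrite ?nnegrE ?(ltW q0)// !addr_ge0.
have W0 xi : [set: n.-tuple R] xi -> (0 <= W xi)%E by rewrite /W !adde_ge0.
have C0 : (0 <= (2 `^ q * 2 `^ q)%:E :> \bar R)%E by rewrite lee_fin mulr_ge0 ?powR_ge0.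
rewrite (ge0_integralZl mu measurableT mW W0 C0).
rewrite -mulrA [leRHS]EFinM; apply: lee_wpmul2l => //.
have W120 xi : [set: n.-tuple R] xi -> (0 <= (V1 xi `^ q)%:E + (V2 xi `^ q)%:E)%E.
  by rewrite adde_ge0.
have W340 xi : [set: n.-tuple R] xi -> (0 <= (V3 xi `^ q)%:E + (V4 xi `^ q)%:E)%E.
  by rewrite adde_ge0.
rewrite /W (ge0_integralD mu measurableT W120 m12 W340 m34).
rewrite (ge0_integralD mu measurableT (fun x _ => v0 V1 x) (mq _ mV1) (fun x _ => v0 V2 x) (mq _ mV2)).
rewrite (ge0_integralD mu measurableT (fun x _ => v0 V3 x) (mq _ mV3) (fun x _ => v0 V4 x) (mq _ mV4)).
rewrite !mulrDl !EFinD; apply: leeD; apply: leeD.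
- exact: V1A.
- exact: V2A.
- exact: V3A.
- exact: V4A.
Qed.

(** Monotone convergence along the partial maxima, whose bound is uniform in k. *)
Lemma maximal_integral_bound : exists2 K : R, 0 <= K & forall f (A : R),
  cLp p%:E f -> (\int[mu]_x (Normc.normc (f x) `^ p)%:E = A%:E)%E -> 0 <= A ->
  (\int[mu]_xi (maximal_fourier f xi `^ q) <= (K * A `^ (q - 1))%:E)%E.
Proof.
have [K K0 HK] := partial_maximal_bound; exists K => // f A fp fA A0.
pose G k xi : \bar R := (partial_max f k xi `^ q)%:E.
have pm0 k xi := partial_max_ge0 f k xi.
have mpm k := measurable_partial_max k fp.
have mG k : measurable_fun setT (G k).
  by apply/measurable_EFinP; exact: (measurableT_comp (measurable_powR q)).
have G0 k xi : (0 <= G k xi)%E by rewrite lee_fin powR_ge0.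
have ndG xi : {homo G ^~ xi : i j / (i <= j)%N >-> (i <= j)%E}.
  apply: (homo_leq (@lexx _ _) (@le_trans _ _)) => k; rewrite lee_fin.
  apply: ge0_ler_powR; rewrite ?nnegrE ?(ltW q0)//.
  by rewrite /= le_max lexx.
have mM := measurable_maximal_fourier p_ge1 fp.
have M0 xi : (0 <= maximal_fourier f xi)%E.
  rewrite (maximal_fourierE p_ge1 _ fp).
  apply: le_trans (ereal_sup_ubound (ex_intro2 _ _ 0%N I erefl)).
  by rewrite lee_fin normc_ge0.
(* The power has to pass through a supremum of extended reals: a finite limit bounds every truncated
   integral by its q-th root, and an infinite one leaves nothing to prove. *)
have key xi : (maximal_fourier f xi `^ q <= limn (G ^~ xi))%E.
  have cG := ereal_nondecreasing_cvgn (ndG xi).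
  rewrite (cvg_lim _ cG)//; set s := ereal_sup _.
  have s0 : (0 <= s)%E by apply: le_trans (G0 0%N xi) _; apply: ereal_sup_ubound; exists 0%N.
  have Gs k : (G k xi <= s)%E by apply: ereal_sup_ubound; exists k.
  move: s s0 Gs {cG} => [s| |] s0 Gs; [|by rewrite leey|by []].
  rewrite lee_fin in s0.
  have Ms : (maximal_fourier f xi <= (s `^ q^-1)%:E)%E.
    rewrite (maximal_fourierE p_ge1 _ fp); apply: ge_ereal_sup => _ [m _ <-].
    rewrite lee_fin; apply: (@le_trans _ _ (partial_max f m.+1 xi)).
      by rewrite /= le_max lexx orbT.
    have := Gs m.+1; rewrite lee_fin => Gm.
    rewrite -[leLHS]powRr1// -(@mulfV _ q) ?gt_eqF// powRrM.
    by apply: ge0_ler_powR; rewrite ?nnegrE ?invr_ge0 ?powR_ge0 ?(ltW q0).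
  have := gt0_ler_poweR (ltW q0) _ _ Ms; rewrite poweR_EFin -powRrM mulVf ?gt_eqF// powRr1//.
  apply.
  - by rewrite in_itv/= M0 leey.
  - by rewrite in_itv/= lee_fin powR_ge0 leey.
apply: (@le_trans _ _ (\int[mu]_xi limn (G ^~ xi))%E).
  apply: ge0_le_integral => //.
  - by move=> xi _; exact: poweR_ge0.
  - exact: (measurableT_comp (measurable_poweR q)).
  - rewrite (_ : (fun xi => _) = fun xi => esups (G ^~ xi) 0%N).
      exact: measurable_fun_esups.
    apply/funext => xi; rewrite (cvg_lim _ (ereal_nondecreasing_cvgn (ndG xi)))// /esups/=.
    by congr ereal_sup; apply/seteqP; split => _ [k _ <-]; exists k.
rewrite monotone_convergence//.
apply: lime_le.
  apply: ereal_nondecreasing_is_cvgn; apply/nondecreasing_seqP => k.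
  by apply: ge0_le_integral => // xi _; exact: ndG.
by apply: nearW => k; exact: HK.
Qed.
End maximal_inequality.

(** * Norms of complex functions, and the integrable case *)

Lemma cvg_complexP {R : realType} (I : Type) (F : set_system I) {FF : ProperFilter F}
    (u : I -> R[i]) (l : R[i]) :
  (forall e : R, 0 < e -> \forall x \near F, Normc.normc (u x - l) < e) ->
  (u x : R[i]^o) @[x --> F] --> (l : R[i]^o).
Proof.
move=> H; apply/cvgrPdist_lt => e e0.
have [re0 ie0] : 0 < complex.Re e /\ complex.Im e = 0.
  by move: e0; rewrite ltcE /= => /andP[/eqP <- ->].
near=> x; rewrite distrC.
have : Normc.normc (u x - l) < complex.Re e by near: x; exact: H.
by rewrite [`|_|]/Num.norm/= ltcE/= ie0 eqxx.
Unshelve. all: by end_near. Qed.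

Section Lp_norms.
Context {R : realType} (n : nat).
Local Notation mu := (@lebesgue_Rn R n).
Implicit Types (f g : n.-tuple R -> R[i]).

Lemma hoelder_conjugateE (p : R) : 1 < p -> hoelder_conjugate p%:E = (p / (p - 1))%:E.
Proof.
move=> p1; have p0 : p != 0 by rewrite gt_eqF// (lt_trans _ p1).
rewrite /hoelder_conjugate/= eqe (negbTE p0) -EFinB inver subr_eq0 gt_eqF//.
Qed.

Lemma cmeasurableD f g : cmeasurable f -> cmeasurable g -> cmeasurable (f \+ g)%R.
Proof.
move=> [fr fi] [gr gi]; split => /=.
  by under eq_fun do rewrite ReD; exact: measurable_funD.
by under eq_fun do rewrite ImD; exact: measurable_funD.
Qed.

Lemma cmeasurableN f : cmeasurable f -> cmeasurable (\- f)%R.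
Proof.
move=> [fr fi]; split => /=.
  by under eq_fun do rewrite ReN; exact: measurableT_comp.
by under eq_fun do rewrite ImN; exact: measurableT_comp.
Qed.

Lemma cmeasurableB f g : cmeasurable f -> cmeasurable g -> cmeasurable (f \- g)%R.
Proof. by move=> fm gm; exact: (cmeasurableD fm (cmeasurableN gm)). Qed.

Lemma Lnorm_le_ae (p : R) (g h : n.-tuple R -> \bar R) : 0 <= p ->
  measurable_fun setT g -> measurable_fun setT h ->
  {ae mu, forall x, (`|g x| <= `|h x|)%E} ->
  ('N[mu]_p%:E[g] <= 'N[mu]_p%:E[h])%E.
Proof.
move=> p0 mg mh gh; rewrite unlock.
apply: gt0_ler_poweR; rewrite ?invr_ge0//.
- by rewrite in_itv/= leey andbT integral_ge0// => x _; exact: poweR_ge0.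
- by rewrite in_itv/= leey andbT integral_ge0// => x _; exact: poweR_ge0.
apply: ae_ge0_le_integral => //.
- by move=> x _; exact: poweR_ge0.
- by apply: (measurableT_comp (measurable_poweR p)); apply: measurableT_comp.
- by move=> x _; exact: poweR_ge0.
- by apply: (measurableT_comp (measurable_poweR p)); apply: measurableT_comp.
- apply: filterS gh => x gh _; apply: gt0_ler_poweR => //.
  + by rewrite in_itv/= leey abse_ge0.
  + by rewrite in_itv/= leey abse_ge0.
Qed.

Lemma cLnorm_ge0 (p : \bar R) f : (0 <= cLnorm p f)%E.
Proof. exact: Lnorm_ge0. Qed.

Lemma cLnormD (p : R) f g : 1 <= p -> cmeasurable f -> cmeasurable g ->
  (cLnorm p%:E (f \+ g)%R <= cLnorm p%:E f + cLnorm p%:E g)%E.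
Proof.
move=> p1 mf mg; have mnf := measurable_normc mf; have mng := measurable_normc mg.
apply: le_trans (minkowski_EFin mu mnf mng p1).
apply: Lnorm_le_ae.
- by rewrite (le_trans _ p1).
- by apply/measurable_EFinP; apply: measurable_normc; exact: cmeasurableD.
- by apply/measurable_EFinP; exact: measurable_funD.
- by apply: aeW => x; rewrite lee_fin !ger0_norm ?addr_ge0 ?normc_ge0 ?normcD.
Qed.

Lemma cLnormN (p : \bar R) f : cLnorm p (\- f)%R = cLnorm p f.
Proof. by apply: eq_Lnorm => x /=; rewrite normcN. Qed.

Lemma cLnormB_sym (p : \bar R) f g : cLnorm p (f \- g)%R = cLnorm p (g \- f)%R.
Proof. by apply: eq_Lnorm => x /=; rewrite -normcN opprB. Qed.

Lemma cLnorm_split (p : R) f g h : 1 <= p -> cmeasurable f -> cmeasurable g -> cmeasurable h ->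
  (cLnorm p%:E (f \- h)%R <= cLnorm p%:E (f \- g)%R + cLnorm p%:E (g \- h)%R)%E.
Proof.
move=> p1 mf mg mh; have -> : f \- h = (f \- g)%R \+ (g \- h)%R.
  by apply/funext => x /=; rewrite addrA subrK.
by apply: cLnormD => //; exact: cmeasurableB.
Qed.

Lemma cLpB (p : R) f g : 1 <= p -> cLp p%:E f -> cLp p%:E g -> cLp p%:E (f \- g)%R.
Proof.
move=> p1 [mf fp] [mg gp]; split; first exact: cmeasurableB.
apply: (le_lt_trans (cLnormD p1 mf (cmeasurableN mg))).
by rewrite cLnormN lte_add_pinfty.
Qed.

Lemma cLp_le (p : R) f g : 0 < p -> cmeasurable f -> cLp p%:E g ->
  (forall x, Normc.normc (f x) <= Normc.normc (g x)) -> cLp p%:E f.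
Proof.
move=> p0 mf [mg gp] fg; split=> //; apply: le_lt_trans gp.
apply: Lnorm_le_ae; first exact: ltW.
- by apply/measurable_EFinP; exact: measurable_normc.
- by apply/measurable_EFinP; exact: measurable_normc.
by apply: aeW => x; rewrite lee_fin !ger0_norm ?normc_ge0 ?fg.
Qed.

Lemma cLp1P f : cLp 1 f <-> cintegrable f.
Proof.
rewrite /cLp /cintegrable /cLnorm Lnorm1; split=> [[mf fi]|[mf /integrableP[_ fi]]].
  by split=> //; apply/integrableP; split=> //; apply/measurable_EFinP; exact: measurable_normc.
by split.
Qed.
End Lp_norms.

Section integrable_convergence.
Context {R : realType} (n : nat).
Local Notation mu := (@lebesgue_Rn R n).
Local Notation re f := (fun x => complex.Re (f x)).
Local Notation im f := (fun x => complex.Im (f x)).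
Local Notation cut := Defs.cut.
Implicit Types (f g : n.-tuple R -> R[i]) (xi : n.-tuple R) (r : 'rV[R]_n).

Lemma cos_transformB (g h : n.-tuple R -> R) c xi : mu.-integrable setT (EFin \o g) ->
  mu.-integrable setT (EFin \o h) ->
  cos_transform (g \- h) c xi = cos_transform g c xi - cos_transform h c xi.
Proof.
move=> ig ih; rewrite /cos_transform -RintegralB//; [|exact: integrable_phase..].
by apply: eq_Rintegral => t _; rewrite mulrBl.
Qed.

Lemma cintegrableB f g : cintegrable f -> cintegrable g -> cintegrable (f \- g).
Proof.
move=> [mf fi] [mg gi]; have mfg := cmeasurableB mf mg; split => //.
apply: (le_integrable measurableT _ _ (integrableD measurableT fi gi)).
  by apply/measurable_EFinP; exact: measurable_normc.
move=> x _ /=; rewrite lee_fin !ger0_norm ?addr_ge0 ?normc_ge0//.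
by rewrite -[X in _ <= _ + X]normcN normcD.
Qed.

Lemma fourier_integralB f g xi : cintegrable f -> cintegrable g ->
  fourier_integral (f \- g) xi = fourier_integral f xi - fourier_integral g xi.
Proof.
move=> fi gi; rewrite !fourier_integralE//; last exact: cintegrableB.
have reB : re (f \- g) = re f \- re g by apply/funext => x /=; rewrite ReD ReN.
have imB : im (f \- g) = im f \- im g by apply/funext => x /=; rewrite ImD ImN.
have [a b] := (cintegrable_re fi, cintegrable_re gi).
have [a' b'] := (cintegrable_im fi, cintegrable_im gi).
rewrite reB imB !cos_transformB//.
by apply: complex_eq; rewrite ?ReD ?ImD ?ReN ?ImN /=; ring.
Qed.

(** The constant counts the four real transforms, each at most the L^1 norm. *)
Lemma normc_fourier_sup f xi : cintegrable f ->
  ((Normc.normc (fourier_integral f xi))%:E <= 4%:E * \int[mu]_x (Normc.normc (f x))%:E)%E.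
Proof.
move=> fi; have [mf _] := fi.
have part (h : n.-tuple R -> R) c : mu.-integrable setT (EFin \o h) ->
    (forall x, `|h x| <= Normc.normc (f x)) ->
    (`|cos_transform h c xi|%:E <= \int[mu]_x (Normc.normc (f x))%:E)%E.
  move=> ih hf; apply: (le_trans (cos_transform_le c xi ih)).
  have mh : measurable_fun setT h by apply/measurable_EFinP; exact: measurable_int ih.
  apply: ge0_le_integral => //.
  - by apply/measurable_EFinP; exact: measurableT_comp.
  - by apply/measurable_EFinP; exact: measurable_normc.
  - by move=> x _; rewrite lee_fin.
have pr c := part _ c (cintegrable_re fi) (fun x => normr_Re_le (f x)).
have pim c := part _ c (cintegrable_im fi) (fun x => normr_Im_le (f x)).
have I0 : (0 <= \int[mu]_x (Normc.normc (f x))%:E)%E.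
  by apply: integral_ge0 => x _; rewrite lee_fin normc_ge0.
have := normc_fourier_le xi fi; rewrite -lee_fin => /le_trans; apply.
rewrite (_ : (4 : R)%:E = (1%:E + 1%:E + (1%:E + 1%:E))%E); last by rewrite -!EFinD; congr EFin; lra.
have E1 : (0 <= (1 : R)%:E + 1%:E)%E by rewrite -EFinD lee_fin.
rewrite ge0_muleDl// ge0_muleDl ?lee_fin// mul1e.
by rewrite EFinD; apply: leeD; rewrite EFinD; apply: leeD.
Qed.

Lemma integral_tail (phi : n.-tuple R -> R) (e : R) : mu.-integrable setT (EFin \o phi) ->
  (forall x, 0 <= phi x) -> 0 < e ->
  \forall k \near \oo, (\int[mu]_x (phi x * (1 - \1_(cube k%:R) x))%:E < e%:E)%E.
Proof.
move=> iphi phi0 e0.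
suff : (\int[mu]_x (phi x * (1 - \1_(cube k%:R) x))%:E)%E @[k --> \oo] --> (0%R)%:E.
  move=> /fine_cvgP[fin /cvgrPdist_lt /(_ e e0) H]; near=> k.
  have fk : (\int[mu]_x (phi x * (1 - \1_(cube k%:R) x))%:E)%E \is a fin_num by near: k.
  rewrite -(fineK fk) lte_fin; apply: le_lt_trans (ler_norm _) _.
  by rewrite -normrN -sub0r; near: k.
have mphi : measurable_fun setT phi by apply/measurable_EFinP; exact: measurable_int iphi.
have mc k : measurable_fun setT (fun x : n.-tuple R => 1 - \1_(cube k%:R) x : R).
  by apply: measurable_funB => //; apply: measurable_indic; exact: measurable_cube.
have cv : {ae mu, forall x, setT x -> (phi x * (1 - \1_(cube k%:R) x))%:E @[k --> \oo] --> (0 : \bar R)%E}.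
  apply: aeW => x _; apply: cvg_near_cst.
  have [N xN] : exists N : nat, cube N%:R x.
    pose s := \sum_(j < n) `|tnth x j|.
    have s0 : 0 <= s by rewrite sumr_ge0.
    exists (Num.bound s) => j; apply: le_trans (ltW (archi_boundP s0)).
    by rewrite /s (bigD1 j)//= lerDl sumr_ge0.
  near=> k; rewrite indicE mem_set ?subrr ?mulr0// => j.
  apply: (le_trans (xN j)); rewrite ler_nat; near: k; exact: nbhs_infty_ge.
have dom : {ae mu, forall x k, setT x -> (`|(phi x * (1 - \1_(cube k%:R) x))%:E| <= (phi x)%:E)%E}.
  apply: aeW => x k _; rewrite lee_fin indicE; case: (_ \in _).
    by rewrite subrr mulr0 normr0.
  by rewrite subr0 mulr1 ger0_norm.
have [_ _] := dominated_convergence measurableT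
  (fun k => (measurable_EFinP _ _).2 (measurable_funM mphi (mc k))) (measurable_cst _) cv iphi dom.
by rewrite integral0.
Unshelve. all: by end_near. Qed.

Lemma cube_box N r : (forall j, N < r ord0 j) -> cube N `<=` box r.
Proof.
move=> Nr t tN j; rewrite -ler_norml; apply: le_trans (tN j) _.
exact/ltW/Nr.
Qed.

Lemma box_fourier_integral_near f xi (e : R) : cintegrable f -> 0 < e ->
  \forall r \near all_pinfty,
    Normc.normc (box_fourier_integral f r xi - fourier_integral f xi) < e.
Proof.
move=> fi e0; have [mf ni] := fi.
(* The quarter absorbs the constant of [normc_fourier_sup]. *)
have e4 : 0 < e / 4 by rewrite divr_gt0.
have [k _ /(_ k (leqnn k)) ke] := integral_tail ni (fun x => normc_ge0 (f x)) e4.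
exists k%:R => r kr; have mcut := cut_cmeasurable r mf.
have ci : cintegrable (cut r f).
  split=> //; apply: (le_integrable measurableT _ _ ni).
    by apply/measurable_EFinP; exact: measurable_normc.
  move=> x _ /=; rewrite lee_fin !ger0_norm ?normc_ge0// normc_cut ler_piMr ?normc_ge0//.
rewrite box_fourier_cut -fourier_integralB// -lte_fin.
apply: (le_lt_trans (normc_fourier_sup xi (cintegrableB ci fi))).
rewrite -lte_pdivlMl// -EFinM mulrC; apply: le_lt_trans ke.
apply: ge0_le_integral => //.
- by move=> x _; rewrite lee_fin normc_ge0.
- by apply/measurable_EFinP; apply: measurable_normc; exact: cmeasurableB.
- apply/measurable_EFinP; apply: measurable_funM; first exact: measurable_normc.
  by apply: measurable_funB => //; apply: measurable_indic; exact: measurable_cube.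
- move=> x _; rewrite lee_fin !indicE.
  case: (boolP (x \in cube k%:R)) => [|_].
    rewrite inE => /(cube_box kr) xr; rewrite subrr mulr0.
    rewrite (_ : (cut r f \- f) x = 0) ?Normc.normc0//.
    apply: complex_eq; rewrite /= ?ReD ?ImD ?ReN ?ImN ?re_cut ?im_cut indicE mem_set//.
      by rewrite mulr1 subrr.
    by rewrite mulr1 subrr.
  rewrite subr0 mulr1 /=.
  rewrite /Defs.cut indicE; case: (x \in box r).
    by rewrite mulr1 subrr Normc.normc0 normc_ge0.
  by rewrite mulr0 sub0r normcN.
Qed.
End integrable_convergence.

Lemma cauchy_limn_esup {R : realType} (u : R^nat) :
  (forall e, 0 < e -> exists N, forall k, (N < k)%N -> `|u k - u N| <= e) ->
  u k @[k --> \oo] --> fine (limn_esup (EFin \o u)).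
Proof.
move=> cu; have cv : cvgn u.
  apply/cauchy_cvgP; apply: cauchy_exP => e e0.
  have [N Nk] := cu (e / 2) (divr_gt0 e0 (ltr0n _ 2)).
  exists (u N); rewrite /=; near=> k; rewrite /= /ball/= distrC.
  apply: le_lt_trans (Nk k _) _; first by near: k; exact: nbhs_infty_gt.
  by rewrite ltr_pdivrMr// ltr_pMr// ltr1n.
have cE : (EFin \o u) k @[k --> \oo] --> (limn u)%:E by apply: cvg_EFin => //; exact: nearW.
by rewrite (cvg_limn_einf_sup cE).2.
Unshelve. all: by end_near. Qed.

Section maximal_function.
Context {R : realType} (n : nat).
Local Notation mu := (@lebesgue_Rn R n).
Local Notation re f := (fun x => complex.Re (f x)).
Local Notation im f := (fun x => complex.Im (f x)).
Local Notation cut := Defs.cut.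
Implicit Types (f g : n.-tuple R -> R[i]) (xi : n.-tuple R) (r : 'rV[R]_n).

Lemma maximal_fourier_ge f r xi : (forall j, 0 < r ord0 j) ->
  ((Normc.normc (fourier_integral (cut r f) xi))%:E <= maximal_fourier f xi)%E.
Proof. by move=> r0; apply: ereal_sup_ubound; exists r. Qed.

Lemma maximal_fourier_ge0 f xi : (0 <= maximal_fourier f xi)%E.
Proof.
apply: le_trans (maximal_fourier_ge (r := const_mx 1) f xi _).
  by rewrite lee_fin normc_ge0.
by move=> j; rewrite mxE.
Qed.

Lemma maximal_bound1 f : cLp 1 f ->
  ('N[mu]_(hoelder_conjugate 1)[maximal_fourier f] <= 4%:E * cLnorm 1 f)%E.
Proof.
move=> fp; have [mf fi] := (cLp1P f).1 fp.
rewrite hoelder_conjugate1 unlock; case: ifPn => _; last first.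
  by rewrite mule_ge0// cLnorm_ge0.
apply/ess_sup_inf.ess_supP; apply: aeW => xi /=; rewrite gee0_abs ?maximal_fourier_ge0//.
apply: ge_ereal_sup => _ [r r0 <-].
have fp' : cLp (1%:R%:E) f by [].
have ci := cut_cintegrable (lexx (1 : R)) r fp'.
apply: (le_trans (normc_fourier_sup xi ci)); rewrite lee_pmul2l//.
rewrite /cLnorm Lnorm1; apply: ge0_le_integral => //.
- by move=> x _; rewrite lee_fin normc_ge0.
- by apply/measurable_EFinP; apply: measurable_normc; exact: cut_cmeasurable.
- by apply/measurable_EFinP; apply: measurableT_comp => //; exact: measurable_normc.
- move=> x _; rewrite /= ger0_norm ?normc_ge0// lee_fin normc_cut ler_piMr ?normc_ge0//.
Qed.

Lemma fourierE1 (p : \bar R) f : cLp 1 f -> fourier p f = fourier_integral f.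
Proof. by move=> f1; rewrite /fourier asboolT. Qed.

End maximal_function.

(** * Almost everywhere convergence *)

Section convergence.
Context {R : realType} (n : nat).
Local Notation mu := (@lebesgue_Rn R n).
Local Notation re f := (fun x => complex.Re (f x)).
Local Notation im f := (fun x => complex.Im (f x)).
Local Notation cut := Defs.cut.
Implicit Types (f g h : n.-tuple R -> R[i]) (xi : n.-tuple R) (r : 'rV[R]_n).

Variable p : R.
Hypotheses (p1 : 1 < p) (p2 : p < 2).
Let q := p / (p - 1).
Let p0 : 0 < p. Proof. exact: lt_trans p1. Qed.
Let p10 : 0 < p - 1. Proof. by rewrite subr_gt0. Qed.
Let q0 : 0 < q. Proof. by rewrite divr_gt0. Qed.
Let q_ge1 : 1 <= q. Proof. by rewrite ler_pdivlMr// mul1r lerBlDr lerDl. Qed.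
Let p_ge1 := ltW p1.
Let radius N : 'rV[R]_n := const_mx N.+1%:R.

Lemma maximal_bound : exists2 C : R, 0 <= C & forall f, cLp p%:E f ->
  ('N[mu]_(hoelder_conjugate p%:E)[maximal_fourier f] <= C%:E * cLnorm p%:E f)%E.
Proof.
have [K K0 HK] := maximal_integral_bound n p1 p2.
exists (K `^ q^-1); first exact: powR_ge0.
move=> f fp; have [A A0 fA] := cLpP p_ge1 fp.
rewrite (cLnormE fA) hoelder_conjugateE// unlock -/q -EFinM.
apply: (@le_trans _ _ ((K * A `^ (q - 1))%:E `^ q^-1)%E).
  apply: gt0_ler_poweR; rewrite ?invr_ge0 ?(ltW q0)//.
  - by rewrite in_itv/= leey andbT integral_ge0// => x _; exact: poweR_ge0.
  - by rewrite in_itv/= leey andbT lee_fin mulr_ge0// powR_ge0.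
  - under eq_integral do rewrite gee0_abs ?maximal_fourier_ge0//.
    exact: HK.
(* The exponents of the integral bound turn into those of norms because (q - 1) / q = 1 / p. *)
rewrite poweR_EFin powRM// ?powR_ge0// -powRrM (_ : (q - 1) * q^-1 = p^-1)//.
by rewrite /q; field; rewrite !gt_eqF.
Qed.

Section tails.
Variable f : n.-tuple R -> R[i].
Hypothesis fp : cLp p%:E f.

Let cut_Lp r : cLp p%:E (cut r f).
Proof.
apply: (cLp_le p0 (cut_cmeasurable r fp.1) fp) => x.
by rewrite normc_cut ler_piMr ?normc_ge0// indicE; case: (_ \in _).
Qed.

Let tail N : n.-tuple R -> R[i] := (f \- cut (radius N) f)%R.

Let tail_Lp N : cLp p%:E (tail N).
Proof. exact: cLpB. Qed.

Lemma tail_norm_small e : 0 < e -> exists N, (cLnorm p%:E (tail N) < e%:E)%E.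
Proof.
move=> e0; pose phi x := Normc.normc (f x) `^ p.
have phi0 x : 0 <= phi x by exact: powR_ge0.
have mn := measurable_normc fp.1.
have mphi : measurable_fun setT phi by exact: (measurableT_comp (measurable_powR p)).
have iphi : mu.-integrable setT (EFin \o phi).
  have [A A0 fA] := cLpP p_ge1 fp.
  apply/integrableP; split; first exact/measurable_EFinP.
  under eq_integral do rewrite /= ger0_norm//.
  by rewrite [X in (X < _)%E]fA ltry.
have ep : 0 < e `^ p by rewrite powR_gt0.
have [k _ /(_ k (leqnn k)) ke] := integral_tail iphi phi0 ep.
exists k; have [A A0 tA] := cLpP p_ge1 (tail_Lp k).
rewrite (cLnormE tA) lte_fin.
have Ae : A < e `^ p.
  rewrite -lte_fin -tA; apply: le_lt_trans ke.
  have mtail := measurable_normc (tail_Lp k).1.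
  apply: ge0_le_integral => //.
  - by move=> x _; rewrite lee_fin powR_ge0.
  - by apply/measurable_EFinP; exact: (measurableT_comp (measurable_powR p)).
  - apply/measurable_EFinP; apply: measurable_funM => //.
    by apply: measurable_funB => //; apply: measurable_indic; exact: measurable_cube.
  move=> x _; rewrite lee_fin /tail /= /Defs.cut !indicE.
  case: (boolP (x \in cube k%:R)) => [|_].
    rewrite inE => xk; rewrite mem_set; last first.
      by apply: cube_box xk => j; rewrite mxE ltr_nat.
    by rewrite mulr1 subrr Normc.normc0 subrr mulr0 powR0// gt_eqF.
  rewrite subr0 mulr1; case: (x \in _); last by rewrite mulr0 subr0.
  by rewrite mulr1 subrr Normc.normc0 powR0 ?gt_eqF.
rewrite -[ltRHS](powRr1 (ltW e0)) -(@mulfV _ p) ?gt_eqF// powRrM.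
by apply: gt0_ltr_powR; rewrite ?nnegrE ?invr_gt0 ?powR_ge0.
Qed.

(** Once the box of r contains that of [radius N], the difference of the two cut functions is the
    tail cut at r. One value of the maximal function of the tail thus controls all larger boxes at
    once. *)
Let box_le_tail N r xi : (forall j, N.+1%:R < r ord0 j) ->
  ((Normc.normc (box_fourier_integral f r xi
      - fourier_integral (cut (radius N) f) xi))%:E <= maximal_fourier (tail N) xi)%E.
Proof.
move=> Nr; have r0 j : 0 < r ord0 j by apply: lt_trans (Nr j).
rewrite box_fourier_cut -fourier_integralB; [|exact: cut_cintegrable fp..].
rewrite (_ : cut r f \- _ = cut r (tail N)); first exact: maximal_fourier_ge.
apply/funext => x; rewrite /tail /Defs.cut /= mulrBl; congr (_ - _).
rewrite !indicE; case: (boolP (x \in box (radius N))) => [|_]; last by rewrite mulr0 mul0r.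
rewrite inE => xN; rewrite [X in _ = _ * X](_ : _ = 1) ?mulr1//.
rewrite mem_set// => j; have /andP[a b] := xN j; move: a b (Nr j); rewrite mxE => a b c.
by apply/andP; split; move: a b c; set u := N.+1%:R; lra.
Qed.

(** An infimum suffices, with no limit in N: a single N with a small maximal function already
    controls every larger box. *)
Let tail_inf xi : \bar R := einfs (fun N => maximal_fourier (tail N) xi) 0%N.

(** Its L^q norm is at most C times the L^p norm of any tail, hence zero. *)
Lemma tail_inf_eq0 : {ae mu, forall xi, tail_inf xi = 0%E}.
Proof.
have [C C0 HC] := maximal_bound.
have mM N := measurable_maximal_fourier p_ge1 (tail_Lp N).
have mt : measurable_fun setT tail_inf by exact: measurable_fun_einfs.
have t0 xi : (0 <= tail_inf xi)%E.
  by apply: le_ereal_inf_tmp => _ [N _ <-]; exact: maximal_fourier_ge0.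
have tM N xi : (tail_inf xi <= maximal_fourier (tail N) xi)%E.
  by apply: ereal_inf_lbound; exists N.
have q0E : (0 < q%:E)%E by rewrite lte_fin.
suff N0 : 'N[mu]_q%:E[tail_inf]%E = 0.
  apply: filterS (Lnorm_eq0_eq0 mt q0E N0) => xi H; exact: H.
apply/eqP; rewrite eq_le Lnorm_ge0 andbT; apply/lee_addgt0Pr => e e0; rewrite add0e.
have eC : 0 < e / (C + 1) by rewrite divr_gt0// ltr_wpDl.
have [N Ne] := tail_norm_small eC.
apply: (@le_trans _ _ ('N[mu]_q%:E[maximal_fourier (tail N)])%E).
  apply: Lnorm_le_ae => //; first exact: ltW.
  by apply: aeW => xi; rewrite !gee0_abs// maximal_fourier_ge0.
rewrite -(hoelder_conjugateE p1); apply: le_trans (HC _ (tail_Lp N)) _.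
apply: (@le_trans _ _ (C%:E * (e / (C + 1))%:E)%E).
  by rewrite lee_wpmul2l// ltW.
by rewrite -EFinM lee_fin mulrCA ler_piMr ?(ltW e0)// ler_pdivrMr ?ltr_wpDl// mul1r lerDl.
Qed.

(* The upper limits only serve to have a measurable function defined everywhere. *)
Let limit xi : R[i] :=
  (fine (limn_esup (EFin \o (fun N => complex.Re (fourier_integral (cut (radius N) f) xi)))) +i*
   fine (limn_esup (EFin \o (fun N => complex.Im (fourier_integral (cut (radius N) f) xi)))))%C.

Let limit_cmeasurable : cmeasurable limit.
Proof.
have m N := measurable_fourier_cut p_ge1 (radius N) fp.
split => /=; apply: measurableT_comp => //;
  apply: measurable_fun_limn_esup => N; apply/measurable_EFinP.
  exact: (m N).1.
exact: (m N).2.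
Qed.

Let limit_cvg xi : tail_inf xi = 0%E ->
  forall e : R, 0 < e ->
  \forall r \near all_pinfty, Normc.normc (box_fourier_integral f r xi - limit xi) < e.
Proof.
move=> ti.
(* The four quarters are: box r against radius N, radius k against radius N, and the real and
   imaginary parts of radius k against the limit. *)
have add4 (e a b c u v : R) : a < e / 4 -> b < e / 4 -> u < e / 4 -> v < e / 4 ->
  c <= u + v -> a + (b + c) < e by lra.
have small (e : R) : 0 < e -> exists N, forall r, (forall j, N.+1%:R < r ord0 j) ->
    Normc.normc (box_fourier_integral f r xi - fourier_integral (cut (radius N) f) xi) < e.
  move=> e0; have : (tail_inf xi < e%:E)%E by rewrite ti lte_fin.
  move=> /ereal_inf_lt[_ [N _ <-] Ne]; exists N => r Nr.
  by rewrite -lte_fin; exact: le_lt_trans (box_le_tail xi Nr) Ne.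
have smallN (e : R) : 0 < e -> exists N, forall k, (N < k)%N ->
    Normc.normc (fourier_integral (cut (radius k) f) xi -
                 fourier_integral (cut (radius N) f) xi) < e.
  move=> e0; have [N Ne] := small e e0; exists N => k Nk.
  by rewrite -box_fourier_cut; apply: Ne => j; rewrite mxE ltr_nat.
have cre := @cauchy_limn_esup R (fun N => complex.Re (fourier_integral (cut (radius N) f) xi)).
have cim := @cauchy_limn_esup R (fun N => complex.Im (fourier_integral (cut (radius N) f) xi)).
have {}cre := cre _; have {}cim := cim _.
have {cre} /cvgrPdist_lt cre : (fun N => complex.Re (fourier_integral (cut (radius N) f) xi)) k
    @[k --> \oo] --> complex.Re (limit xi).
  apply: cre => e e0; have [N Ne] := smallN e e0; exists N => k Nk.
  rewrite -ReN -ReD; apply: le_trans (normr_Re_le _) _; exact: ltW (Ne _ Nk).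
have {cim} /cvgrPdist_lt cim : (fun N => complex.Im (fourier_integral (cut (radius N) f) xi)) k
    @[k --> \oo] --> complex.Im (limit xi).
  apply: cim => e e0; have [N Ne] := smallN e e0; exists N => k Nk.
  rewrite -ImN -ImD; apply: le_trans (normr_Im_le _) _; exact: ltW (Ne _ Nk).
move=> e e0; have e4 : 0 < e / 4 by rewrite divr_gt0.
have [N Ne] := small _ e4; exists N.+1%:R => r Nr.
near \oo => k.
have Nk : (N < k)%N by near: k; exact: nbhs_infty_gt.
have h1 := Ne r Nr.
have h2 : Normc.normc (box_fourier_integral f (radius k) xi -
    fourier_integral (cut (radius N) f) xi) < e / 4.
  by apply: Ne => j; rewrite mxE ltr_nat.
rewrite box_fourier_cut in h2.
have h3 : `|complex.Re (limit xi) - complex.Re (fourier_integral (cut (radius k) f) xi)| < e / 4.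
  by near: k; exact: cre.
have h4 : `|complex.Im (limit xi) - complex.Im (fourier_integral (cut (radius k) f) xi)| < e / 4.
  by near: k; exact: cim.
have h5 := normc_le_parts (limit xi - fourier_integral (cut (radius k) f) xi).
rewrite ReD ReN ImD ImN in h5.
have -> : box_fourier_integral f r xi - limit xi =
   (box_fourier_integral f r xi - fourier_integral (cut (radius N) f) xi) +
   (- (fourier_integral (cut (radius k) f) xi - fourier_integral (cut (radius N) f) xi) +
   - (limit xi - fourier_integral (cut (radius k) f) xi)) by ring.
apply: le_lt_trans (normcD _ _) _.
apply: le_lt_trans (lerD (lexx _) (normcD _ _)) _.
by rewrite (normcN (limit xi - _)) normcN; exact: add4 h1 h2 h3 h4 h5.
Unshelve. all: by end_near. Qed.

Let box_diff_le h r xi : cLp p%:E h -> (forall j, 0 < r ord0 j) ->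
  ((Normc.normc (box_fourier_integral h r xi - box_fourier_integral f r xi))%:E
     <= maximal_fourier (h \- f)%R xi)%E.
Proof.
move=> hp r0; rewrite !box_fourier_cut -fourier_integralB;
  [|exact: cut_cintegrable hp|exact: cut_cintegrable fp].
rewrite (_ : cut r h \- _ = cut r (h \- f)%R); first exact: maximal_fourier_ge.
by apply/funext => x; rewrite /Defs.cut /= mulrBl.
Qed.

(** For integrable h, comparing both functions on one sufficiently large common box shows that the
    difference of the transform of h and [limit] is a.e. at most the maximal function of h - f. The
    maximal inequality is then the required continuity estimate. *)
Let limit_extension : fourier_extension p%:E f limit.
Proof.
split=> [|e e0]; first exact: limit_cmeasurable.
have [C C0 HC] := maximal_bound.
have C1 : 0 < C + 1 by rewrite ltr_wpDl.
exists (e / (C + 1)) => [|h h1 hp hf]; first exact: divr_gt0.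
have hfp := cLpB p_ge1 hp fp; have hi := (cLp1P h).1 h1.
apply: (@le_lt_trans _ _ ((C + 1)%:E * cLnorm p%:E (h \- f)%R)%E); last first.
  by rewrite muleC -lte_pdivlMr.
apply: (@le_trans _ _ (C%:E * cLnorm p%:E (h \- f)%R)%E); last first.
  by rewrite lee_wpmul2r ?cLnorm_ge0// lee_fin lerDl.
apply: le_trans (HC _ hfp); rewrite hoelder_conjugateE//.
have mF := cmeasurableB (cmeasurable_fourier hi) limit_cmeasurable.
apply: Lnorm_le_ae.
- exact: ltW.
- by apply/measurable_EFinP; exact: measurable_normc.
- exact: (measurable_maximal_fourier p_ge1 hfp).
apply: filterS tail_inf_eq0 => xi ti.
rewrite !gee0_abs ?maximal_fourier_ge0 ?lee_fin ?normc_ge0//.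
apply/lee_addgt0Pr => a a0; have a2 : 0 < a / 2 by rewrite divr_gt0.
have nh := box_fourier_integral_near xi hi a2.
have nf := limit_cvg ti a2.
have n0 : \forall r \near all_pinfty, forall j, 0 < (r : 'rV[R]_n) ord0 j by exists 0.
have [r [[r0 hr] fr]] := filter_ex (filterI (filterI n0 nh) nf).
have br := box_diff_le xi hp r0.
apply: (@le_trans _ _ ((Normc.normc (box_fourier_integral h r xi -
    box_fourier_integral f r xi))%:E + a%:E)%E); last by rewrite leeD2r.
rewrite -EFinD lee_fin.
have -> : (fourier_integral h \- limit)%R xi = 
   (box_fourier_integral h r xi - box_fourier_integral f r xi) +
   (- (box_fourier_integral h r xi - fourier_integral h xi) +
   (box_fourier_integral f r xi - limit xi)) by rewrite /=; ring.
apply: le_trans (normcD _ _) _; rewrite lerD2l.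
apply: le_trans (normcD _ _) _; rewrite normcN [leRHS]splitr.
by apply: lerD; exact: ltW.
Qed.

(** The cut functions lie in both L^1 and L^p and approximate f in L^p, so both candidates are close
    in L^q to the same Fourier integrals. *)
Let extension_unique g h : fourier_extension p%:E f g -> fourier_extension p%:E f h ->
  {ae mu, forall xi, g xi = h xi}.
Proof.
move=> [mg gP] [mh hP].
have q0E : (0 < q%:E)%E by rewrite lte_fin.
have mgh : measurable_fun setT (fun xi => (Normc.normc ((g \- h)%R xi))%:E).
  by apply/measurable_EFinP; apply: measurable_normc; exact: cmeasurableB.
suff N0 : cLnorm q%:E (g \- h)%R = 0%E.
  apply: filterS (Lnorm_eq0_eq0 mgh q0E N0) => xi H.
  have [/Normc.eq0_normc /eqP] := H I.
  by rewrite subr_eq0 => /eqP.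
apply/eqP; rewrite eq_le Lnorm_ge0 andbT; apply/lee_addgt0Pr => e e0; rewrite add0e.
have e2 : 0 < e / 2 by rewrite divr_gt0.
have [a a0 ga] := gP _ e2; have [b b0 hb] := hP _ e2.
have ab : 0 < Num.min a b by rewrite lt_min a0.
have [N] := tail_norm_small ab; rewrite /tail (cLnormB_sym p%:E f) => Nab.
have c1 : cLp 1 (cut (radius N) f) by apply/cLp1P; exact: cut_cintegrable fp.
have cp := cut_Lp (radius N).
have {ga} ga := ga _ c1 cp _; have {hb} hb := hb _ c1 cp _.
have {}ga := ga (lt_le_trans Nab _); have {}hb := hb (lt_le_trans Nab _).
have mF := measurable_fourier_cut p_ge1 (radius N) fp.
apply: le_trans (cLnorm_split q_ge1 mg mF mh) _.
rewrite [e]splitr EFinD (cLnormB_sym _ g) -(hoelder_conjugateE p1).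
apply: leeD; apply: ltW.
  by apply: ga; rewrite lee_fin ge_min lexx.
by apply: hb; rewrite lee_fin ge_min lexx orbT.
Qed.

Lemma box_fourier_integral_ae_cvg : {ae mu, forall xi,
  (box_fourier_integral f r xi : R[i]^o) @[r --> all_pinfty]
    --> (fourier p%:E f xi : R[i]^o)}.
Proof.
case: (pselect (cLp 1 f)) => [f1|f1].
  apply: aeW => xi; rewrite fourierE1//; apply: cvg_complexP => e.
  by apply: box_fourier_integral_near; exact/cLp1P.
(* The chosen representative is a genuine extension value, since [limit] witnesses that one
   exists. *)
have : fourier_extension p%:E f (fourier p%:E f).
  rewrite /fourier asboolF//.
  exact: (xgetPex (fun=> 0) (ex_intro _ limit limit_extension)).
move=> /(extension_unique limit_extension) le.
apply: filterS2 tail_inf_eq0 le => xi ti lx.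
by apply: cvg_complexP; rewrite -lx; exact: limit_cvg.
Qed.

End tails.
End convergence.

Lemma carleson_subquadratic {R : realType} (n : nat) (p : R) : 1 <= p -> p < 2 ->
  exists C : R, forall f : n.-tuple R -> R[i], cLp p%:E f ->
    ('N[@lebesgue_Rn R n]_(hoelder_conjugate p%:E)[maximal_fourier f]
       <= C%:E * cLnorm p%:E f)%E /\
    {ae @lebesgue_Rn R n, forall xi,
      (box_fourier_integral f r xi : R[i]^o) @[r --> all_pinfty]
        --> (fourier p%:E f xi : R[i]^o)}.
Proof.
rewrite le_eqVlt => /orP[/eqP <-|p1] p2.
  exists 4 => f fp; split; first exact: maximal_bound1.
  apply: aeW => xi; rewrite fourierE1//; apply: cvg_complexP => e.
  by apply: box_fourier_integral_near; exact/cLp1P.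
have [C _ HC] := maximal_bound n p1 p2.
by exists C => f fp; split; [exact: HC|exact: box_fourier_integral_ae_cvg].
Qed.

(** * Divergence in L^2 *)

Section chirp.
Context {R : realType}.
Local Notation la := (@lebesgue_measure R).
Local Notation mu n := (@lebesgue_Rn R n).

(** With u = B - y, the function (1 - cos (be u)) / u has no elementary primitive. Subtracting the
    nonnegative term (1 - sin (be u)) / (be u^2) gives it one. *)
Let log_primitive (be B y : R) : be != 0 -> 0 < B - y ->
  is_derive y (1 : R)
    (fun t => - (ln (B - t) - sin (be * (B - t)) / (be * (B - t)) + (be * (B - t))^-1))
    ((1 - cos (be * (B - y))) / (B - y) - (1 - sin (be * (B - y))) / (be * (B - y) ^+ 2)).
Proof.
move=> be0 By; have By0 : B - y != 0 by rewrite gt_eqF.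
derive_tac; rewrite ?mulf_neq0//.
by rewrite /=; field; rewrite be0 By0.
Qed.

(** The interval stops at distance 1 from y = B. In the boundary terms of [log_primitive], the
    contribution at u = B is at least ln B and that at u = 1 costs at most 2 / be <= 1. *)
Lemma log_le_integral (be B : R) : 2 <= be -> 1 <= B ->
  ((ln B - 1)%:E <= \int[la]_(y in `[0%R, (B - 1)%R]) ((1 - cos (be * (B - y))) / (B - y))%:E)%E.
Proof.
move=> be2 B1; have be0 : be != 0 by rewrite gt_eqF// (lt_le_trans _ be2).
have bep : 0 < be by rewrite (lt_le_trans _ be2).
pose g y := (1 - cos (be * (B - y))) / (B - y) - (1 - sin (be * (B - y))) / (be * (B - y) ^+ 2).
have yB y : 0 <= y <= B - 1 -> 0 < B - y by lra.
have cg y : 0 <= y <= B - 1 -> {for y, continuous g}.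
  move=> /yB By; have By0 : B - y != 0 by rewrite gt_eqF.
  by continuous_tac; rewrite ?mulf_neq0// ?expf_neq0.
have B10 : 0 <= B - 1 by rewrite subr_ge0.
have := integral_FTC B10 (fun y yI => log_primitive be0 (yB y yI)) cg.
set F0 := (X in X%:E) => gE.
apply: (@le_trans _ _ F0%:E).
  rewrite lee_fin /F0 (_ : B - (B - 1) = 1); last by ring.
  rewrite subr0 ln1 mulr1.
  have b1 : be^-1 <= 1 / 2 by rewrite ler_pdivlMr// mulrC ler_pdivrMr// mul1r.
  have s1 : `|sin be / be| <= 1 / 2.
    rewrite normrM normfV (ger0_norm (ltW bep)) -[leRHS]mul1r.
    by apply: ler_pM; rewrite ?invr_ge0 ?(ltW bep)// ?sin_max.
  have s2 : 0 <= (be * B)^-1 - sin (be * B) / (be * B).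
    have bB : 0 < be * B by rewrite mulr_gt0// (lt_le_trans _ B1).
    rewrite -{1}[(be * B)^-1]mul1r -mulrBl; apply: mulr_ge0; last by rewrite invr_ge0 ltW.
    by rewrite subr_ge0 (le_trans (ler_norm _)) ?sin_max.
  move: s1 s2; rewrite ler_norml => /andP[s1 _].
  move: (sin be / be) (sin (be * B) / (be * B)) s1 => u v; lra.
rewrite -gE; have gf y : y \in `[0, B - 1] -> g y <= (1 - cos (be * (B - y))) / (B - y).
  rewrite in_itv/= => /yB By; rewrite /g lerBlDr lerDl; apply: divr_ge0.
    by rewrite subr_ge0 (le_trans (ler_norm _)) ?sin_max.
  by rewrite mulr_ge0 ?(ltW bep) ?sqr_ge0.
have cf y : 0 <= y <= B - 1 -> {for y, continuous (fun y => (1 - cos (be * (B - y))) / (B - y))}.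
  move=> /yB By; have By0 : B - y != 0 by rewrite gt_eqF.
  by continuous_tac.
have ii (h : R -> R) : (forall y, 0 <= y <= B - 1 -> {for y, continuous h}) ->
    la.-integrable `[0, B - 1] (EFin \o h).
  move=> ch; apply: continuous_compact_integrable; first exact: segment_compact.
  by apply: continuous_in_subspaceT => y; rewrite inE/= in_itv/=; exact: ch.
apply: le_integral => //; [exact: ii|exact: ii|].
by move=> y yI; rewrite lee_fin gf//; move: yI; rewrite inE.
Qed.

Let sin_primitive (a A x : R) : a != 0 ->
  is_derive x (1 : R) (fun t => cos (a * (A - t)) / a) (sin (a * (A - x))).
Proof. by move=> a0; derive_tac; rewrite /=; field. Qed.

Lemma integral_sin_shift (a A : R) : 0 < a -> 0 <= A ->
  \int[la]_(x in `[0, A]) sin (a * (A - x)) = (1 - cos (a * A)) / a.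
Proof.
move=> a0 A0; have a_n0 : a != 0 by rewrite gt_eqF.
rewrite /Rintegral (integral_FTC A0 (fun x _ => sin_primitive A x a_n0)); last first.
  by move=> x _; continuous_tac.
by rewrite subrr mulr0 cos0 subr0 /=; ring.
Qed.
Definition abscissa (t : 2.-tuple R) := tnth t ord0.
Definition ordinate (t : 2.-tuple R) := tnth t (lift ord0 ord0).

(* With [A = eta b] and [B = xi b] this is the imaginary part of
   [w e^{2 pi i (xy / b - x xi - y eta)}] on [0, A] x [0, B], up to a constant phase. *)
Definition chirp (A B b w : R) (t : 2.-tuple R) : R :=
  w * sin (2 * pi * ((A - abscissa t) * (B - ordinate t) / b)) *
  (\1_`[0, A] (abscissa t) * \1_`[0, B] (ordinate t)).

Lemma chirp_bounded_support A B b w : 0 <= w ->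
  bounded_support (mu 2) w (cube (Num.max A B)) (chirp A B b w).
Proof.
move=> w0; have m1 : measurable_fun setT abscissa by exact: measurable_tnth.
have m2 : measurable_fun setT ordinate by exact: measurable_tnth.
split => //.
- apply: measurable_funM.
    apply: measurable_funM => //; apply: measurable_fsin.
    apply: measurable_funM => //; apply: measurable_funM => //.
    by apply: measurable_funM; apply: measurable_funB.
  by apply: measurable_funM; apply: measurableT_comp.
- exact: measurable_cube.
- exact: cube_lty.
move=> t; rewrite !normrM (ger0_norm w0) -mulrA ler_wpM2l//.
rewrite -[leRHS]mul1r; apply: ler_pM => //; first exact: sin_max.
rewrite !indicE !ger0_norm// -natrM mulnb ler_nat.
case: (boolP (_ && _)) => //; move=> /andP[].
rewrite !inE/= !in_itv/= => /andP[a0 aA] /andP[b0 bB].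
rewrite mem_set// => j; rewrite le_max.
case: (unliftP ord0 j) => [k ->|->]; last by rewrite ger0_norm// aA.
by rewrite (ord1 k) ger0_norm// bB orbT.
Qed.

(** The integral in x is explicit and equals a constant times (1 - cos (be (B - y))) / (B - y) with
    be = 2 pi A / b, which is at least 2 since b <= A. It is nonnegative, so y may be restricted to
    [0, B - 1], where [log_le_integral] applies; finally b <= B. *)
Lemma chirp_integral (A B b w : R) : 1 <= b -> b <= A -> b <= B -> 0 <= w ->
  w * b / (2 * pi) * (ln b - 1) <= \int[mu 2]_t chirp A B b w t.
Proof.
move=> b1 bA bB w0; have b0 : 0 < b by rewrite (lt_le_trans _ b1).
have A0 : 0 <= A by rewrite (le_trans _ bA)// ltW.
have pi0 := pi_gt0 R.
have bs := chirp_bounded_support A B b w0.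
rewrite (Rintegral_tuple_cons bs).
pose I1 (t : 1.-tuple R) : R := \int[la]_x chirp A B b w (tuple_cons (x, t)).
have cE x t : chirp A B b w (tuple_cons (x, t)) =
   w * sin (2 * pi * ((B - tnth t ord0) / b) * (A - x)) * \1_`[0, B] (tnth t ord0) * \1_`[0, A] x.
  rewrite /chirp /abscissa /ordinate tnth0 tnthS.
  rewrite (_ : (A - x) * _ / b = (B - tnth t ord0) / b * (A - x)); last by ring.
  by rewrite (mulrA (2 * pi)); ring.
have IE t : I1 t = w * (\int[la]_(x in `[0, A]) sin (2 * pi * ((B - tnth t ord0) / b) * (A - x)))
    * \1_`[0, B] (tnth t ord0).
  have is1 : la.-integrable setT (EFin \o (fun x =>
      sin (2 * pi * ((B - tnth t ord0) / b) * (A - x)) * \1_`[0, A] x)).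
    apply: (@bounded_support_integrable _ _ _ la 1 `[0, A]%classic); split => //.
    - apply: measurable_funM => //; apply: continuous_measurable_fun => x.
      by continuous_tac.
    - exact: itv_lty.
    - move=> x; rewrite normrM ler_pM//; first exact: sin_max.
      by rewrite ger0_norm.
  rewrite /I1 [in RHS]Rintegral_indic mulrAC mulrC -RintegralZr//.
  by apply: eq_Rintegral => x _; rewrite cE; ring.
pose be := 2 * pi * A / b.
have IE' t : I1 t = w * b / (2 * pi) *
    ((1 - cos (be * (B - tnth t ord0))) / (B - tnth t ord0)) * \1_`[0, B] (tnth t ord0).
  rewrite IE indicE; case: (boolP (_ \in _)) => [|_]; last by rewrite !mulr0.
  (* At y = B the formula divides by 0, which yields 0; the integrand on the left is sin 0, so the
     two sides agree there too. *)
  rewrite inE/= in_itv/= => /andP[y0]; rewrite le_eqVlt => /predU1P[->|yB].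
    rewrite subrr invr0 (_ : Rintegral _ _ _ = 0) ?(mulr0, mul0r)//.
    rewrite (eq_Rintegral la (g := fun=> 0)) ?Rintegral_cst ?mul0r//.
    by move=> x _; rewrite ?subrr !(mul0r, mulr0) sin0.
  have By : 0 < B - tnth t ord0 by rewrite subr_gt0.
  rewrite integral_sin_shift//; last by rewrite !mulr_gt0 ?invr_gt0.
  rewrite !mulr1 (_ : _ * A = be * (B - tnth t ord0)); last by rewrite /be; field; rewrite gt_eqF.
  have [bn Byn pin] : [/\ b != 0, B - tnth t ord0 != 0 & (pi : R) != 0] by rewrite !gt_eqF.
  by set p := pi in pin *; clearbody p; field; rewrite bn Byn pin.
have be2 : 2 <= be.
  have := pi_ge2 R; rewrite /be ler_pdivlMr//; set p := pi; clearbody p => p2.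
  nra.
have I10 t : 0 <= I1 t.
  rewrite IE' indicE; case: (boolP (_ \in _)) => [|_]; last by rewrite !mulr0.
  rewrite inE/= in_itv/= => /andP[y0 yB].
  apply: mulr_ge0 => //; apply: mulr_ge0.
    by apply: divr_ge0; apply: mulr_ge0 => //; exact: ltW.
  apply: divr_ge0; last by rewrite subr_ge0.
  by rewrite subr_ge0 (le_trans (ler_norm _))// cos_max.
have iI1 : (mu 1).-integrable setT (EFin \o I1).
  set r := Num.max A B in bs; have [mc _ _ _ cM] := bs.
  have mF : measurable_fun setT (fun z : 1.-tuple R * R => chirp A B b w (tuple_cons (z.2, z.1))).
    apply: (measurableT_comp mc); apply: (measurableT_comp (@measurable_tuple_cons R 1)).
    by apply/measurable_fun_pair.
  have FM t x : `|chirp A B b w (tuple_cons (x, t))| <= w * \1_(cube r) t * \1_`[- r, r] x.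
    by rewrite -mulrA (mulrC (\1_(cube r) t)) -indic_cube_cons.
  have mI : measurable (`[- r, r]%classic : set R) by exact: measurable_itv.
  have b1I := bounded_support_Rintegral1 (m1 := mu 1) (m2 := la) mF (measurable_cube r) mI
    (cube_lty 1 r) (itv_lty _ _) w0 FM.
  exact: bounded_support_integrable b1I.
rewrite -lee_fin /Rintegral fineK; last exact: integrable_fin_num.
have mI1 : measurable_fun setT I1 by apply/measurable_EFinP; exact: measurable_int iI1.
rewrite (ge0_integral_tuple_cons (F := EFin \o I1)); last 2 first.
- exact/measurable_EFinP.
- by move=> t; rewrite lee_fin.
have c0 : 0 <= w * b / (2 * pi) by apply: divr_ge0; apply: mulr_ge0 => //; exact: ltW.
apply: (@le_trans _ _ (\int[la]_(y in `[0%R, (B - 1)%R])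
   (w * b / (2 * pi) * ((1 - cos (be * (B - y))) / (B - y)))%:E)%E).
  have hB y : `[0, B - 1]%classic y -> 0 < B - y by rewrite /= in_itv/= => /andP[]; lra.
  under eq_integral do rewrite EFinM.
  rewrite (ge0_integralZl la (measurable_itv _)) ?lee_fin//; last 2 first.
  - apply/measurable_EFinP; apply: subspace_continuous_measurable_fun => //.
    apply: continuous_in_subspaceT => y; rewrite inE => /hB By.
    have By0 : B - y != 0 by rewrite gt_eqF.
    by continuous_tac.
  - move=> y /hB By; rewrite lee_fin; apply: divr_ge0; last exact: ltW.
    by rewrite subr_ge0 (le_trans (ler_norm _))// cos_max.
  rewrite EFinM lee_wpmul2l//; apply: le_trans (log_le_integral be2 _).
    by rewrite lee_fin lerB// ler_ln ?posrE// (lt_le_trans b0).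
  exact: le_trans bB.
have I1E : (\int[la]_y \int[mu 0]_t (EFin \o I1) (tuple_cons (y, t)) =
    \int[la]_y (I1 (tuple_cons (y, [tuple])))%:E)%E.
  apply: eq_integral => y _; rewrite (@integral_dirac _ _ [tuple] R setT measurableT).
    by rewrite diracT mul1e.
  apply/measurable_EFinP; apply: (measurableT_comp mI1).
  exact: (measurableT_comp (@measurable_tuple_cons R 0) (pair1_measurable y)).
rewrite I1E; apply: (@le_trans _ _ (\int[la]_(y in `[0%R, (B - 1)%R]) (I1 (tuple_cons (y, [tuple])))%:E)%E).
  apply: le_of_eq; apply: eq_integral => y; rewrite inE/= in_itv/= => /andP[y0 yB].
  rewrite IE' tnth0 indicE mem_set ?mulr1//= in_itv/= y0/=; lra.
apply: ge0_subset_integral => //.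
- apply/measurable_EFinP; apply: (measurableT_comp mI1).
  exact: (measurableT_comp (@measurable_lebesgue_cons R 0) (pair2_measurable [tuple])).
- by move=> y _; rewrite lee_fin.
Qed.
End chirp.

Section divergent_function.
Context {R : realType}.
Local Notation mu n := (@lebesgue_Rn R n).

(* The inverse frequencies 1/a_k.  The exponent is the one for which [divergent_box_ge]
   beats [2 ^ k] times [k] plus the mass of the previous levels. *)
Fixpoint scale (k : nat) : R :=
  if k is k'.+1 then expR (1 + 2 ^+ k * (2 * pi) * (k%:R + 32 * scale k' ^+ 2)) else 1.

(** A crude linear consequence of exp x >= 1 + x, from which both monotonicity and divergence of
    [scale] follow. *)
Lemma scaleS_ge k : 1 <= scale k -> 2 * scale k + k.+1%:R <= scale k.+1.
Proof.
move=> s1; have p2 := pi_ge2 R; have k1 : 1 <= 2 ^+ k.+1 :> R by rewrite exprn_ege1 ?ler1n.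
rewrite [leRHS]/=; apply: le_trans (expR_ge1Dx _).
have k0 : 0 <= k.+1%:R :> R by [].
set s := scale k in s1 *; set e := 2 ^+ k.+1 in k1 *; set n := k.+1%:R in k0 *.
move: (pi : R) p2 e k1 n k0 s s1 => p p2 e e1 n n0 s s1.
have u0 : n + 2 * s <= n + 32 * s ^+ 2 by nra.
have v1 : 1 <= e * (2 * p) by nra.
apply: (@le_trans _ _ (n + 32 * s ^+ 2)); first by lra.
rewrite addrA ler_wpDl// -[leLHS]mul1r ler_wpM2r// addr_ge0//; nra.
Qed.

Lemma scale_ge1 k : 1 <= scale k.
Proof.
elim: k => // k IH; apply: le_trans (scaleS_ge IH).
have : 0 <= k.+1%:R :> R by []; move: k.+1%:R (scale k) IH => n s; lra.
Qed.

Lemma scale_gt0 k : 0 < scale k.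
Proof. exact: lt_le_trans (scale_ge1 k). Qed.

Lemma scale_ge_nat k : k%:R <= scale k.
Proof.
case: k => [|k]; first exact: le_trans (scale_ge1 0).
by apply: le_trans (scaleS_ge (scale_ge1 k)); rewrite lerDr mulr_ge0// ltW// scale_gt0.
Qed.

Lemma scale_homo : {homo scale : i j / (i <= j)%N >-> i <= j}.
Proof.
apply: (homo_leq (@lexx _ _) (@le_trans _ _)) => k.
apply: le_trans (scaleS_ge (scale_ge1 k)).
have := scale_ge1 k; have : 0 <= k.+1%:R :> R by [].
by move: k.+1%:R (scale k) => n s; lra.
Qed.

Let level_ex (s : R) : exists k, s <= 2 * scale k.
Proof.
exists (Num.bound `|s|); apply: le_trans (ler_norm _) _.
apply: le_trans (ltW (archi_boundP (normr_ge0 s))) _.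
apply: le_trans (scale_ge_nat _) _; have := scale_gt0 (Num.bound `|s|); lra.
Qed.

(** The index of the annulus. The factor 2 is there because for frequencies in [1, 2] the resonant
    corner of level k lies in [0, 2 scale k]^2. *)
Definition level (s : R) : nat := ex_minn (level_ex s).

Lemma level_le s k : (level s <= k)%N = (s <= 2 * scale k).
Proof.
rewrite /level; case: ex_minnP => m sm mmin; apply/idP/idP => [mk|/mmin//].
by apply: le_trans sm _; rewrite ler_wpM2l// scale_homo.
Qed.

Lemma level_homo : {homo level : s t / s <= t >-> (s <= t)%N}.
Proof. by move=> s t st; rewrite level_le (le_trans st)// -level_le. Qed.

(** On a cube of side 4 scale k this amplitude has L^2 norm 4 / 2^k, which is square summable; the
    exponent in [scale] pays for the factor 2^k. *)
Definition weight (k : nat) : R := (2 ^+ k * scale k)^-1.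

Lemma weight_gt0 k : 0 < weight k.
Proof. by rewrite invr_gt0 mulr_gt0 ?exprn_gt0 ?scale_gt0. Qed.

Lemma weight_homo i j : (i <= j)%N -> weight j <= weight i.
Proof.
move=> ij; rewrite lef_pV2 ?posrE ?mulr_gt0 ?exprn_gt0 ?scale_gt0//.
apply: ler_pM; rewrite ?exprn_ge0 ?(ltW (scale_gt0 _)) ?scale_homo//.
by rewrite ler_weXn2l ?ler1n.
Qed.

Lemma weight_le1 k : weight k <= 1.
Proof. by apply: le_trans (weight_homo (leq0n k)) _; rewrite /weight expr0 mul1r invr1. Qed.

Definition side (t : 2.-tuple R) : R := Num.max `|abscissa t| `|ordinate t|.

Lemma cube_side r t : cube r t <-> side t <= r.
Proof.
rewrite /side ge_max; split=> [h|/andP[h0 h1] j]; first by rewrite !h.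
by case: (unliftP ord0 j) => [k ->|->//]; rewrite (ord1 k).
Qed.

Definition amplitude t : R := weight (level (side t)) *
  (\1_`[0, +oo[%classic (abscissa t) * \1_`[0, +oo[%classic (ordinate t)).

Definition phase t : R :=
  2 * pi * (abscissa t * ordinate t * (scale (level (side t)))^-1).

Definition divergent t : R[i] :=
  ((amplitude t * cos (phase t))%R +i* (amplitude t * sin (phase t))%R)%C.

Lemma amplitude_ge0 t : 0 <= amplitude t.
Proof. by rewrite /amplitude mulr_ge0 ?mulr_ge0// ltW// weight_gt0. Qed.

Lemma amplitude_le t : amplitude t <= weight (level (side t)).
Proof.
by rewrite /amplitude ler_piMr ?(ltW (weight_gt0 _)).
Qed.

Lemma normc_divergent t : Normc.normc (divergent t) = amplitude t.
Proof.
rewrite normcE /=; have := amplitude_ge0 t; move: (amplitude t) => a a0.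
by rewrite !exprMn -mulrDr cos2Dsin2 mulr1 sqrtr_sqr ger0_norm.
Qed.

Let measurable_abscissa : measurable_fun setT (@abscissa R).
Proof. exact: measurable_tnth. Qed.

Let measurable_ordinate : measurable_fun setT (@ordinate R).
Proof. exact: measurable_tnth. Qed.

Let measurable_side : measurable_fun setT side.
Proof. by apply: measurable_maxr; apply: measurableT_comp. Qed.

Lemma measurable_amplitude : measurable_fun setT amplitude.
Proof.
apply: measurable_funM; last first.
  by apply: measurable_funM; apply: measurableT_comp.
apply: (measurableT_comp (f := fun s => weight (level s)) _ measurable_side).
by apply: nonincreasing_measurable => // s t st; exact/weight_homo/level_homo.
Qed.

Lemma measurable_phase : measurable_fun setT phase.
Proof.
apply: measurable_funM => //; apply: measurable_funM; first exact: measurable_funM.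
apply: (measurableT_comp (f := fun s => (scale (level s))^-1) _ measurable_side).
apply: nonincreasing_measurable => // s t st.
by rewrite lef_pV2 ?posrE ?scale_gt0// scale_homo// level_homo.
Qed.

Lemma divergent_cmeasurable : cmeasurable divergent.
Proof.
have [ma mp] := (measurable_amplitude, measurable_phase).
split; apply: measurable_funM => //; first exact: measurable_fcos.
exact: measurable_fsin.
Qed.
Lemma divergent_L2 : cLp 2%:E divergent.
Proof.
split; first exact: divergent_cmeasurable.
have ma := measurable_amplitude.
pose u k (t : 2.-tuple R) : \bar R := (weight k ^+ 2 * \1_(cube (2 * scale k)) t)%:E.
have u0 k t : (0 <= u k t)%E by rewrite lee_fin mulr_ge0// sqr_ge0.
have mu0 k : measurable_fun setT (u k).
  apply/measurable_EFinP; apply: measurable_funM => //.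
  by apply: measurable_indic; exact: measurable_cube.
have au t : ((amplitude t ^+ 2)%:E <= \sum_(k <oo) u k t)%E.
  apply: le_trans (nneseries_ge (level (side t)) _) => //.
  rewrite lee_fin indicE mem_set; last by apply/cube_side; rewrite -level_le.
  rewrite mulr1; have := amplitude_le t; have := amplitude_ge0 t; have := weight_gt0 (level (side t)).
  move: (amplitude t) (weight _) => a w w0 a0 aw.
  by rewrite ler_sqr ?nnegrE// ltW.
have int : (\int[mu 2]_t (amplitude t ^+ 2)%:E <= 32%:E)%E.
  apply: (le_trans (integral_le_nneseries _ _ _ _ _ au)) => //.
  - by apply/measurable_EFinP; exact: measurable_funX.
  - by move=> t; rewrite lee_fin sqr_ge0.
  have uE k : (\int[mu 2]_t u k t = (16 / 4 ^+ k)%:E)%E.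
    have mc := @measurable_cube R 2 (2 * scale k).
    rewrite /u; under eq_integral do rewrite EFinM.
    rewrite ge0_integralZl ?lee_fin ?sqr_ge0//; last first.
      by apply/measurable_EFinP; exact: measurable_indic.
    rewrite integral_indic// setIT.
    rewrite [X in (_ * X)%E](_ : _ = ((2 * (2 * scale k)) ^+ 2)%:E); last first.
      by apply: (@measure_cube R 2); rewrite mulr_ge0 ?(ltW (scale_gt0 _)).
    rewrite -EFinM; congr EFin; have s0 : scale k != 0 by rewrite gt_eqF// scale_gt0.
    rewrite /weight; have -> : 4 ^+ k = (2 ^+ k) ^+ 2 :> R.
      by rewrite -exprM mulnC exprM; congr (_ ^+ k); ring.
    have : 2 ^+ k != 0 :> R by rewrite expf_neq0.
    by move: (scale k) s0 (2 ^+ k) => s s0 e e0; field; rewrite e0 s0.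
  apply: nneseries_le => [k|n]; first exact: integral_ge0.
  under eq_bigr do rewrite uE.
  rewrite sumEFin lee_fin.
  (* The full series sums to 64/3; the correction by 4^-n makes the bound inductive. *)
  suff : \sum_(0 <= k < n) 16 / 4 ^+ k <= 32 * (1 - (4 ^+ n)^-1) :> R.
    move=> /le_trans; apply; rewrite ler_piMr// lerBlDr lerDl invr_ge0 exprn_ge0//.
  elim: n => [|n IH]; first by rewrite big_geq// expr0 invr1 subrr mulr0.
  rewrite big_nat_recr//= exprS invfM.
  have : 0 <= (4 ^+ n)^-1 :> R by rewrite invr_ge0 exprn_ge0.
  by move: IH; move: (4 ^+ n)^-1 (\sum_(_ <= _ < _) _) => q S; lra.
rewrite /cLnorm unlock; apply: poweR_lty.
under eq_integral => t _.
  rewrite normc_divergent abse_EFin poweR_EFin ger0_norm ?amplitude_ge0//.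
  rewrite powR_mulrn ?amplitude_ge0//.
  over.
exact: le_lt_trans int (ltry _).
Qed.

Section large_box.
Variables (xi : 2.-tuple R) (k : nat).
Hypotheses (xi1 : 1 <= abscissa xi <= 2) (xi2 : 1 <= ordinate xi <= 2).
Let s := scale k.+1.
Let A := ordinate xi * s.
Let B := abscissa xi * s.
Let r : 'rV[R]_2 := \row_j (if j == ord0 then A else B).
(** The constant phase that completes the factorization of the resonance at the corner (A, B). With
    it, the integrand of level k + 1 inside the box is exactly a [chirp]. *)
Let theta := 2 * pi * (abscissa xi * ordinate xi * s).
Let h t := amplitude t * sin (phase t - 2 * pi * dot t xi + theta).

Let s0 : 0 < s. Proof. exact: scale_gt0. Qed.

Let sA : s <= A. Proof. by rewrite /A ler_peMl ?(ltW s0)//; case/andP: xi2. Qed.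
Let sB : s <= B. Proof. by rewrite /B ler_peMl ?(ltW s0)//; case/andP: xi1. Qed.

Let dotE t : dot t xi = abscissa t * abscissa xi + ordinate t * ordinate xi.
Proof. by rewrite /dot big_ord_recl big_ord_recl big_ord0 addr0. Qed.

Let ReE t : complex.Re (divergent t * fourier_kernel t xi) =
  amplitude t * cos (phase t - 2 * pi * dot t xi).
Proof. by rewrite cosB /divergent /fourier_kernel /=; ring. Qed.

Let ImE t : complex.Im (divergent t * fourier_kernel t xi) =
  amplitude t * sin (phase t - 2 * pi * dot t xi).
Proof. by rewrite sinB /divergent /fourier_kernel /=; ring. Qed.

(* On the cube of the previous level both sides are merely bounded by 1. *)
Let h_ge t : chirp A B s (weight k.+1) t - 2 * \1_(cube (2 * scale k)) t <= h t * \1_(box r) t.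
Proof.
have w0 := weight_gt0 k.+1; have w1 := weight_le1 k.+1.
have a0 := amplitude_ge0 t; have a1 := le_trans (amplitude_le t) (weight_le1 _).
have hb : `|h t * \1_(box r) t| <= 1.
  rewrite normrM -[leRHS]mulr1 ler_pM//; last by rewrite ger0_norm.
  rewrite /h normrM -[leRHS]mulr1 ler_pM//; last exact: sin_max.
  by rewrite ger0_norm.
case: (boolP (t \in cube (2 * scale k))) => tk.
  have : `|chirp A B s (weight k.+1) t| <= 1.
    have [_ _ _ _ /(_ t)] := chirp_bounded_support A B s (ltW w0).
    move=> /le_trans; apply; rewrite -[leRHS]mulr1 ler_pM ?(ltW w0)//.
  rewrite (indicE _ (cube _)) tk mulr1; move: hb; rewrite !ler_norml => /andP[+ _] /andP[_].
  by move: (chirp _ _ _ _ _) (h t * _) => u v; lra.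
rewrite (indicE _ (cube _)) (negbTE tk) mulr0 subr0.
have lk : (k < level (side t))%N.
  rewrite ltnNge level_le; apply: contra tk => tk; rewrite inE; exact/cube_side.
have [tr|tr] := boolP ((0 <= abscissa t <= A) && (0 <= ordinate t <= B)); last first.
  have -> : chirp A B s (weight k.+1) t = 0.
    rewrite /chirp !indicE -natrM mulnb !mem_setE !in_itv/= (negbTE tr) mulr0//.
  suff H : \1_`[0, +oo[%classic (abscissa t) * \1_`[0, +oo[%classic (ordinate t) * \1_(box r) t = 0 :> R.
    by rewrite /h /amplitude mulrAC -(mulrA (weight _)) H mulr0 mul0r.
  rewrite !indicE !mem_setE !in_itv/= !andbT.
  have [|_] := boolP (t \in box r); last by rewrite mulr0.
  rewrite inE => tb; move: (tb ord0) (tb (lift ord0 ord0)) tr; rewrite !mxE/=.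
  rewrite -/(abscissa t) -/(ordinate t) => /andP[_ ->] /andP[_ ->]; rewrite !andbT.
  by case: (0 <= abscissa t); case: (0 <= ordinate t); rewrite //= ?mulr0 ?mul0r.
move: tr => /andP[/andP[x0 xA] /andP[y0 yB]].
(* The coordinates of xi are at most 2, so this part of the box lies in [0, 2 s]^2 and no higher
   level occurs. *)
have lE : level (side t) = k.+1.
  apply/eqP; rewrite eqn_leq lk andbT level_le /side ge_max !ger0_norm//.
  apply/andP; split; [apply: le_trans xA _|apply: le_trans yB _].
    by rewrite ler_wpM2r ?(ltW s0)//; case/andP: xi2.
  by rewrite ler_wpM2r ?(ltW s0)//; case/andP: xi1.
have sn : s != 0 by rewrite gt_eqF.
have tb : box r t.
  move=> j; rewrite mxE; case: (unliftP ord0 j) => [i ->|->] /=.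
    by rewrite (ord1 i); move: y0 yB; rewrite /ordinate; lra.
  by move: x0 xA; rewrite /abscissa; lra.
rewrite /chirp /h /amplitude /phase !indicE !mem_setE !in_itv/= lE mem_set// x0 xA y0 yB !mulr1.
apply: le_of_eq; congr (_ * sin _).
by rewrite dotE /theta /A /B -/s; move: (pi : R) => p; field.
Qed.

Let bounded_box (g : 2.-tuple R -> R) : measurable_fun setT g ->
  (forall t, `|g t| <= 1) -> (mu 2).-integrable setT (EFin \o (fun t => g t * \1_(box r) t)).
Proof.
move=> mg g1; apply: (@bounded_support_integrable _ _ _ (mu 2) 1 (box r)); split => //.
- by apply: measurable_funM => //; apply: measurable_indic; exact: measurable_box.
- exact: measurable_box.
- exact: box_lty.
- by move=> t; rewrite normrM ler_pM// ger0_norm.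
Qed.

(** The integral of [h] over the box is cos theta Im F + sin theta Re F, hence at most 2 |F|. From
    below, the chirp gives (ln s - 1) / (2^(k + 1) 2 pi) = k + 1 + 32 (scale k)^2, and the earlier
    levels remove at most twice the volume 16 (scale k)^2. *)
Lemma divergent_box_ge : k.+1%:R / 2 <= Normc.normc (box_fourier_integral divergent r xi).
Proof.
set F := box_fourier_integral _ _ _.
have ap t : 0 <= amplitude t <= 1.
  by rewrite amplitude_ge0 (le_trans (amplitude_le t)) ?weight_le1.
have amp1 (u : R) t : `|u| <= 1 -> `|amplitude t * u| <= 1.
  have /andP[a0 a1] := ap t => u1.
  by rewrite normrM (ger0_norm a0) -[leRHS]mulr1 ler_pM.
have mph0 : measurable_fun setT (fun t => phase t - 2 * pi * dot t xi).
  apply: measurable_funB; first exact: measurable_phase.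
  by apply: measurable_funM => //; exact: measurable_dot.
have ma := @measurable_amplitude.
pose C t := amplitude t * cos (phase t - 2 * pi * dot t xi).
pose S t := amplitude t * sin (phase t - 2 * pi * dot t xi).
have iC : (mu 2).-integrable setT (EFin \o (fun t => C t * \1_(box r) t)).
  apply: bounded_box => [|t]; last exact/amp1/cos_max.
  by apply: measurable_funM => //; exact: measurable_fcos.
have iS : (mu 2).-integrable setT (EFin \o (fun t => S t * \1_(box r) t)).
  apply: bounded_box => [|t]; last exact/amp1/sin_max.
  by apply: measurable_funM => //; exact: measurable_fsin.
have ih : (mu 2).-integrable setT (EFin \o (fun t => h t * \1_(box r) t)).
  apply: bounded_box => [|t]; last exact/amp1/sin_max.
  by apply: measurable_funM => //; apply: measurable_fsin; exact: measurable_funD.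
have hE : \int[mu 2]_t (h t * \1_(box r) t) =
    cos theta * complex.Im F + sin theta * complex.Re F.
  have -> : complex.Im F = \int[mu 2]_t (S t * \1_(box r) t).
    transitivity (\int[mu 2]_(t in box r) complex.Im (divergent t * fourier_kernel t xi)) => //.
    by rewrite Rintegral_indic; apply: eq_Rintegral => t _; rewrite ImE.
  have -> : complex.Re F = \int[mu 2]_t (C t * \1_(box r) t).
    transitivity (\int[mu 2]_(t in box r) complex.Re (divergent t * fourier_kernel t xi)) => //.
    by rewrite Rintegral_indic; apply: eq_Rintegral => t _; rewrite ReE.
  rewrite -RintegralZl// -RintegralZl// -RintegralD//.
  - by apply: eq_Rintegral => t _; rewrite /h sinD /C /S; ring.
  - exact: (integrableZl measurableT (cos theta) iS).
  - exact: (integrableZl measurableT (sin theta) iC).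
have Fge : \int[mu 2]_t (h t * \1_(box r) t) <= 2 * Normc.normc F.
  rewrite hE; have := normr_Re_le F; have := normr_Im_le F.
  have := cos_max theta; have := sin_max theta.
  move: (cos _) (sin _) (complex.Re _) (complex.Im _) (Normc.normc _) => c d x y z.
  move=> d1 c1 yz xz.
  have b (u v : R) : `|u| <= 1 -> `|v| <= z -> u * v <= z.
    move=> u1 vz; apply: le_trans (ler_norm _) _; rewrite normrM -[leRHS]mul1r.
    exact: ler_pM.
  by rewrite mulr_natl mulr2n lerD// b.
rewrite ler_pdivrMr// mulrC; apply: le_trans Fge.
have s1 := scale_ge1 k.+1; have w0 := ltW (weight_gt0 k.+1).
have ich : (mu 2).-integrable setT (EFin \o chirp A B s (weight k.+1)).
  exact: bounded_support_integrable (chirp_bounded_support A B s w0).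
have mc := @measurable_cube R 2 (2 * scale k).
have i1 : (mu 2).-integrable setT (EFin \o (fun t => 2 * \1_(cube (2 * scale k)) t : R)).
  exact: (integrableZl measurableT 2 (integrable_indic_lty mc (cube_lty _ _))).
apply: le_trans (le_Rintegral _ _ ih (fun t _ => h_ge t)) => //; last first.
  exact: (integrableB measurableT ich i1).
rewrite RintegralB//.
have -> : \int[mu 2]_t (2 * \1_(cube (2 * scale k)) t) = 32 * scale k ^+ 2 :> R.
  rewrite RintegralZl//; last exact: integrable_indic_lty mc (cube_lty _ _).
  rewrite /Rintegral integral_indic// setIT.
  rewrite [X in fine X](_ : _ = ((2 * (2 * scale k)) ^+ 2)%:E) /=; first by ring.
  by apply: (@measure_cube R 2); rewrite mulr_ge0 ?(ltW (scale_gt0 _)).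
rewrite lerBrDr; apply: le_trans (chirp_integral s1 sA sB w0).
have -> : ln s = 1 + 2 ^+ k.+1 * (2 * pi) * (k.+1%:R + 32 * scale k ^+ 2) by rewrite /s expRK.
have [sn en pn] : [/\ s != 0, 2 ^+ k.+1 != 0 :> R & (pi : R) != 0].
  by rewrite expf_neq0// !gt_eqF ?pi_gt0.
rewrite /weight -/s; move: (2 ^+ k.+1) (pi : R) s k.+1%:R (scale k) sn en pn {ich}.
move=> e p s' n c sn en pn.
by apply: le_of_eq; field; rewrite sn en pn.
Qed.
End large_box.

Lemma divergent_unbounded (xi : 2.-tuple R) (K M : R) :
  1 <= abscissa xi <= 2 -> 1 <= ordinate xi <= 2 ->
  exists r : 'rV[R]_2, (forall j, K < r ord0 j) /\
    M < Normc.normc (box_fourier_integral divergent r xi).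
Proof.
move=> xi1 xi2; pose k := Num.bound (2 * (`|K| + `|M|)).
have kM : 2 * (`|K| + `|M|) < k.+1%:R.
  apply: (@lt_trans _ _ k%:R); last by rewrite ltr_nat.
  by apply: archi_boundP; rewrite mulr_ge0// addr_ge0.
have [K0 M0] := (ler_norm K, ler_norm M); have [K1 M1] := (normr_ge0 K, normr_ge0 M).
eexists; split; last first.
  apply: lt_le_trans (divergent_box_ge k xi1 xi2).
  by rewrite ltr_pdivlMr//; lra.
have Ks : K < scale k.+1 by apply: lt_le_trans (scale_ge_nat _); lra.
have s0 := ltW (scale_gt0 k.+1).
move=> j; apply: lt_le_trans Ks _; rewrite mxE.
by case: ifP => _; rewrite ler_peMl//; [case/andP: xi2|case/andP: xi1].
Qed.

End divergent_function.

(** * Higher dimensions by tensor products *)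

Section tensor.
Context {R : realType}.
Local Notation la := (@lebesgue_measure R).
Local Notation mu n := (@lebesgue_Rn R n).
Local Notation tail t := [tuple of behead t].

Definition cons_set n (I : set R) (Q : set (n.-tuple R)) : set (n.+1.-tuple R) :=
  [set t | I (tnth t ord0) /\ Q (tail t)].

Lemma tail_tuple_cons n x (t : n.-tuple R) : tail (tuple_cons (x, t)) = t.
Proof. exact: val_inj. Qed.

Lemma measurable_cons_set n I (Q : set (n.-tuple R)) :
  measurable I -> measurable Q -> measurable (cons_set I Q).
Proof.
move=> mI mQ; apply: measurableI.
  by rewrite -[X in measurable X]setTI; exact: (@measurable_tnth _ _ _ ord0).
by rewrite -[X in measurable X]setTI; exact: measurable_behead.
Qed.

Lemma measure_cons_set n I (Q : set (n.-tuple R)) : measurable I -> measurable Q ->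
  mu n.+1 (cons_set I Q) = (la I * mu n Q)%E.
Proof.
move=> mI mQ.
have -> : mu n.+1 (cons_set I Q) = (la \x mu n)%E (I `*` Q).
  rewrite /= /pushforward; congr (_ _); apply/seteqP.
  by split => -[x t]; rewrite /cons_set /= tail_tuple_cons tnth0.
by apply: product_measure1E.
Qed.

Lemma cons_set_gt0 n I (Q : set (n.-tuple R)) : measurable I -> measurable Q ->
  (0 < la I)%E -> (0 < mu n Q)%E -> (0 < mu n.+1 (cons_set I Q))%E.
Proof. by move=> mI mQ I0 Q0; rewrite measure_cons_set// mule_gt0. Qed.

(** Two products are needed because the real and imaginary parts of a product of complex factors are
    sums of two. *)
Lemma Rintegral_tensor2 n (M r : R) (g : n.+1.-tuple R -> R) (u1 u2 : R -> R)
    (g1 g2 : n.-tuple R -> R) :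
  bounded_support (mu n.+1) M (cube r) g ->
  la.-integrable setT (EFin \o u1) -> la.-integrable setT (EFin \o u2) ->
  (mu n).-integrable setT (EFin \o g1) -> (mu n).-integrable setT (EFin \o g2) ->
  (forall x t, g (tuple_cons (x, t)) = u1 x * g1 t + u2 x * g2 t) ->
  \int[mu n.+1]_t g t = \int[la]_x u1 x * \int[mu n]_t g1 t + \int[la]_x u2 x * \int[mu n]_t g2 t.
Proof.
move=> bg i1 i2 j1 j2 gE; rewrite (Rintegral_tuple_cons bg).
rewrite -!RintegralZl// -RintegralD//; last 2 first.
- exact: (integrableZl measurableT (\int[la]_x u1 x) j1).
- exact: (integrableZl measurableT (\int[la]_x u2 x) j2).
apply: eq_Rintegral => t _.
under eq_Rintegral do rewrite gE.
rewrite RintegralD//; first by rewrite !RintegralZr.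
- exact: (integrableZr measurableT (g1 t) i1).
- exact: (integrableZr measurableT (g2 t) i2).
Qed.

(** An invariant that passes from n to n + 1. The bound |f| <= 1 places the truncated integrands in
    [bounded_support], where Fubini is available. *)
Definition diverges n (f : n.-tuple R -> R[i]) (Q : set (n.-tuple R)) :=
  [/\ cLp 2%:E f, forall t, Normc.normc (f t) <= 1, measurable Q, (0 < mu n Q)%E &
    forall xi, Q xi -> forall K M : R, exists r : 'rV[R]_n, (forall j, K < r ord0 j) /\
      M < Normc.normc (box_fourier_integral f r xi)].

Lemma diverges2 : exists f Q, @diverges 2 f Q.
Proof.
pose I12 : set R := `[1, 2]%classic.
have mI : measurable I12 by exact: measurable_itv.
have I0 : (0 < la I12)%E.
  by rewrite lebesgue_measure_itv/= lte_fin ltr1n -EFinB lte_fin; lra.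
have mT : measurable [set: 0.-tuple R] by exact: measurableT.
have T0 : (0 < mu 0 setT)%E by rewrite /= diracT lte_fin.
exists divergent, (cons_set I12 (cons_set I12 setT)); split.
- exact: divergent_L2.
- by move=> t; rewrite normc_divergent (le_trans (amplitude_le t)) ?weight_le1.
- by apply: measurable_cons_set => //; exact: measurable_cons_set.
- apply: cons_set_gt0 => //; first exact: measurable_cons_set.
  exact: cons_set_gt0.
move=> xi [x1 [x2 _]] K M; apply: divergent_unbounded.
  by move: x1; rewrite /I12 /= in_itv.
move: x2; rewrite /I12 /= in_itv/= (_ : tnth (tail xi) ord0 = ordinate xi)//.
by rewrite /ordinate !(tnth_nth 0)/= nth_behead.
Qed.

Lemma box_phase_bounded_support n (f : n.-tuple R -> R[i]) xi (r : 'rV[R]_n) :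
  cmeasurable f -> (forall t, Normc.normc (f t) <= 1) ->
  let m := bounded_support (mu n) 1 (cube (\sum_k `|r ord0 k|)) in
  m (fun t => complex.Re (f t * fourier_kernel t xi) * \1_(box r) t) /\
  m (fun t => complex.Im (f t * fourier_kernel t xi) * \1_(box r) t).
Proof.
move=> [mre mim] f1 m.
have md : measurable_fun setT (fun t : n.-tuple R => 2 * pi * dot t xi).
  by apply: measurable_funM => //; exact: measurable_dot.
have mc : measurable_fun setT (fun t : n.-tuple R => cos (2 * pi * dot t xi)).
  exact: measurable_fcos.
have ms : measurable_fun setT (fun t : n.-tuple R => sin (2 * pi * dot t xi)).
  exact: measurable_fsin.
have mb : measurable_fun setT (\1_(box r) : n.-tuple R -> R).
  by apply: measurable_indic; exact: measurable_box.
have normk t : Normc.normc (f t * fourier_kernel t xi) <= 1.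
  rewrite Normc.normcM (_ : Normc.normc (fourier_kernel t xi) = 1) ?mulr1//.
  by rewrite normcE /= sqrrN cos2Dsin2 sqrtr1.
have le1 (h : n.-tuple R -> R) : (forall t, `|h t| <= Normc.normc (f t * fourier_kernel t xi)) ->
    forall t, `|h t * \1_(box r) t| <= 1 * \1_(cube (\sum_k `|r ord0 k|)) t.
  move=> hb t; rewrite normrM ler_pM//; first exact: le_trans (hb t) (normk t).
  rewrite ger0_norm// !indicE; case: (boolP (t \in box r)) => // /[!inE] tr.
  rewrite mem_set//; apply: box_cube tr => j.
  by rewrite (bigD1 j)//= (le_trans (ler_norm _))// lerDl sumr_ge0.
split; split=> //; [|exact: measurable_cube|exact: cube_lty|
  |  |exact: measurable_cube|exact: cube_lty|].
- apply: measurable_funM => //.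
  rewrite (_ : (fun t => _) = (fun t => complex.Re (f t) * cos (2 * pi * dot t xi) +
      complex.Im (f t) * sin (2 * pi * dot t xi))).
    by apply: measurable_funD; exact: measurable_funM.
  by apply/funext => t; rewrite /fourier_kernel; case: (f t) => a b /=; ring.
- by apply: (le1 (fun t => complex.Re (f t * fourier_kernel t xi))) => t; exact: normr_Re_le.
- apply: measurable_funM => //.
  rewrite (_ : (fun t => _) = (fun t => complex.Im (f t) * cos (2 * pi * dot t xi) -
      complex.Re (f t) * sin (2 * pi * dot t xi))).
    by apply: measurable_funB; exact: measurable_funM.
  by apply/funext => t; rewrite /fourier_kernel; case: (f t) => a b /=; ring.
- by apply: (le1 (fun t => complex.Im (f t * fourier_kernel t xi))) => t; exact: normr_Im_le.
Qed.

Section step.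
Variables (n : nat) (f : n.-tuple R -> R[i]).
Hypotheses (f2 : cLp 2%:E f) (f1 : forall t, Normc.normc (f t) <= 1).

Let u : R -> R := \1_`[0, 1].
Let ext (t : n.+1.-tuple R) : R[i] := ((u (tnth t ord0))%:C%C * f (tail t)).

Let extE x t : ext (tuple_cons (x, t)) = (u x)%:C%C * f t.
Proof. by rewrite /ext tnth0 tail_tuple_cons. Qed.

Let normc_ext t : Normc.normc (ext t) = u (tnth t ord0) * Normc.normc (f (tail t)).
Proof.
by rewrite /ext /u indicE; case: (_ \in _);
  rewrite ?(mul1r, mul0r, Normc.normc0).
Qed.

Let ext_cmeasurable : cmeasurable ext.
Proof.
have [[mre mim] _] := f2.
have mu0 : measurable_fun setT (fun t : n.+1.-tuple R => u (tnth t ord0)).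
  apply: (measurableT_comp (f := u)); first by apply: measurable_indic; exact: measurable_itv.
  exact: measurable_tnth.
have mt : measurable_fun setT (fun t : n.+1.-tuple R => tail t) by exact: measurable_behead.
split.
  rewrite (_ : (fun t => _) = (fun t => u (tnth t ord0) * complex.Re (f (tail t)))).
    by apply: measurable_funM => //; exact: measurableT_comp mre mt.
  by apply/funext => t; rewrite /ext; case: (f _) => a b /=; ring.
rewrite (_ : (fun t => _) = (fun t => u (tnth t ord0) * complex.Im (f (tail t)))).
  by apply: measurable_funM => //; exact: measurableT_comp mim mt.
by apply/funext => t; rewrite /ext; case: (f _) => a b /=; ring.
Qed.

Let ext_L2 : cLp 2%:E ext.
Proof.
have le12 : 1 <= 2 :> R by rewrite ler1n.
split; first exact: ext_cmeasurable.
have [A A0 fA] := cLpP le12 f2; have mext := measurable_normc ext_cmeasurable.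
rewrite /cLnorm unlock; apply: poweR_lty.
rewrite (eq_integral (fun t => (Normc.normc (ext t) `^ 2)%:E)); last first.
  by move=> t _; rewrite /= ger0_norm ?normc_ge0.
rewrite ge0_integral_tuple_cons; last 2 first.
- by apply/measurable_EFinP; exact: (measurableT_comp (measurable_powR 2) mext).
- by move=> t; rewrite lee_fin powR_ge0.
have inner x : (\int[mu n]_t (Normc.normc (ext (tuple_cons (x, t))) `^ 2)%:E = A%:E * (u x)%:E)%E.
  rewrite -fA /u indicE; case: (boolP (x \in _)) => xI.
    by rewrite mule1; apply: eq_integral => t _; rewrite normc_ext tnth0 tail_tuple_cons /u indicE xI mul1r.
  rewrite mule0; apply: integral0_eq => t _.
  by rewrite normc_ext tnth0 /u indicE (negbTE xI) mul0r powR0// pnatr_eq0.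
under eq_integral do rewrite inner.
rewrite ge0_integralZl//; last 2 first.
- by apply/measurable_EFinP; apply: measurable_indic; exact: measurable_itv.
- by move=> x _; rewrite lee_fin.
rewrite integral_indic//.
rewrite setIT [X in (_ * X)%E](_ : _ = 1%:E) ?mule1 ?ltry//.
by rewrite /= lebesgue_measure_itv/= lte_fin ltr01 -EFinB subr0.
Qed.

Let a (x : R) := \int[la]_y (u y * cos (2 * pi * (y * x))).
Let b (x : R) := \int[la]_y (u y * sin (2 * pi * (y * x))).

Let iu (g : R -> R) : (forall y, `|g y| <= 1) -> measurable_fun setT g ->
  la.-integrable setT (EFin \o (fun y => u y * g y)).
Proof.
move=> g1 mg; apply: (@bounded_support_integrable _ _ _ la 1 `[0, 1]%classic).
split => //.
- by apply: measurable_funM => //; apply: measurable_indic; exact: measurable_itv.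
- exact: itv_lty.
- by move=> y; rewrite normrM mulrC ler_pM// ger0_norm.
Qed.

Let a_gt0 x : 0 < x < 1 / 2 -> 0 < a x.
Proof.
move=> /andP[x0 x1]; have p0 := pi_gt0 R.
have w0 : 0 < 2 * pi * x by rewrite !mulr_gt0.
have -> : a x = sin (2 * pi * x) / (2 * pi * x).
  transitivity (\int[la]_(y in `[0, 1]) cos (2 * pi * x * y)).
    rewrite Rintegral_indic; apply: eq_Rintegral => y _.
    by rewrite mulrC /u (mulrC y) mulrA.
  have dF y : is_derive y (1 : R) (fun y => sin (2 * pi * x * y) / (2 * pi * x)) (cos (2 * pi * x * y)).
    have wn : 2 * pi * x != 0 by rewrite gt_eqF.
    by move: (2 * pi * x) wn => w wn; derive_tac; rewrite /=; field.
  rewrite /Rintegral (integral_FTC ler01 (fun y _ => dF y)).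
    by rewrite mulr0 sin0 mul0r subr0 mulr1.
  by move=> y _; continuous_tac.
apply: divr_gt0 => //; apply: sin_gt0_pi; rewrite w0/=.
by move: p0; set p := pi; clearbody p => p0; nra.
Qed.

Let cons_row (K : R) (r : 'rV[R]_n) : 'rV[R]_n.+1 :=
  \row_j (if unlift ord0 j is Some k then r ord0 k else K).

(** A first radius K >= 1 does not cut [0, 1], so the box integral is that of f times the transform
    a - i b of the indicator. Its modulus is at least a, which is positive for 0 < x0 < 1/2. *)
Let tensor_box_ge (x0 : R) (eta : n.-tuple R) (r : 'rV[R]_n) (K : R) :
  0 < x0 < 1 / 2 -> 1 <= K ->
  a x0 * Normc.normc (box_fourier_integral f r eta) <=
  Normc.normc (box_fourier_integral ext (cons_row K r) (tuple_cons (x0, eta))).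
Proof.
move=> x01 K1; set r' := cons_row K r; set xi := tuple_cons (x0, eta).
have a0 := a_gt0 x01.
have ext1 t : Normc.normc (ext t) <= 1.
  by rewrite normc_ext -[leRHS]mulr1 /u ler_pM ?normc_ge0 ?f1.
have [bRe bIm] := box_phase_bounded_support xi r' ext_cmeasurable ext1.
have [iRe iIm] := box_phase_bounded_support eta r f2.1 f1.
have {}iRe := bounded_support_integrable iRe; have {}iIm := bounded_support_integrable iIm.
have mlin : measurable_fun setT (fun y : R => 2 * pi * (y * x0)).
  by do 2 apply: measurable_funM => //.
have ic := iu (fun y => cos_max _) (measurable_fcos mlin).
have ms : measurable_fun setT (fun y : R => sin (2 * pi * (y * x0))).
  exact: measurable_fsin.
have is_ := iu (fun y => sin_max _) ms.
have boxE y t : u y * \1_(box r') (tuple_cons (y, t)) = u y * \1_(box r) t.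
  rewrite /u !(indicE _ `[0, 1]%classic); case: (boolP (y \in _)); last by rewrite !mul0r.
  rewrite inE/= in_itv/= => /andP[y0 y1]; rewrite !mul1r !indicE; congr (nat_of_bool _)%:R.
  apply/idP/idP; rewrite !inE => tr j.
    by have := tr (lift ord0 j); rewrite mxE tnthS liftK.
  rewrite mxE; case: (unliftP ord0 j) => [k ->|->]; first by rewrite tnthS; exact: tr.
  by rewrite tnth0 /=; apply/andP; split; lra.
have phE y t : fourier_kernel (tuple_cons (y, t)) xi =
    ((cos (2 * pi * (y * x0)) * cos (2 * pi * dot t eta) -
      sin (2 * pi * (y * x0)) * sin (2 * pi * dot t eta))%R -i*
     (sin (2 * pi * (y * x0)) * cos (2 * pi * dot t eta) +
      cos (2 * pi * (y * x0)) * sin (2 * pi * dot t eta))%R)%C.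
  by rewrite /fourier_kernel dot_cons mulrDr cosD sinD.
set F := box_fourier_integral f r eta; set F' := box_fourier_integral ext r' xi.
have ReF' : complex.Re F' = a x0 * complex.Re F + b x0 * complex.Im F.
  transitivity (\int[mu n.+1]_(t in box r') complex.Re (ext t * fourier_kernel t xi)) => //.
  rewrite Rintegral_indic (Rintegral_tensor2 bRe ic is_ iRe iIm) => [|y t].
    by rewrite -!Rintegral_indic.
  rewrite phE extE; transitivity (u y * \1_(box r') (tuple_cons (y, t)) * (
      cos (2 * pi * (y * x0)) * complex.Re (f t * fourier_kernel t eta) +
      sin (2 * pi * (y * x0)) * complex.Im (f t * fourier_kernel t eta))).
    by rewrite /fourier_kernel; case: (f t) => p q /=; ring.
  by rewrite boxE; ring.
have ImF' : complex.Im F' = a x0 * complex.Im F + (- b x0) * complex.Re F.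
  transitivity (\int[mu n.+1]_(t in box r') complex.Im (ext t * fourier_kernel t xi)) => //.
  have is' : la.-integrable setT (EFin \o (fun y => -1 * (u y * sin (2 * pi * (y * x0))))).
    exact: (integrableZl measurableT (-1) is_).
  rewrite Rintegral_indic (Rintegral_tensor2 bIm ic is' iIm iRe) => [|y t].
    by rewrite -!Rintegral_indic RintegralZl// mulN1r.
  rewrite phE extE; transitivity (u y * \1_(box r') (tuple_cons (y, t)) * (
      cos (2 * pi * (y * x0)) * complex.Im (f t * fourier_kernel t eta) -
      sin (2 * pi * (y * x0)) * complex.Re (f t * fourier_kernel t eta))).
    by rewrite /fourier_kernel; case: (f t) => p q /=; ring.
  by rewrite boxE; ring.
rewrite !normcE ReF' ImF'; move: (complex.Re F) (complex.Im F) (a x0) (b x0) a0 => X Y c d c0.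
rewrite -[X in X * _](ger0_norm (ltW c0)) -sqrtr_sqr -sqrtrM ?sqr_ge0// ler_wsqrtr//.
rewrite -subr_ge0 [leRHS](_ : _ = d ^+ 2 * (X ^+ 2 + Y ^+ 2)); last by ring.
by rewrite mulr_ge0 ?addr_ge0 ?sqr_ge0.
Qed.

Lemma diverges_tensor (Q : set (n.-tuple R)) : diverges f Q ->
  diverges ext (cons_set `[1 / 8, 1 / 4]%classic Q).
Proof.
move=> [_ _ mQ Q0 fQ].
have mI : measurable (`[1 / 8, 1 / 4]%classic : set R) by exact: measurable_itv.
split.
- exact: ext_L2.
- by move=> t; rewrite normc_ext -[leRHS]mulr1 /u ler_pM ?normc_ge0 ?f1.
- exact: measurable_cons_set.
- apply: cons_set_gt0 => //; rewrite lebesgue_measure_itv/= lte_fin ifT; last by lra.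
  by rewrite -EFinB lte_fin; lra.
move=> xi [/= x0 etaQ] K M; rewrite in_itv/= in x0.
have {}x0 : 0 < tnth xi ord0 < 1 / 2 by move: x0; set z := tnth _ _; lra.
have a0 := a_gt0 x0.
have [r [Kr Mr]] := fQ _ etaQ K (M / a (tnth xi ord0)).
(* The new radius must be at least 1 to leave the indicator uncut, and larger than K. *)
exists (cons_row (Num.max 1 (K + 1)) r); split.
  move=> j; rewrite mxE; case: (unliftP ord0 j) => [k _|_]; first exact: Kr.
  by rewrite lt_max ltrDl ltr01 orbT.
have -> : xi = tuple_cons (tnth xi ord0, tail xi).
  by apply: eq_from_tnth => j; case: (unliftP ord0 j) => [k ->|->];
    rewrite ?tnth0 ?tnthS// !(tnth_nth 0)/= nth_behead.
apply: lt_le_trans (tensor_box_ge _ _ x0 _); last by rewrite le_max lexx.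
by move: Mr; rewrite ltr_pdivrMr// mulrC.
Qed.

End step.

Lemma exists_diverges n : (2 <= n)%N -> exists f Q, @diverges n f Q.
Proof.
case: n => [|[|n]]// _; elim: n => [|n [f [Q fQ]]]; first exact: diverges2.
have [f2 f1 _ _ _] := fQ.
by exists (fun t => (\1_`[0, 1]%classic (tnth t ord0))%:C%C * f (tail t)),
  (cons_set `[1 / 8, 1 / 4]%classic Q); exact: diverges_tensor.
Qed.
End tensor.

(** * Conclusion: infinite upper limits and failure of the weak estimate *)

Lemma limf_esup_diverges {R : realType} n (f : n.-tuple R -> R[i]) Q xi :
  diverges f Q -> Q xi ->
  limf_esup (fun r => (Normc.normc (box_fourier_integral f r xi))%:E) all_pinfty = +oo%E.
Proof.
move=> [_ _ _ _ fQ] Qxi; apply/eqyP => a a0; apply: le_ereal_inf_tmp => _ [V [M MV] <-].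
have [r [Mr ar]] := fQ xi Qxi M a.
apply: (@le_trans _ _ (Normc.normc (box_fourier_integral f r xi))%:E).
  by rewrite lee_fin ltW.
by apply: ereal_sup_ubound; exists r => //; exact: MV.
Qed.

(** The maximal function is infinite on Q, so every superlevel set contains Q and the quasinorm is
    at least a |Q|^(1/2) for all a > 0, whereas the right-hand side is finite. *)
Lemma diverges_not_weak_type {R : realType} n (f : n.-tuple R -> R[i]) Q (C : R) :
  diverges f Q -> ~ (weakL2norm (maximal_fourier f) <= C%:E * cLnorm 2%:E f)%E.
Proof.
move=> [f2 _ mQ Q0 fQ] wf.
have le12 : 1 <= 2 :> R by rewrite ler1n.
have mM := measurable_maximal_fourier le12 f2.
have [c cE] : exists c : R, (C%:E * cLnorm 2%:E f = c%:E)%E.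
  have [_] := f2; have := cLnorm_ge0 2%:E f; case: (cLnorm _ _) => [l| |]// _ _.
  by exists (C * l).
rewrite cE in wf.
pose m := (@lebesgue_Rn R n Q `^ 2^-1)%E.
have m0 : (0 < m)%E by exact: poweR_gt0.
have am (a : R) : 0 < a -> (a%:E * m <= c%:E)%E.
  move=> a0; apply: le_trans wf; apply: le_trans (ereal_sup_ubound _); last by exists a.
  rewrite lee_wpmul2l ?lee_fin ?(ltW a0)//.
  apply: gt0_ler_poweR; rewrite ?invr_ge0// ?in_itv/= ?leey ?measure_ge0//.
  apply: le_measure; rewrite ?inE//.
    have mabs : measurable_fun setT (fun xi => `|maximal_fourier f xi|%E).
      exact: measurableT_comp.
    have := mabs; move=> /(_ measurableT _ (emeasurable_itv `]a%:E, +oo[)); rewrite setTI.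
    by congr measurable; apply/seteqP; split => xi /=; rewrite in_itv/= andbT.
  move=> xi Qxi /=; rewrite gee0_abs ?maximal_fourier_ge0//.
  have [r [r0 ar]] := fQ xi Qxi 0 a.
  by apply: lt_le_trans (maximal_fourier_ge f xi r0); rewrite lte_fin -box_fourier_cut.
case: m m0 am => [m| |]// m0 am.
  rewrite lte_fin in m0.
  (* This height makes the left-hand side equal to |c| + 1; if Q has infinite measure, height 1 is
     enough. *)
  have := am ((`|c| + 1) / m) (divr_gt0 (ltr_wpDl (normr_ge0 c) ltr01) m0).
  rewrite -EFinM lee_fin divfK ?gt_eqF//; have := ler_norm c; lra.
by have := am 1 ltr01; rewrite mul1e.
Qed.

Theorem theorem4 (R : realType) (d : nat) (hd : (1 <= d)%N) :
  (forall p : R, 1 <= p -> p < 2 ->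
     exists C : R, forall f : d.-tuple R -> R[i], cLp p%:E f ->
       ('N[@lebesgue_Rn R d]_(hoelder_conjugate p%:E)[maximal_fourier f]
          <= C%:E * cLnorm p%:E f)%E /\
       {ae @lebesgue_Rn R d, forall xi,
         (box_fourier_integral f r xi : R[i]^o) @[r --> all_pinfty]
           --> (fourier p%:E f xi : R[i]^o)})
  /\
  ((2 <= d)%N ->
     (exists (f : d.-tuple R -> R[i]) (Q : set (d.-tuple R)),
        [/\ cLp 2%:E f, measurable Q, (0 < @lebesgue_Rn R d Q)%E &
          forall xi, Q xi ->
            limf_esup (fun r => (Normc.normc (box_fourier_integral f r xi))%:E)
              all_pinfty = +oo%E]) /\
     ~ (exists C : R, forall f : d.-tuple R -> R[i], cLp 2%:E f ->
          (weakL2norm (maximal_fourier f) <= C%:E * cLnorm 2%:E f)%E)).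
Proof.
split=> [p p1 p2|d2]; first exact: carleson_subquadratic.
have [f [Q fQ]] := @exists_diverges R d d2; have [f2 _ mQ Q0 _] := fQ; split.
  by exists f, Q; split => // xi; exact: limf_esup_diverges fQ.
by move=> [C HC]; exact: (diverges_not_weak_type fQ (HC f f2)).
Qed.
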